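(* Let $\mathfrak{n}$ be a $7$-dimensional $2$-step nilpotent real Lie algebra that admits coclosed $\mathrm{G}_2$-structures. Then there exists a coclosed $\mathrm{G}_2$-structure $\varphi$ on $\mathfrak{n}$ whose induced metric $g_\varphi$ is the nilsoliton metric of $\mathfrak{n}$.
   Context: A Lie algebra is $2$-step nilpotent if it is non-abelian and its derived algebra is contained in its center. $\mathrm{d}$ denotes the Chevalley-Eilenberg differential on $\Lambda^\bullet\mathfrak{n}^*$ ($\mathrm{d}\alpha(x,y)=-\alpha([x,y])$ for $\alpha\in\mathfrak{n}^*$, extended as a graded derivation). A $\mathrm{G}_2$-structure on a $7$-dimensional real vector space $V$ is a $3$-form $\varphi\in\Lambda^3V^*$ such that $(v\lrcorner\varphi)\wedge(v\lrcorner\varphi)\wedge\varphi\neq0$ for all $v\in V\smallsetminus\{0\}$. It determines a unique inner product $g_\varphi$ and orientation, with volume form $\mathrm{vol}_\varphi$, such that $g_\varphi(v,w)\mathrm{vol}_\varphi=\frac16\,(v\lrcorner\varphi)\wedge(w\lrcorner\varphi)\wedge\varphi$; $*_\varphi$ is the corresponding Hodge operator. A $\mathrm{G}_2$-structure $\varphi$ on $\mathfrak{n}$ is coclosed if $\mathrm{d}*_\varphi\varphi=0$. A nilsoliton metric on a nilpotent Lie algebra $\mathfrak{n}$ is an inner product $g$ whose Ricci endomorphism (that of the corresponding left-invariant Riemannian metric on the simply connected Lie group with Lie algebra $\mathfrak{n}$) is of the form $\mathrm{Rc}(g)=\lambda\,\mathrm{Id}+D$ for some $\lambda\in\mathbb{R}$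 and some derivation $D$ of $\mathfrak{n}$. It is known that every $7$-dimensional $2$-step nilpotent Lie algebra admits a nilsoliton metric, unique up to automorphism and scaling. *)

(* Defs.v *)
From HB Require Import structures.
From mathcomp Require Import all_boot all_order all_fingroup all_algebra.
From mathcomp Require Import reals.

Set Implicit Arguments.
Unset Strict Implicit.
Unset Printing Implicit Defensive.

Import Order.TTheory GRing.Theory Num.Theory.
Local Open Scope ring_scope.

Section ExteriorAlgebra.
Variables (R : realType) (V : vectType R).

Definition multilinear_map k (f : k.-tuple V -> R) : Prop :=
  forall (x : k.-tuple V) (i : 'I_k),
    scalar (fun v => f [tuple dfwith (tnth x) (i := i) v j | j < k]).

Definition alternating_map k (f : k.-tuple V -> R) : Prop :=
  forall (x : k.-tuple V) (i j : 'I_k),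
    i != j -> tnth x i = tnth x j -> f x = 0.

(* The elements of Lambda^k V^*.  The operations below are defined on all
   functions of k vectors, so that no closure proof is needed to state them. *)
Record altform k := AltForm {
  altform_fun :> k.-tuple V -> R;
  altform_multilinear : multilinear_map altform_fun;
  altform_alternating : alternating_map altform_fun }.

Definition interior_product k (v : V) (f : k.+1.-tuple V -> R)
    (x : k.-tuple V) : R :=
  f [tuple of v :: x].

(* Normalised so that (a /\ b)(x, y) = a x * b y - a y * b x on 1-forms. *)
Definition wedge_product p q (f : p.-tuple V -> R) (h : q.-tuple V -> R)
    (x : (p + q).-tuple V) : R :=
  ((p`! * q`!)%:R)^-1 *
  \sum_(s : 'S_(p + q))
     (-1) ^+ s * f [tuple tnth x (s (lshift q i)) | i < p]
               * h [tuple tnth x (s (rshift p i)) | i < q].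

(* {dot V for idfun} is the library's type of symmetric positive definite
   bilinear forms, i.e. of inner products on the real vector space V. *)
Implicit Types g : {dot V for idfun}.

(* The inner product of two p-forms for which the e^I = e^i1 /\ ... /\ e^ip,
   i1 < ... < ip, are orthonormal, e being a g-orthonormal basis. *)
Definition form_dot n p (e : n.-tuple V) (a b : p.-tuple V -> R) : R :=
  \sum_(I : p.-tuple 'I_n | sorted ltn [seq val i | i <- I])
     a [tuple of map (tnth e) I] * b [tuple of map (tnth e) I].

(* The Riemannian volume form of g for one of the two orientations of V,
   where n = \dim V. *)
Definition volume_form n g (vol : altform n) : Prop :=
  forall e : n.-tuple V, orthonormal g e -> `|vol e| = 1.

(* c = *b, where p + q = \dim V: a /\ *b = <a, b> vol for all p-forms a. *)
Definition hodge_dual p q g (vol : altform (p + q))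
    (b : altform p) (c : altform q) : Prop :=
  forall e : (p + q).-tuple V, orthonormal g e ->
  forall a : altform p,
    wedge_product a c =1 (fun x => form_dot e a b * vol x).

(* (v _| phi) /\ (w _| phi) /\ phi *)
Definition G2_density (phi : altform 3) (v w : V) : 7.-tuple V -> R :=
  wedge_product
    (wedge_product (interior_product v phi) (interior_product w phi)) phi.

Definition G2_structure (phi : altform 3) : Prop :=
  forall v, v != 0 -> ~ (G2_density phi v v =1 (fun=> 0)).

(* g = g_phi and vol = vol_phi: the inner product and the orientation, encoded
   by the volume form, are determined by these two conditions. *)
Definition G2_induced (phi : altform 3) g (vol : altform 7) : Prop :=
  volume_form g vol /\
  forall v w x, g v w * vol x = 6%:R^-1 * G2_density phi v w x.

End ExteriorAlgebra.

Section LieAlgebra.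
Variables (R : realType) (V : vectType R).

Record lie_algebra := LieAlgebra {
  bracket :> {bilinear V -> V -> V};
  bracket_alternating : forall x, bracket x x = 0;
  bracket_jacobi : forall x y z,
    bracket x (bracket y z) + bracket y (bracket z x)
      + bracket z (bracket x y) = 0 }.

Variable L : lie_algebra.

Definition abelian_lie : Prop := forall x y, L x y = 0.

Definition lie_center (z : V) : Prop := forall x, L z x = 0.

(* Scalars are absorbed by the brackets, so sums of brackets form a space. *)
Definition lie_derived (z : V) : Prop :=
  exists (n : nat) (x y : 'I_n -> V), z = \sum_i L (x i) (y i).

Definition two_step_nilpotent : Prop :=
  ~ abelian_lie /\ forall z, lie_derived z -> lie_center z.

Definition derivation (D : 'End(V)) : Prop :=
  forall x y, D (L x y) = L (D x) y + L x (D y).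

(* The Chevalley-Eilenberg differential, i.e. the graded derivation extending
   d a (x, y) = - a [x, y], evaluated on a (k+1)-form:
     d a (x_0, ..., x_{k+1}) =
       sum_{i < j} (-1)^(i+j) a ([x_i, x_j], the x_m with m <> i, j).
   The position of the second omitted vector is written lift i j, where i <= j,
   and is thus j+1. *)
Definition ce_diff k (a : k.+1.-tuple V -> R) (x : k.+2.-tuple V) : R :=
  \sum_(i < k.+2) \sum_(j < k.+1 | (i <= j)%N)
     (-1) ^+ (i + lift i j) *
     a [tuple of L (tnth x i) (tnth x (lift i j))
              :: [tuple tnth x (lift i (lift j m)) | m < k]].

Lemma ce_diff1 (a : 1.-tuple V -> R) (x y : V) :
  ce_diff a [tuple x; y] = - a [tuple L x y].
Proof.
rewrite /ce_diff !big_ord_recl !big_ord0 !big_mkcond !big_ord_recl !big_ord0 /=.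
rewrite !addr0 /= expr1 mulN1r; congr (- a _).
by apply: val_inj; rewrite /= enum_ord0.
Qed.

Definition coclosed (phi : altform V 3) : Prop :=
  exists (g : {dot V for idfun}) (vol : altform V 7) (psi : altform V 4),
    [/\ G2_induced phi g vol,
        hodge_dual (p := 3) (q := 4) g vol phi psi
      & ce_diff psi =1 (fun=> 0)].

(* Left-invariant vector fields are identified with elements of V, on which
   the Levi-Civita connection restricts to a bilinear map V -> V -> V. *)
Definition levi_civita (g : {dot V for idfun})
    (nabla : {bilinear V -> V -> V}) : Prop :=
  (forall x y, nabla x y - nabla y x = L x y) /\
  (forall x y z, g (nabla x y) z + g y (nabla x z) = 0).

Definition curvature (nabla : {bilinear V -> V -> V}) (x y z : V) : V :=
  nabla x (nabla y z) - nabla y (nabla x z) - nabla (L x y) z.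

Definition endo_trace (f : V -> V) : R :=
  \sum_(i < \dim {:V}) coord (vbasis {:V}) i (f (vbasis {:V})`_i).

Definition ricci_tensor (nabla : {bilinear V -> V -> V}) (y z : V) : R :=
  endo_trace (fun x => curvature nabla x y z).

Definition ricci_endomorphism (g : {dot V for idfun}) (Rc : 'End(V)) : Prop :=
  exists nabla : {bilinear V -> V -> V},
    levi_civita g nabla /\ forall y z, g (Rc y) z = ricci_tensor nabla y z.

Definition nilsoliton (g : {dot V for idfun}) : Prop :=
  exists (Rc : 'End(V)) (lambda : R) (D : 'End(V)),
    [/\ ricci_endomorphism g Rc,
        derivation D
      & Rc = lambda *: \1%VF + D].

End LieAlgebra.

(* Main.v *)
(** In a basis e0, ..., e6 consider the 2-step nilpotent brackets given by

      - d e^4 = c0 e^03 + c1 e^12,    - d e^5 = c2 e^02 - c3 e^13,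
      - d e^6 = c4 e^01 + c5 e^23 + c6 e^45.

    The standard G2-structure for which this basis is orthonormal is coclosed
    for all values of the c_i, and for suitable c_i in {-1, 0, 1} its metric is
    a nilsoliton.  So it suffices to bring the brackets to this form.

    Let D be the derived algebra; its dimension is at most 3, since a complement
    of D generates and \dim D <= 'C(7 - \dim D, 2).  If \dim D = 1, the bracket is
    a 2-form, and a symplectic basis does it.  If \dim D = 3, the brackets span a
    space W of 2-forms on the 4-dimensional quotient by D.  Diagonalise the
    quadratic form B |-> B /\ B on W.  When B1 /\ B1 <> 0, the forms B orthogonal
    to B1 are B1(x A, y) for operators A that square to scalars and that
    anticommute when the forms are orthogonal, and a basis x, y, x A, y A gives
    the normal form.  Isotropic forms are decomposable, and treated directly.

    If \dim D = 2, coclosedness yields a central u outside D, so that D + <u> can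
    play the role of D.  Namely, let p, q be an orthonormal basis of D and u a
    radical vector of the 2-form sigma = psi(p, q, ., .) on a complement of D,
    which has odd dimension 5.  Contracting d psi = 0 with u and q leaves
    alpha /\ sigma = 0 where alpha = g(p, [u, .]).  If alpha <> 0, then sigma
    vanishes on ker alpha; hence phi(v, ., .) vanishes on the orthogonal of
    p, q for v orthogonal to ker alpha, and then the density of phi vanishes
    at v, which is impossible. *)

Require Import Defs.
From HB Require Import structures.
From mathcomp Require Import all_boot all_order all_fingroup all_algebra.
From mathcomp Require Import reals.
From mathcomp Require Import ring lra zify.

Set Implicit Arguments.
Unset Strict Implicit.
Unset Printing Implicit Defensive.

Import Order.TTheory GRing.Theory Num.Theory.
Local Open Scope ring_scope.

(** * Alternating forms and monomials *)

(** Why the model is coclosed for all c: put w_4 = e^03 + e^12, w_5 = e^02 - e^13, w_6 = e^01 +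
    e^23. Then phi is the sum of e^456 and the e^k /\ w_k, and its dual is e^0123 + w_4 /\ e^56 -
    w_5 /\ e^46 + w_6 /\ e^45. In the differential of the dual, w_j meets only d e^k with k <> j,
    and either half of w_k has zero wedge with w_j; the term c6 e^45 always meets e^4 or e^5. So the
    two halves of each w_k may be weighted independently, which is the freedom that the normal forms
    of the brackets need. Weights in {-1, 0, 1} suffice because a nonzero real ratio of B /\ B to B1
    /\ B1 can be scaled to a sign. This leaves finitely many models, and density, Hodge dual,
    closedness and Ricci tensor are decided by integer computation: forms become lists of
    coefficients and indices, and evaluation is shown to respect the operations. The obstacle is
    \dim D = 2: the brackets are then forms on a 5-dimensional quotient and need not descend to a
    4-dimensional one. Coclosedness is what makes them descend. *)

Lemma big_tuple_cons (A : nmodType) (T : finType) n (F : n.+1.-tuple T -> A) :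
  \sum_(t : n.+1.-tuple T) F t = \sum_i \sum_(t : n.-tuple T) F [tuple of i :: t].
Proof.
rewrite pair_big /=.
rewrite (reindex (fun p : T * n.-tuple T => [tuple of p.1 :: p.2])) //=.
exists (fun t => (thead t, [tuple of behead t])) => [[i t] _|t _] /=.
  by congr pair; apply: val_inj.
by rewrite [RHS](tuple_eta t).
Qed.

Lemma big_tuple0 (A : nmodType) (T : finType) (F : 0.-tuple T -> A) :
  \sum_(t : 0.-tuple T) F t = F [tuple].
Proof.
rewrite (bigD1 [tuple]) //= big1 ?addr0 // => t /eqP[]; exact: tuple0.
Qed.

Lemma sum_tuple_prod (R : comPzRingType) (T : finType) n (G : 'I_n -> T -> R) :
  \sum_(t : n.-tuple T) \prod_(k < n) G k (tnth t k) =
  \prod_(k < n) \sum_i G k i.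
Proof.
elim: n G => [|n IH] G; first by rewrite big_tuple0 !big_ord0.
rewrite big_tuple_cons big_ord_recl mulr_suml; apply: eq_bigr => i _.
rewrite -IH mulr_sumr; apply: eq_bigr => t _; rewrite big_ord_recl; congr (_ * _).
by apply: eq_bigr => k _; rewrite tnthS.
Qed.

Section Multilinear.
Variables (R : realType) (V : vectType R).

Definition subst_tuple k (x : k.-tuple V) (i : 'I_k) (v : V) : k.-tuple V :=
  [tuple dfwith (tnth x) (i := i) v j | j < k].

Lemma tnth_subst k (x : k.-tuple V) i v j :
  tnth (subst_tuple x i v) j = if j == i then v else tnth x j.
Proof.
rewrite tnth_mktuple; case: eqVneq => [->|ji]; first exact: dfwith_in.
by rewrite dfwith_out // eq_sym.
Qed.

Lemma interior_multilinear k (a : k.+1.-tuple V -> R) v :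
  multilinear_map a -> multilinear_map (interior_product v a).
Proof.
move=> ma x i; have H := ma [tuple of v :: x] (lift ord0 i).
have E u : [tuple of v :: subst_tuple x i u] =
           subst_tuple [tuple of v :: x] (lift ord0 i) u.
  apply: eq_from_tnth => j; rewrite tnth_subst.
  case: (unliftP ord0 j) => [j'|] ->; last by rewrite !tnth0.
  by rewrite (inj_eq lift_inj) !tnthS tnth_subst.
move=> c u w; rewrite /interior_product.
by rewrite !E; apply: H.
Qed.

Lemma multilinear_head k (a : k.+1.-tuple V -> R) (x : k.-tuple V) :
  multilinear_map a -> scalar (fun v => a [tuple of v :: x]).
Proof.
move=> ma; have E u : [tuple of u :: x] = subst_tuple [tuple of 0 :: x] ord0 u.
  apply: eq_from_tnth => j; rewrite tnth_subst.
  case: (unliftP ord0 j) => [j'|] ->; last by rewrite tnth0 eqxx.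
  by rewrite /= !tnthS.
by move=> c u w /=; rewrite (E u) (E w) (E (c *: u + w)); apply: ma.
Qed.

Lemma scalar_sum (h : V -> R) (I : finType) (c : I -> R) (e : I -> V) :
  scalar h -> h (\sum_i c i *: e i) = \sum_i c i * h (e i).
Proof.
move=> hs; have h0 : h 0 = 0.
  by have := hs 1 0 0; rewrite scale1r addr0 mul1r => /eqP; rewrite -subr_eq subrr => /eqP.
elim/big_ind2: _ => // [y1 x1 y2 x2 <- <-|i _].
  by have := hs 1 x1 x2; rewrite scale1r mul1r.
by have := hs (c i) (e i) 0; rewrite addr0 h0 addr0.
Qed.

Lemma multilinear_expand k n (a : k.-tuple V -> R) (c : 'I_k -> 'I_n -> R)
    (e : 'I_n -> V) :
  multilinear_map a ->
  a [tuple \sum_j c i j *: e j | i < k] =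
  \sum_(I : k.-tuple 'I_n) (\prod_i c i (tnth I i)) * a [tuple of map e I].
Proof.
elim: k a c => [|k IH] a c ma.
  by rewrite big_tuple0 big_ord0 mul1r; congr a; apply: val_inj; rewrite /= enum_ord0.
rewrite big_tuple_cons.
have -> : [tuple \sum_j c i j *: e j | i < k.+1] =
  [tuple of (\sum_j c ord0 j *: e j) :: [tuple \sum_j c (lift ord0 i) j *: e j | i < k]].
  apply: eq_from_tnth => j; rewrite tnth_mktuple.
  by case: (unliftP ord0 j) => [j'|] ->; rewrite ?tnth0 // tnthS tnth_mktuple.
rewrite (scalar_sum _ _ (multilinear_head _ ma)); apply: eq_bigr => j _.
have := IH (interior_product (e j) a) (fun i => c (lift ord0 i))
  (interior_multilinear _ ma).
rewrite {1}/interior_product => ->; rewrite mulr_sumr; apply: eq_bigr => I _.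
rewrite big_ord_recl mulrA tnth0; congr (_ * _ * _).
  by apply: eq_bigr => i _; rewrite tnthS.
by congr a; apply: val_inj.
Qed.

(** Polarisation: expand [a] with x_i + x_j placed in both slots. *)
Lemma alternating_tperm k (a : altform V k) (x : k.-tuple V) (i j : 'I_k) :
  i != j -> a [tuple tnth x (tperm i j m) | m < k] = - a x.
Proof.
move=> ij; pose S u w := subst_tuple (subst_tuple x i u) j w.
have addl u u' w : a (S (u + u') w) = a (S u w) + a (S u' w).
  have C v : S v w = subst_tuple (subst_tuple x j w) i v.
    apply: eq_from_tnth => m; rewrite !tnth_subst.
    by case: (eqVneq m j) => [->|//]; rewrite eq_sym (negPf ij).
  rewrite !C; have := altform_multilinear a (subst_tuple x j w) i 1 u u'.
  by rewrite scale1r mul1r.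
have addr u w w' : a (S u (w + w')) = a (S u w) + a (S u w').
  have := altform_multilinear a (subst_tuple x i u) j 1 w w'.
  by rewrite scale1r mul1r.
have alt u : a (S u u) = 0.
  apply: (altform_alternating a (i := i) (j := j)) => //.
  by rewrite !tnth_subst (negPf ij) !eqxx.
have := alt (tnth x i + tnth x j); rewrite addl !addr !alt add0r addr0.
have -> : S (tnth x i) (tnth x j) = x.
  apply: eq_from_tnth => m; rewrite !tnth_subst.
  by case: (eqVneq m j) => [->|_] //; case: eqVneq => [->|].
have -> : S (tnth x j) (tnth x i) = [tuple tnth x (tperm i j m) | m < k].
  apply: eq_from_tnth => m; rewrite !tnth_subst tnth_mktuple.
  by case: tpermP => [->|->|/eqP/negPf-> /eqP/negPf->]; rewrite ?eqxx ?(negPf ij).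
by move/eqP; rewrite addrC addr_eq0 => /eqP.
Qed.

Lemma alternating_perm k (a : altform V k) (x : k.-tuple V) (s : 'S_k) :
  a [tuple tnth x (s m) | m < k] = (-1) ^+ s * a x.
Proof.
have [ts -> dts] := prod_tpermP s; elim: ts dts x => [_|[i j] ts IH] /=.
  move=> x; rewrite big_nil odd_perm1 mul1r; congr (a _).
  by apply: eq_from_tnth => m; rewrite tnth_mktuple perm1.
case/andP=> ij dts x; rewrite big_cons odd_mul_tperm ij signr_addb expr1.
rewrite mulN1r mulNr -IH // -(alternating_tperm a _ ij); congr (a _).
by apply: eq_from_tnth => m; rewrite !tnth_mktuple permM.
Qed.

End Multilinear.

(** * Wedge products, linearly and on monomials *)

Section Wedge.
Variables (R : realType) (V : vectType R).

Lemma eq_wedge p q (a a' : p.-tuple V -> R) (b b' : q.-tuple V -> R) :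
  a =1 a' -> b =1 b' -> wedge_product a b =1 wedge_product a' b'.
Proof.
move=> ea eb x; rewrite /wedge_product; congr (_ * _).
by apply: eq_bigr => s _; rewrite ea eb.
Qed.

Lemma wedge_suml p q (I : Type) (r : seq I) (c : I -> R)
    (a : I -> p.-tuple V -> R) (b : q.-tuple V -> R) x :
  wedge_product (fun y => \sum_(i <- r) c i * a i y) b x =
  \sum_(i <- r) c i * wedge_product (a i) b x.
Proof.
rewrite /wedge_product; under [RHS]eq_bigr do rewrite mulrCA.
rewrite -mulr_sumr; congr (_ * _); under [RHS]eq_bigr do rewrite mulr_sumr.
rewrite exchange_big /=; apply: eq_bigr => s _.
rewrite mulr_sumr mulr_suml; apply: eq_bigr => i _.
by rewrite (mulrCA _ (c i)) -!mulrA.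
Qed.

Lemma wedge_sumr p q (I : Type) (r : seq I) (c : I -> R)
    (a : p.-tuple V -> R) (b : I -> q.-tuple V -> R) x :
  wedge_product a (fun y => \sum_(i <- r) c i * b i y) x =
  \sum_(i <- r) c i * wedge_product a (b i) x.
Proof.
rewrite /wedge_product; under [RHS]eq_bigr do rewrite mulrCA.
rewrite -mulr_sumr; congr (_ * _); under [RHS]eq_bigr do rewrite mulr_sumr.
rewrite exchange_big /=; apply: eq_bigr => s _.
by rewrite mulr_sumr; apply: eq_bigr => i _; rewrite mulrCA.
Qed.

End Wedge.

Section BlockPerm.
Variables (p q : nat) (s : 'S_p) (t : 'S_q).

Definition block_perm_fun (c : 'I_(p + q)) : 'I_(p + q) :=
  match split c with inl a => lshift q (s a) | inr b => rshift p (t b) end.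

Lemma block_perm_fun_inj : injective block_perm_fun.
Proof.
move=> c d; rewrite /block_perm_fun.
case: (split_ordP c) => a ->; case: (split_ordP d) => b -> E.
- by rewrite (perm_inj (lshift_inj E)).
- by move/eqP: E; rewrite eq_lrshift.
- by move/eqP: E; rewrite eq_rlshift.
- by rewrite (perm_inj (rshift_inj E)).
Qed.

Definition block_perm : 'S_(p + q) := perm block_perm_fun_inj.

Lemma block_perml a : block_perm (lshift q a) = lshift q (s a).
Proof. by rewrite permE /block_perm_fun (unsplitK (inl a)). Qed.

Lemma block_permr b : block_perm (rshift p b) = rshift p (t b).
Proof. by rewrite permE /block_perm_fun (unsplitK (inr b)). Qed.

Lemma sign_block_perm (R : comNzRingType) :
  (-1) ^+ block_perm = (-1) ^+ s * (-1) ^+ t :> R.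
Proof.
(* The sign is the determinant of the permutation matrix, which is block diagonal. *)
rewrite -!det_perm -(det_ublock _ 0); congr (\det _).
apply/matrixP => i j; rewrite !mxE.
case: (split_ordP i) => a ->; rewrite ?block_perml ?block_permr;
  case: (split_ordP j) => b ->; rewrite ?mxE ?eq_lshift ?eq_rshift ?eq_lrshift
  ?eq_rlshift ?(unsplitK (inl _)) ?(unsplitK (inr _)) ?mxE //.
Qed.

End BlockPerm.

Section Monomials.
Variables (R : realType) (V : vectType R) (xi : nat -> {scalar V}).

(** The value of e^i1 /\ ... /\ e^ip at x. If I is shorter than p, the default index 0 fills the
    missing columns, and entries beyond p are ignored; hence the size hypotheses below. *)
Definition monomial p (I : seq nat) (x : p.-tuple V) : R :=
  \det (\matrix_(a < p, b < p) xi (nth 0%N I b) (tnth x a)).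

Lemma monomial_multilinear p I : multilinear_map (@monomial p I).
Proof.
move=> x i c u v; rewrite /monomial -[in RHS](mul1r (\det _)).
rewrite -/(subst_tuple x i (c *: u + v)) -/(subst_tuple x i u) -/(subst_tuple x i v).
rewrite mul1r -[X in _ = _ + X]mul1r; apply: (@determinant_multilinear _ _ _ _ _ i).
- by apply/rowP => b; rewrite !mxE !tnth_subst eqxx linearP mul1r.
- by apply/matrixP => a b; rewrite !mxE !tnth_subst !(eq_sym _ i) !(negPf (neq_lift _ _)).
- by apply/matrixP => a b; rewrite !mxE !tnth_subst !(eq_sym _ i) !(negPf (neq_lift _ _)).
Qed.

Lemma monomial_alternating p I : alternating_map (@monomial p I).
Proof.
move=> x i j ij E; apply: (determinant_alternate ij) => b.
by rewrite !mxE E.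
Qed.

Definition monomial_form p I : altform V p :=
  AltForm (@monomial_multilinear p I) (@monomial_alternating p I).

Lemma monomialE p I (x : p.-tuple V) : monomial I x =
  \sum_(s : 'S_p) (-1) ^+ s * \prod_a xi (nth 0%N I (s a)) (tnth x a).
Proof.
by apply: eq_bigr => s _; congr (_ * _); apply: eq_bigr => a _; rewrite mxE.
Qed.

(** Expanding both determinants gives a sum over a shuffle s and a block permutation. For each fixed
    block permutation the sum over s is already the determinant for I ++ J, so this determinant
    occurs p! q! times, which cancels the normalisation of the wedge product. *)
Lemma wedge_monomial p q I J : size I = p -> size J = q ->
  wedge_product (@monomial p I) (@monomial q J) =1 monomial (I ++ J).
Proof.
move=> sI sJ x; rewrite /wedge_product.
pose X i c := xi (nth 0%N (I ++ J) c) (tnth x i).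
suff -> : \sum_(s : 'S_(p + q))
     (-1) ^+ s * monomial I [tuple tnth x (s (lshift q i)) | i < p]
               * monomial J [tuple tnth x (s (rshift p i)) | i < q] =
  \sum_(st : 'S_p * 'S_q) monomial (I ++ J) x.
  rewrite sumr_const card_prod !card_Sn -[monomial _ _ *+ _]mulr_natl mulrA.
  by rewrite mulVf ?mul1r // pnatr_eq0 -lt0n muln_gt0 !fact_gt0.
transitivity (\sum_(s : 'S_(p + q)) \sum_(st : 'S_p * 'S_q)
  (-1) ^+ s * (-1) ^+ (block_perm st.1 st.2) *
     \prod_c X (s c) (block_perm st.1 st.2 c)).
  apply: eq_bigr => s _; rewrite !monomialE -mulrA mulr_suml mulr_sumr.
  under eq_bigr do rewrite mulr_sumr mulr_sumr.
  rewrite pair_big /=; apply: eq_bigr => -[t u] _ /=.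
  rewrite sign_block_perm big_split_ord /= mulrACA !mulrA; congr (_ * _ * _).
    apply: eq_bigr => a _; rewrite block_perml /X tnth_mktuple nth_cat sI.
    by rewrite /= ltn_ord.
  apply: eq_bigr => b _; rewrite block_permr /X tnth_mktuple nth_cat sI.
  by rewrite /= ltnNge leq_addr addKn.
rewrite exchange_big /=; apply: eq_bigr => st _; move: (block_perm _ _) => t.
rewrite monomialE [RHS](reindex (fun s : 'S_(p + q) => s^-1 * t)%g) /=; last first.
  exists (fun s => t * s^-1)%g => s _; first by rewrite invMg invgK mulKVg.
  by rewrite invMg invgK mulgKV.
apply: eq_bigr => s _; rewrite odd_permM odd_permV signr_addb; congr (_ * _).
rewrite [RHS](reindex_inj (@perm_inj _ s)) /=.
by apply: eq_bigr => c _; rewrite permM permK.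
Qed.
End Monomials.

(** * Forms with integer coefficients *)

Definition rem_nth (b : nat) (I : seq nat) := take b I ++ drop b.+1 I.

Lemma size_rem_nth b I : (b < size I)%N -> size (rem_nth b I) = (size I).-1.
Proof. by move=> bI; rewrite size_cat (size_takel (ltnW bI)) size_drop; lia. Qed.

Lemma nth_rem_nth b I c : (b < size I)%N ->
  nth 0%N (rem_nth b I) c = nth 0%N I (bump b c).
Proof.
move=> bI; rewrite nth_cat (size_takel (ltnW bI)) /bump.
case: ltnP => cb; first by rewrite nth_take.
by rewrite nth_drop; congr nth; lia.
Qed.

(** Each entry passed changes the sign. A repeated index gives the sign 0, but the list still gets
    its full length, so that sizes stay predictable. *)
Fixpoint signed_insert (a : nat) (l : seq nat) : int * seq nat :=
  if l is b :: l' then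
    if (a < b)%N then (1, a :: l) else
    if a == b then (0, a :: l) else
    let r := signed_insert a l' in (- r.1, b :: r.2)
  else (1, [:: a]).

Fixpoint signed_sort (I : seq nat) : int * seq nat :=
  if I is a :: I' then
    let r := signed_sort I' in
    let q := signed_insert a r.2 in (r.1 * q.1, q.2)
  else (1, [::]).

Lemma size_signed_insert a l : size (signed_insert a l).2 = (size l).+1.
Proof. by elim: l => //= b l IH; case: ifP => // _; case: ifP => //= _; rewrite IH. Qed.

Lemma size_signed_sort I : size (signed_sort I).2 = size I.
Proof. by elim: I => //= a I IH; rewrite size_signed_insert IH. Qed.

(* A pair (c, [:: i1; ...; ip]) stands for the monomial c e^i1 /\ ... /\ e^ip. *)
Notation formal_form := (seq (int * seq nat)).

Definition homogeneous p (F : formal_form) := all (fun m => size m.2 == p) F.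

Fixpoint add_monomial (c : int) (I : seq nat) (F : formal_form) : formal_form :=
  if F is (d, J) :: F' then
    if I == J then (c + d, J) :: F' else (d, J) :: add_monomial c I F'
  else [:: (c, I)].

Fixpoint collect (F : formal_form) : formal_form :=
  if F is (c, J) :: F' then
    let r := signed_sort J in
    if r.1 == 0 then collect F' else add_monomial (c * r.1) r.2 (collect F')
  else [::].

(** The order of the terms is not normalised. The checks below compare only with lists of at most
    one term, where this is harmless. *)
Definition normal_form (F : formal_form) : formal_form :=
  [seq m <- collect F | m.1 != 0].

Definition formal_wedge (F G : formal_form) : formal_form :=
  [seq (m.1 * k.1, m.2 ++ k.2) | m <- F, k <- G].

Definition formal_interior (i : nat) (F : formal_form) : formal_form :=
  flatten [seq [seq ((-1) ^+ b * m.1, rem_nth b m.2)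
               | b <- iota 0 (size m.2) & nth 0%N m.2 b == i] | m <- F].

(* D k lists the terms c e^a /\ e^b of -d e^k. *)
Definition formal_diff (D : nat -> seq (int * (nat * nat))) (F : formal_form) :
    formal_form :=
  flatten [seq flatten [seq [seq (- ((-1) ^+ b * m.1 * d.1),
                                  d.2.1 :: d.2.2 :: rem_nth b m.2)
                            | d <- D (nth 0%N m.2 b)]
                       | b <- iota 0 (size m.2)] | m <- F].

Section FormalForms.
Variables (R : realType) (V : vectType R) (xi : nat -> {scalar V}).
Notation monomial := (monomial xi).

Lemma monomial_cons p I v (x : p.-tuple V) : size I = p.+1 ->
  monomial I [tuple of v :: x] =
  \sum_(b < p.+1) (-1) ^+ b * xi (nth 0%N I b) v * monomial (rem_nth b I) x.
Proof.
move=> sI; rewrite /monomial (expand_det_row _ ord0); apply: eq_bigr => b _.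
rewrite mxE /cofactor tnth0 add0n [RHS]mulrAC [RHS]mulrC.
congr (_ * (_ * \det _)); apply/matrixP => i j.
by rewrite !mxE tnthS nth_rem_nth // sI.
Qed.

Lemma monomial_cons_col p a J (x : p.+1.-tuple V) :
  monomial (a :: J) x =
  \sum_(i < p.+1) (-1) ^+ i * xi a (tnth x i)
                  * monomial J [tuple tnth x (lift i m) | m < p].
Proof.
rewrite /monomial (expand_det_col _ ord0); apply: eq_bigr => b _.
rewrite mxE /cofactor addn0 [RHS]mulrAC [RHS]mulrC.
congr (_ * (_ * \det _)); apply/matrixP => i j.
by rewrite !mxE tnth_mktuple.
Qed.

Lemma monomial_perm p I J (s : 'S_p) (x : p.-tuple V) :
  (forall b : 'I_p, nth 0%N J b = nth 0%N I (s b)) ->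
  monomial J x = (-1) ^+ s * monomial I x.
Proof.
move=> E; rewrite /monomial -[in RHS]det_tr -det_perm -det_mulmx -row_permE -[LHS]det_tr.
by congr (\det _); apply/matrixP => i j; rewrite !mxE E.
Qed.

Lemma monomial_swap p P a b Q (x : p.-tuple V) :
  size (P ++ a :: b :: Q) = p ->
  monomial (P ++ a :: b :: Q) x = - monomial (P ++ b :: a :: Q) x.
Proof.
rewrite size_cat /= => sI.
have i_lt : (size P < p)%N by lia.
have j_lt : ((size P).+1 < p)%N by lia.
pose i := Ordinal i_lt; pose j := Ordinal j_lt.
have ij : i != j by rewrite -val_eqE /= neq_ltn ltnSn.
rewrite (monomial_perm (I := P ++ b :: a :: Q) (s := tperm i j)) ?odd_tperm ?ij ?mulN1r //.
move=> c; rewrite !nth_cat.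
case: tpermP => [->|->|/eqP ci /eqP cj] /=.
- by rewrite ltnn subnn ltnNge leqnSn subSnn.
- by rewrite ltnn subnn ltnNge leqnSn subSnn.
- case: ltnP => // Pc; move: ci cj; rewrite -!val_eqE /= => ci cj.
  by case E: (c - size P)%N => [|[|m]] //=; lia.
Qed.

Lemma monomial_dup p P a Q (x : p.-tuple V) :
  size (P ++ a :: a :: Q) = p -> monomial (P ++ a :: a :: Q) x = 0.
Proof.
move=> sI; have := monomial_swap x sI; move: (monomial _ _) => m; lra.
Qed.

(** The prefix P carries the induction: every entry that [a] passes moves from the list to the end
    of P. *)
Lemma monomial_insert p P a l (x : p.-tuple V) : size (P ++ a :: l) = p ->
  monomial (P ++ a :: l) x =
  (signed_insert a l).1%:~R * monomial (P ++ (signed_insert a l).2) x.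
Proof.
elim: l P => [|b l IH] P sI /=; first by rewrite mul1r.
case: ltnP => [_|_] /=; first by rewrite mul1r.
case: (eqVneq a b) sI => [->|_] sI /=; first by rewrite mulr0z mul0r monomial_dup.
rewrite monomial_swap // -cat_rcons IH; last by rewrite -sI !size_cat !size_rcons /=; lia.
by rewrite cat_rcons mulrNz mulNr.
Qed.

Lemma monomial_sort p P I (x : p.-tuple V) : size (P ++ I) = p ->
  monomial (P ++ I) x = (signed_sort I).1%:~R * monomial (P ++ (signed_sort I).2) x.
Proof.
elim: I P => [|a I IH] P sI /=; first by rewrite mul1r.
rewrite -cat_rcons IH; last by rewrite cat_rcons.
rewrite cat_rcons monomial_insert; first by rewrite rmorphM mulrA.
by rewrite -sI !size_cat /= size_signed_sort.
Qed.

Definition form_eval p (F : formal_form) (x : p.-tuple V) : R :=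
  \sum_(m <- F) m.1%:~R * monomial m.2 x.
Arguments form_eval : clear implicits.

Lemma form_eval_add p c I F (x : p.-tuple V) :
  form_eval p (add_monomial c I F) x = c%:~R * monomial I x + form_eval p F x.
Proof.
rewrite /form_eval; elim: F => [|[d J] F IH] /=; first by rewrite big_seq1 big_nil addr0.
case: eqP => [->|_]; rewrite !big_cons /= ?IH; last by rewrite addrCA.
by rewrite intrD mulrDl addrA.
Qed.

Lemma form_eval_normal p F (x : p.-tuple V) : homogeneous p F ->
  form_eval p F x = form_eval p (normal_form F) x.
Proof.
move=> hF; transitivity (form_eval p (collect F) x).
  elim: F hF => [|[c I] F IH] //= /andP[/eqP sI hF].
  rewrite {1}/form_eval big_cons /= -/(form_eval p F x) (monomial_sort (P := [::])) //.
  case: eqP => [->|_]; first by rewrite mulr0z mul0r mulr0 add0r IH.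
  by rewrite form_eval_add -IH // mulrA rmorphM.
rewrite /form_eval /normal_form big_filter [LHS](bigID (fun m => m.1 != 0)) /=.
by rewrite [X in _ + X]big1 ?addr0 // => m /negPn/eqP ->; rewrite mul0r.
Qed.

Lemma form_eval_wedge p q F G : homogeneous p F -> homogeneous q G ->
  wedge_product (form_eval p F) (form_eval q G) =1 form_eval (p + q) (formal_wedge F G).
Proof.
move=> /allP hF /allP hG x; rewrite /form_eval /formal_wedge big_allpairs_dep /=.
rewrite (wedge_suml F (fun m => m.1%:~R) (fun m => monomial m.2)).
rewrite big_seq [RHS]big_seq; apply: eq_bigr => m /hF/eqP sm.
rewrite (wedge_sumr G (fun m => m.1%:~R) _ (fun m => monomial m.2)).
rewrite mulr_sumr big_seq [RHS]big_seq; apply: eq_bigr => k /hG/eqP sk.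
by rewrite wedge_monomial // rmorphM mulrA.
Qed.

(** Here v is the i-th frame vector, so the Laplace expansion along its row keeps only the slots
    that hold the index i. *)
Lemma form_eval_interior p i v F : homogeneous p.+1 F ->
  (forall k, xi k v = (k == i)%:R) ->
  interior_product v (form_eval p.+1 F) =1 form_eval p (formal_interior i F).
Proof.
move=> hF xiv x; rewrite /interior_product /form_eval big_flatten big_map.
rewrite big_seq [RHS]big_seq; apply: eq_bigr => m /(allP hF)/eqP sm.
rewrite monomial_cons // big_map big_filter sm -[iota 0 p.+1]/(index_iota 0 p.+1).
rewrite big_mkord mulr_sumr [RHS]big_mkcond /=; apply: eq_bigr => b _.
rewrite xiv; case: eqP => _; last by rewrite mulr0 mul0r mulr0.
by rewrite mulr1 mulrA rmorphM rmorphXn rmorphN1 [_ * m.1%:~R]mulrC.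
Qed.

Lemma homogeneous_wedge p q F G : homogeneous p F -> homogeneous q G ->
  homogeneous (p + q) (formal_wedge F G).
Proof.
move=> /allP hF /allP hG; apply/allP => _ /allpairsP[[m k] /= [/hF/eqP sm /hG/eqP sk ->]].
by rewrite /= size_cat sm sk.
Qed.

Lemma homogeneous_interior p i F : homogeneous p.+1 F ->
  homogeneous p (formal_interior i F).
Proof.
move=> /allP hF; apply/allP => m /flatten_mapP[k /hF/eqP sk /mapP[b]].
rewrite mem_filter mem_iota add0n => /andP[_ bk] ->.
by rewrite size_rem_nth //= sk.
Qed.

Lemma homogeneous_diff p D F : homogeneous p.+1 F -> homogeneous p.+2 (formal_diff D F).
Proof.
move=> /allP hF; apply/allP => m /flatten_mapP[k /hF/eqP sk /flatten_mapP[b]].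
rewrite mem_iota add0n => bk /mapP[d _ ->].
by rewrite /= size_rem_nth //= sk.
Qed.

End FormalForms.

Arguments form_eval {R V} xi p F x.

(** * The differential of monomials *)

Section ChevalleyEilenberg.
Variables (R : realType) (V : vectType R) (xi : nat -> {scalar V}).
Notation monomial := (monomial xi).

(* The Laplace expansion along the first two columns; swapping the two
   removed rows pairs the terms with [j < i] with those with [i <= j]. *)
Lemma monomial_cons2 p a b J (x : p.+2.-tuple V) :
  \sum_(i < p.+2) \sum_(j < p.+1 | (i <= j)%N)
     (-1) ^+ (i + lift i j)
     * (xi a (tnth x i) * xi b (tnth x (lift i j))
        - xi b (tnth x i) * xi a (tnth x (lift i j)))
     * monomial J [tuple tnth x (lift i (lift j m)) | m < p]
  = - monomial [:: a, b & J] x.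
Proof.
pose T (i : 'I_p.+2) (j : 'I_p.+1) : R := (-1) ^+ (i + j)
     * (xi a (tnth x i) * xi b (tnth x (lift i j)))
     * monomial J [tuple tnth x (lift i (lift j m)) | m < p].
have -> : monomial [:: a, b & J] x = \sum_i \sum_j T i j.
  rewrite monomial_cons_col; apply: eq_bigr => i _.
  rewrite monomial_cons_col mulr_sumr; apply: eq_bigr => j _.
  rewrite /T exprD tnth_mktuple.
  set m1 := monomial _ _; set m2 := monomial _ _.
  have -> : m1 = m2.
    by congr (monomial _ _); apply: eq_from_tnth => m; rewrite !tnth_mktuple.
  ring.
transitivity (\sum_(i < p.+2) \sum_(j < p.+1 | (i <= j)%N)
  (- T i j + (-1) ^+ (i + j) * (xi b (tnth x i) * xi a (tnth x (lift i j)))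
     * monomial J [tuple tnth x (lift i (lift j m)) | m < p])).
  apply: eq_bigr => i _; apply: eq_bigr => j ij.
  by rewrite /T /= /bump ij addnCA exprS; ring.
under eq_bigr do rewrite big_split /=.
rewrite big_split /=.
under eq_bigr do rewrite sumrN.
rewrite sumrN.
have -> : \sum_i \sum_j T i j = \sum_(i < p.+2) \sum_(j < p.+1 | (i <= j)%N) T i j
    + \sum_(i < p.+2) \sum_(j < p.+1 | (j < i)%N) T i j.
  rewrite -big_split; apply: eq_bigr => i _ /=.
  rewrite (bigID (fun j : 'I_p.+1 => (i <= j)%N)) /=; congr (_ + _).
  by apply: eq_bigl => j; rewrite ltnNge.
rewrite opprD; congr (_ + _); rewrite -sumrN.
under [RHS]eq_bigr do rewrite -sumrN.
rewrite !pair_big_dep /=.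
(* For i <= j the vector removed second is number j+1, so the swapped pair is (j+1, i). Its inverse
   sends (i, j) with j < i to (j, i-1); [inord] only moves indices between the two ordinal types. *)
rewrite [RHS](reindex_onto
  (fun u : 'I_p.+2 * 'I_p.+1 => (lift u.1 u.2, inord u.1 : 'I_p.+1))
  (fun u : 'I_p.+2 * 'I_p.+1 => (inord u.2 : 'I_p.+2, inord u.1.-1 : 'I_p.+1))) /=;
  last first.
  move=> [i j] /= ji; have [ip jp] := (ltn_ord i, ltn_ord j).
  congr pair; apply: val_inj => /=; rewrite !inordK /bump; lia.
apply: eq_big => [[i j]|[i j]] /=; have [ip jp] := (ltn_ord i, ltn_ord j).
  apply/idP/andP => [ij|[]].
    split; first by rewrite inordK /bump; lia.
    by apply/eqP; congr pair; apply: val_inj => /=; rewrite !inordK /bump; lia.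
  have [ij|ij] := leqP i j => //.
  move=> lt_ij /eqP[/(congr1 val) /=]; rewrite inordK; last exact: ltnW (ltn_ord _).
  by move=> Ei; move: lt_ij; rewrite Ei /bump; lia.
move=> ij; have E m : lift (lift i j) (lift (inord i) m) = lift i (lift j m) :> 'I_p.+2.
  apply: val_inj => /=; rewrite inordK /bump; lia.
rewrite /T /=.
have -> : lift (lift i j) (inord i) = i :> 'I_p.+2.
  apply: val_inj => /=; rewrite inordK /bump; lia.
have -> : [tuple tnth x (lift (lift i j) (lift (inord i) m)) | m < p] =
          [tuple tnth x (lift i (lift j m)) | m < p].
  by apply: eq_from_tnth => m; rewrite !tnth_mktuple E.
have -> : ((-1) ^+ (lift i j + (inord i : 'I_p.+1)) : R) = - (-1) ^+ (i + j).
  by rewrite /= inordK /bump ?ij ?addSn ?exprS ?mulN1r ?[(j + i)%N]addnC //; lia.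
rewrite !mulNr opprK; congr (_ * _ * _); exact: mulrC.
Qed.
End ChevalleyEilenberg.

Section FormalDifferential.
Variables (R : realType) (V : vectType R) (xi : nat -> {scalar V}).
Variables (L : lie_algebra V) (D : nat -> seq (int * (nat * nat))).
Hypothesis structure_eq : forall k x y,
  xi k (L x y) = \sum_(d <- D k) d.1%:~R * (xi d.2.1 x * xi d.2.2 y - xi d.2.2 x * xi d.2.1 y).
Notation monomial := (monomial xi).

(** Expand along the row of the bracket, replace the b-th coordinate of the bracket by the structure
    equation, and let [monomial_cons2] reassemble each term. The 2-form may stand in front because
    its degree is even. *)
Lemma ce_diff_monomial p I (x : p.+2.-tuple V) : size I = p.+1 ->
  ce_diff L (@monomial p.+1 I) x =
  \sum_(b < p.+1) \sum_(d <- D (nth 0%N I b))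
     - ((-1) ^+ b * d.1%:~R) * monomial [:: d.2.1, d.2.2 & rem_nth b I] x.
Proof.
move=> sI; rewrite /ce_diff.
under eq_bigr => i _ do under eq_bigr => j _ do
  rewrite (@monomial_cons _ _ _ p I _ _ sI) mulr_sumr.
under eq_bigr do rewrite exchange_big /=.
rewrite exchange_big /=; apply: eq_bigr => b _.
under eq_bigr => i _ do under eq_bigr => j _ do
  rewrite structure_eq -mulrA mulr_suml mulr_sumr mulr_sumr.
under eq_bigr do rewrite exchange_big /=.
rewrite exchange_big /=; apply: eq_bigr => d _.
rewrite mulNr -mulrN -monomial_cons2 mulr_sumr; apply: eq_bigr => i _.
rewrite mulr_sumr; apply: eq_bigr => j _.
move: (monomial _ _) (d.1%:~R) => m c; move: (_ - _) => w.
by rewrite -!mulrA mulrCA; congr (_ * _); rewrite mulrCA.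
Qed.

Lemma ce_diff_sum p (I : Type) (r : seq I) (c : I -> R)
    (a : I -> p.+1.-tuple V -> R) x :
  ce_diff L (fun y => \sum_(i <- r) c i * a i y) x =
  \sum_(i <- r) c i * ce_diff L (a i) x.
Proof.
rewrite /ce_diff; under eq_bigr => i _ do under eq_bigr => j _ do rewrite mulr_sumr.
under eq_bigr do rewrite exchange_big /=.
rewrite exchange_big /=; apply: eq_bigr => k _.
rewrite mulr_sumr; apply: eq_bigr => i _; rewrite mulr_sumr.
by apply: eq_bigr => j _; rewrite mulrCA.
Qed.

Lemma ce_diff_eval p F : homogeneous p.+1 F ->
  ce_diff L (form_eval xi p.+1 F) =1 form_eval xi p.+2 (formal_diff D F).
Proof.
move=> hF x; rewrite (ce_diff_sum F (fun m => m.1%:~R) (fun m => monomial m.2)).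
rewrite /form_eval big_flatten big_map big_seq [RHS]big_seq.
apply: eq_bigr => m /(allP hF)/eqP sm.
rewrite ce_diff_monomial // big_flatten big_map sm -[iota 0 p.+1]/(index_iota 0 p.+1).
rewrite big_mkord mulr_sumr; apply: eq_bigr => b _.
rewrite mulr_sumr big_map; apply: eq_bigr => d _ /=.
rewrite mulrNz !intrM rmorphXn rmorphN1 mulrA; congr (_ * _).
by rewrite mulrN mulrCA mulrA.
Qed.

End FormalDifferential.

(** * Orthonormal frames *)

Section Frame.
Variables (R : realType) (V : vectType R) (n : nat) (f : n.-tuple V).

Definition dual_form (k : nat) (v : V) : R :=
  if insub k is Some i then coord f i v else 0.

Lemma dual_formE (i : 'I_n) v : dual_form i v = coord f i v.
Proof. by rewrite /dual_form valK. Qed.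

Lemma dual_form_scalar k : scalar (dual_form k).
Proof.
move=> c u v; rewrite /dual_form; case: insub => [i|]; first exact: linearP.
by rewrite mulr0 addr0.
Qed.

HB.instance Definition _ k :=
  GRing.isLinear.Build R V R _ (dual_form k) (dual_form_scalar k).

Definition dual_forms (k : nat) : {scalar V} := dual_form k.

Hypothesis f_basis : basis_of fullv f.

Lemma dual_form_frame k (i : 'I_n) : dual_form k (tnth f i) = (k == i)%:R.
Proof.
rewrite /dual_form; case: insubP => [j _ <-|nk].
  by rewrite (tnth_nth 0) coord_free ?(basis_free f_basis) // eq_sym.
by case: eqP nk => // ->; rewrite ltn_ord.
Qed.

Lemma frame_sum v : v = \sum_(i < n) dual_form i v *: tnth f i.
Proof.
rewrite {1}(coord_basis f_basis (memvf v)).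
by apply: eq_bigr => i _; rewrite dual_formE (tnth_nth 0).
Qed.

(** When the determinants are expanded, each of the p! permutations alone already gives a x, by
    multilinearity and alternation. This accounts for the factorial. *)
Lemma form_expand p (a : altform V p) x :
  a x = (p`!)%:R^-1 * \sum_(I : p.-tuple 'I_n)
    a [tuple of map (tnth f) I] * monomial dual_forms [seq val i | i <- I] x.
Proof.
under eq_bigr do rewrite monomialE mulr_sumr.
rewrite exchange_big /=.
have E (s : 'S_p) : \sum_(I : p.-tuple 'I_n) a [tuple of map (tnth f) I] *
   ((-1) ^+ s * \prod_(b < p) dual_forms (nth 0%N [seq val i | i <- I] (s b)) (tnth x b))
   = a x.
  under eq_bigr do rewrite mulrCA.
  rewrite -mulr_sumr.
  have := multilinear_expand (fun i j => dual_form j (tnth x ((s^-1)%g i))) (tnth f)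
    (altform_multilinear a).
  rewrite (_ : [tuple _ | i < p] = [tuple tnth x ((s^-1)%g i) | i < p]); last first.
    by apply: eq_from_tnth => i; rewrite !tnth_mktuple -frame_sum.
  rewrite alternating_perm odd_permV => /(congr1 (fun r => (-1) ^+ s * r)).
  rewrite signrMK => ->; congr (_ * _); apply: eq_bigr => I _; rewrite mulrC.
  congr (_ * _); rewrite [RHS](reindex_inj (@perm_inj _ s)) /=.
  apply: eq_bigr => b _; rewrite permK /dual_forms /=; congr dual_form.
  by rewrite (nth_map (tnth I (s b))) ?size_tuple // -tnth_nth.
under eq_bigr do rewrite E.
by rewrite sumr_const card_Sn -[a x *+ _]mulr_natl mulrA mulVf ?mul1r // pnatr_eq0 -lt0n fact_gt0.
Qed.

End Frame.

(** * Inner products of forms and changes of orthonormal frame *)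

Section SortedTuples.
Variables (n p : nat).
Implicit Types I J : p.-tuple 'I_n.

Definition permute_tuple (s : 'S_p) I : p.-tuple 'I_n := [tuple tnth I (s k) | k < p].

Let increasing I := sorted ltn [seq val i | i <- I].

Lemma sorting_perm I : uniq I -> exists s, increasing (permute_tuple s I).
Proof.
move=> uI.
have [t Et] : exists t : p.-tuple 'I_n, t = sort (fun i j : 'I_n => (i <= j)%N) I :> seq _.
  have H : size (sort (fun i j : 'I_n => (i <= j)%N) I) == p by rewrite size_sort size_tuple.
  by exists (Tuple H).
have : perm_eq t I by rewrite Et perm_sort.
case/tuple_permP => s Es; exists s; rewrite /increasing /permute_tuple -Es Et.
rewrite ltn_sorted_uniq_leq (map_inj_uniq val_inj) sort_uniq uI /=.
by rewrite -sort_map sort_sorted //; apply: leq_total.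
Qed.

Lemma increasing_perm_inj I s t : uniq I ->
  increasing (permute_tuple s I) -> increasing (permute_tuple t I) -> s = t.
Proof.
move=> uI incs inct.
have E : [seq val i | i <- permute_tuple s I] = [seq val i | i <- permute_tuple t I].
  apply: (irr_sorted_eq ltn_trans ltnn incs inct).
  suff H u : permute_tuple u I =i I.
    by apply: eq_mem_map => i; rewrite !H.
  by apply: perm_mem; apply/tuple_permP; exists u.
move/(inj_map val_inj)/val_inj: E => E.
apply/permP => k; apply: (tuple_uniqP _ uI).
by have := congr1 (fun J => tnth J k) E; rewrite !tnth_mktuple.
Qed.

(** A tuple without repetition is sorted by exactly one permutation. *)
Lemma sum_sorted_tuple (R : pzRingType) (F : p.-tuple 'I_n -> R) :
  (forall I s, F (permute_tuple s I) = F I) ->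
  (forall I, ~~ uniq I -> F I = 0) ->
  \sum_I F I = (p`!)%:R * \sum_(I | increasing I) F I.
Proof.
move=> sF F0; rewrite mulr_natl -card_Sn -sumr_const.
transitivity (\sum_(s : 'S_p) \sum_(I | increasing (permute_tuple s I)) F I).
  rewrite (exchange_big_dep xpredT) //=; apply: eq_bigr => I _.
  have [uI|nI] := boolP (uniq I); last by rewrite F0 // big1.
  have [s sI] := sorting_perm uI; rewrite (big_pred1 s) // => t /=.
  by apply/idP/eqP => [tI|->//]; apply: increasing_perm_inj tI sI.
apply: eq_bigr => s _; rewrite [RHS](reindex (permute_tuple s)) /=.
  by apply: eq_bigr => I _; rewrite sF.
exists (permute_tuple s^-1%g) => I _; apply: eq_from_tnth => k;
  by rewrite !tnth_mktuple ?permK ?permKV.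
Qed.

End SortedTuples.

Section FormDot.
Variables (R : realType) (V : vectType R).

(** Unlike the sum over increasing indices, the full sum transforms one slot at a time under a
    change of frame. *)
Lemma form_dot_full n p (e : n.-tuple V) (a b : altform V p) :
  form_dot e a b = (p`!)%:R^-1 * \sum_(I : p.-tuple 'I_n)
     a [tuple of map (tnth e) I] * b [tuple of map (tnth e) I].
Proof.
rewrite (@sum_sorted_tuple _ _ _
  (fun I => a [tuple of map (tnth e) I] * b [tuple of map (tnth e) I])).
- by rewrite mulrA mulVf ?mul1r // pnatr_eq0 -lt0n fact_gt0.
- move=> I s.
  have -> : [tuple of map (tnth e) (permute_tuple s I)] =
            [tuple tnth [tuple of map (tnth e) I] (s k) | k < p].
    by apply: eq_from_tnth => k; rewrite tnth_map !tnth_mktuple tnth_map.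
  by rewrite !alternating_perm mulrACA -signr_addb addbb mul1r.
- move=> I /tuple_uniqP nI; suff [i [j [ij Eij]]] : exists i j, i != j /\ tnth I i = tnth I j.
    by rewrite (altform_alternating a (i := i) (j := j)) ?mul0r // !tnth_map Eij.
  have : ~~ [forall i, forall j, (tnth I i == tnth I j) ==> (i == j)].
    by apply/negP => /'forall_'forall_implyP H; apply: nI => i j /eqP/H/eqP.
  rewrite negb_forall => /existsP[i]; rewrite negb_forall => /existsP[j].
  by rewrite negb_imply => /andP[/eqP E ij]; exists i, j.
Qed.

(** After expansion in the f_j, the sum over I factors into one orthogonality relation of M per
    slot, which forces the two index tuples to agree. *)
Lemma sum_orthogonal_change n p (a b : p.-tuple V -> R) (e f : 'I_n -> V)
    (M : 'I_n -> 'I_n -> R) :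
  multilinear_map a -> multilinear_map b ->
  (forall i, e i = \sum_j M i j *: f j) ->
  (forall j k, \sum_i M i j * M i k = (j == k)%:R) ->
  \sum_(I : p.-tuple 'I_n) a [tuple of map e I] * b [tuple of map e I] =
  \sum_(I : p.-tuple 'I_n) a [tuple of map f I] * b [tuple of map f I].
Proof.
move=> ma mb eE M_orth.
have expand (c : p.-tuple V -> R) (I : p.-tuple 'I_n) : multilinear_map c -> c [tuple of map e I] =
    \sum_(J : p.-tuple 'I_n) (\prod_k M (tnth I k) (tnth J k)) * c [tuple of map f J].
  move=> mc; rewrite -(multilinear_expand (fun k j => M (tnth I k) j) f mc).
  by congr c; apply: eq_from_tnth => k; rewrite tnth_map tnth_mktuple.
under eq_bigr => I _ do rewrite (expand a) // (expand b) // mulr_suml.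
rewrite exchange_big /=; apply: eq_bigr => J _.
under eq_bigr => I _ do rewrite mulr_sumr.
rewrite exchange_big /= (bigD1 J) //= [X in _ + X]big1 ?addr0 => [|K KJ].
  under eq_bigr => I _ do rewrite mulrACA -big_split /=.
  rewrite -mulr_suml (sum_tuple_prod (fun k i => M i (tnth J k) * M i (tnth J k))).
  by rewrite big1 ?mul1r // => k _; rewrite M_orth eqxx.
under eq_bigr => I _ do rewrite mulrACA -big_split /=.
rewrite -mulr_suml (sum_tuple_prod (fun k i => M i (tnth J k) * M i (tnth K k))).
have [k JKk] : exists k, tnth J k != tnth K k.
  apply/existsP; rewrite -negb_forall; apply: contra KJ => /forallP H.
  by apply/eqP/eq_from_tnth => k; apply/esym/eqP.
by rewrite (bigD1 k) //= M_orth (negPf JKk) !mul0r.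
Qed.

End FormDot.

Section FrameMetric.
Variables (R : realType) (V : vectType R) (n : nat) (f : n.-tuple V).
Hypothesis f_basis : basis_of fullv f.

(** The basis proof is an argument of the form, so that the positive definite instance, which
    depends on it, can be inferred from the term. *)
Definition frame_dot of basis_of fullv f := fun x y : V =>
  \sum_(i < n) dual_form f i x * dual_form f i y.

Lemma frame_dot_bilinear :
  bilinear_for *%R (idfun \; *%R) (frame_dot f_basis).
Proof.
split=> x c u v /=; rewrite /frame_dot mulr_sumr -big_split;
  by apply: eq_bigr => i _; rewrite dual_form_scalar /=; ring.
Qed.

HB.instance Definition _ := bilinear_isBilinear.Build R V V R _ _
  (frame_dot f_basis) frame_dot_bilinear.

Lemma frame_dot_sym x y : frame_dot f_basis x y =
  (-1) ^+ false * idfun (frame_dot f_basis y x).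
Proof. by rewrite mul1r; apply: eq_bigr => i _; rewrite mulrC. Qed.

HB.instance Definition _ := isHermitianSesquilinear.Build R V false idfun
  (frame_dot f_basis) frame_dot_sym.

Lemma frame_dot_pos x : x != 0 -> 0 < frame_dot f_basis x x.
Proof.
move=> x0; rewrite lt_def sumr_ge0 ?andbT => [|i _]; last by rewrite -expr2 sqr_ge0.
apply: contra x0 => /eqP E; apply/eqP; rewrite (frame_sum f_basis x) big1 // => i _.
have /psumr_eq0P H : frame_dot f_basis x x = 0 by [].
have := H (fun i _ => _) i isT; rewrite -expr2.
by move=> /(_ (fun j => sqr_ge0 _)) /eqP; rewrite sqrf_eq0 => /eqP ->; rewrite scale0r.
Qed.

HB.instance Definition _ := isDotProduct.Build R V
  (frame_dot f_basis) frame_dot_pos.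

Definition frame_metric : {dot V for idfun} := frame_dot f_basis.

Lemma frame_metric_dual (i : 'I_n) v : frame_metric (tnth f i) v = dual_form f i v.
Proof.
rewrite /frame_metric /= /frame_dot (bigD1 i) //= big1 ?addr0 => [|j ji].
  by rewrite dual_form_frame // eqxx mul1r.
by rewrite dual_form_frame // val_eqE (negPf ji) mul0r.
Qed.

End FrameMetric.

Section RealInnerProduct.
Variables (R : realType) (V : vectType R) (g : {dot V for idfun}).

Lemma dot_sym x y : g x y = g y x.
Proof. by rewrite (hermC g) mul1r. Qed.

Lemma orthonormalP_nth s :
  reflect (forall i j, (i < size s)%N -> (j < size s)%N -> g s`_i s`_j = (i == j)%:R)
          (orthonormal g s).
Proof.
elim: s => [|v s IH]; first by left.
have -> : orthonormal g (v :: s) =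
    [&& g v v == 1, all (fun w => g v w == 0) s & orthonormal g s].
  by rewrite /orthonormal /= /ortho_rec /= andbT -!andbA; do !bool_congr.
apply: (iffP and3P) => [[/eqP vv /allP vs /IH ss] [|i] [|j] //= ip jp|H].
- by apply/eqP/vs/mem_nth.
- by rewrite dot_sym; apply/eqP/vs/mem_nth.
- exact: ss.
split; first by rewrite (H 0%N 0%N).
  apply/allP => w /(nthP 0)[i ip <-].
  by rewrite (H 0%N i.+1).
by apply/IH => i j ip jp; rewrite (H i.+1 j.+1).
Qed.

Lemma orthonormal_tnth n (e : n.-tuple V) : orthonormal g e ->
  forall i j, g (tnth e i) (tnth e j) = (i == j)%:R.
Proof.
by move/orthonormalP_nth => H i j; rewrite !(tnth_nth 0) H ?size_tuple.
Qed.

Lemma orthonormal_free_real s : orthonormal g s -> free s.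
Proof.
move/orthonormalP_nth => H; rewrite -(in_tupleE s); apply/freeP => a a0 i.
have := congr1 (g s`_i) a0; rewrite linear0r raddf_sum /= (bigD1 i) //= big1 => [|j ji].
  by rewrite addr0 linearZ /= H // eqxx mulr1.
by rewrite linearZ /= H // [(i : nat) == j](_ : _ = (i == j)) // eq_sym (negPf ji) mulr0.
Qed.

(** Gram-Schmidt: a vector of W outside the span of s, minus its projection and normalised, is
    appended until s spans W. *)
Lemma orthonormal_extend (W : {vspace V}) s :
  orthonormal g s -> {subset s <= W} ->
  exists t, orthonormal g (s ++ t) /\ basis_of W (s ++ t).
Proof.
move: {2}(\dim W - size s)%N (leqnn (\dim W - size s)) => m.
elim: m s => [|m IH] s sm os sW.
  exists [::]; rewrite cats0; split=> //; rewrite basisEfree orthonormal_free_real //=.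
  by rewrite -subn_eq0 -leqn0 sm andbT; apply/span_subvP.
have fs := orthonormal_free_real os.
have sub_sW : (<<s>> <= W)%VS by apply/span_subvP.
have [/eqP E|] := boolP (W == <<s>>%VS).
  by exists [::]; rewrite cats0; split=> //; rewrite /basis_of E eqxx fs.
rewrite eqEsubv sub_sW andbT => /subvPn[w wW ws].
have s_lt : (size s < \dim W)%N.
  rewrite -(eqP fs) ltn_neqAle dimvS // andbT.
  apply: contra ws => /eqP E; suff -> : <<s>>%VS = W by [].
  by apply/eqP; rewrite -(dimv_leqif_eq sub_sW) E.
pose v := w - \sum_(i < size s) g s`_i w *: s`_i.
have v_orth i : (i < size s)%N -> g s`_i v = 0.
  move=> ip; rewrite linearB /= raddf_sum /= (bigD1 (Ordinal ip)) //= big1 => [|j ji].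
    by rewrite addr0 linearZ /= (orthonormalP_nth _ os) // eqxx mulr1 subrr.
  rewrite linearZ /= (orthonormalP_nth _ os) //.
  by rewrite eq_sym -[(j : nat) == i]/(j == Ordinal ip) (negPf ji) mulr0.
have v0 : v != 0.
  apply: contra ws; rewrite subr_eq0 => /eqP ->; apply: memv_suml => i _.
  by rewrite memvZ // memv_span // mem_nth.
have vW : v \in W.
  rewrite memvB // memv_suml // => i _; rewrite memvZ // sW // mem_nth //.
have gv : 0 < g v v by apply: neq0_dnorm_gt0.
pose c := (Num.sqrt (g v v))^-1.
have gcv : g (c *: v) (c *: v) = 1.
  rewrite linearZl_LR linearZ /= /c mulrA -expr2 exprVn sqr_sqrtr 1?ltW //.
  by rewrite mulVf // gt_eqF.
have os' : orthonormal g (rcons s (c *: v)).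
  apply/orthonormalP_nth => i j; rewrite size_rcons !ltnS !nth_rcons => ip jp.
  case: ltngtP ip => // [ip|ip] _; case: ltngtP jp => // [jp|jp] _.
  - exact: (orthonormalP_nth _ os).
  - by rewrite jp ltn_eqF // linearZ /= v_orth ?mulr0.
  - by rewrite ip gtn_eqF // dot_sym linearZ /= v_orth ?mulr0.
  - by rewrite ip jp eqxx gcv.
have [||t [ot bt]] := IH (rcons s (c *: v)) _ os'.
- by rewrite size_rcons subnS -subn1 leq_subLR add1n.
- by move=> x; rewrite mem_rcons inE => /predU1P[->|/sW //]; rewrite memvZ.
by exists (c *: v :: t); rewrite -cat_rcons.
Qed.

End RealInnerProduct.

(** * The standard G2-structure *)

(** In the models the derived algebra lies in the associative 3-plane of e4, e5, e6. The forms
    attached to them are a self-dual triple on the span of e0, ..., e3. *)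
Definition G2_form : formal_form :=
  [:: (1, [:: 4; 5; 6]%N); (1, [:: 4; 0; 3]%N); (1, [:: 4; 1; 2]%N);
      (1, [:: 5; 0; 2]%N); (-1, [:: 5; 1; 3]%N);
      (1, [:: 6; 0; 1]%N); (1, [:: 6; 2; 3]%N)].

Definition G2_dual_form : formal_form :=
  [:: (1, [:: 0; 1; 2; 3]%N); (1, [:: 1; 2; 5; 6]%N); (1, [:: 0; 3; 5; 6]%N);
      (1, [:: 1; 3; 4; 6]%N); (-1, [:: 0; 2; 4; 6]%N);
      (1, [:: 2; 3; 4; 5]%N); (1, [:: 0; 1; 4; 5]%N)].

Definition density_form i j : formal_form :=
  formal_wedge (formal_wedge (formal_interior i G2_form) (formal_interior j G2_form)) G2_form.

(** The coefficient 6 cancels the 1/6 in the definition of the induced metric, so that the basis is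
    orthonormal. *)
Lemma density_form_check :
  all (fun i => all (fun j => normal_form (density_form i j) ==
    if i == j then [:: (6, iota 0 7)] else [::]) (iota 0 7)) (iota 0 7).
Proof. by vm_compute. Qed.

(** The value of the 3-form at three basis vectors, as a formal 0-form: either no term or one term
    with the empty index list. *)
Definition G2_coef i j k : formal_form :=
  normal_form (formal_interior k (formal_interior j (formal_interior i G2_form))).

Lemma hodge_form_check :
  all (fun i => all (fun j => all (fun k =>
    normal_form (formal_wedge [:: (1, [:: i; j; k])] G2_dual_form) ==
    [seq (m.1, iota 0 7) | m <- G2_coef i j k])
  (iota 0 7)) (iota 0 7)) (iota 0 7).
Proof. by vm_compute. Qed.

Section StandardG2.
Variables (R : realType) (V : vectType R) (f : 7.-tuple V).
Hypothesis f_basis : basis_of fullv f.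
Let xi := dual_forms f.
Let g := frame_metric f_basis.

Lemma form_eval_multilinear p F : multilinear_map (form_eval xi p F).
Proof.
move=> x i c u v; rewrite /form_eval mulr_sumr -big_split /=.
apply: eq_bigr => m _; rewrite [LHS](congr1 _ (monomial_multilinear _ _ _ _ _ _ _)).
by rewrite /= mulrDr mulrCA.
Qed.

Lemma form_eval_alternating p F : alternating_map (form_eval xi p F).
Proof.
move=> x i j ij E; apply: big1 => m _.
by rewrite (monomial_alternating _ _ ij E) mulr0.
Qed.

Definition formal_altform p F : altform V p :=
  AltForm (@form_eval_multilinear p F) (@form_eval_alternating p F).

Definition frame_volume : altform V 7 := monomial_form xi 7 (iota 0 7).
Definition frame_G2 : altform V 3 := formal_altform 3 G2_form.
Definition frame_G2_dual : altform V 4 := formal_altform 4 G2_dual_form.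

Lemma homogeneous_G2 : homogeneous 3 G2_form. Proof. by []. Qed.
Lemma homogeneous_G2_dual : homogeneous 4 G2_dual_form. Proof. by []. Qed.

Let xi_frame i k : xi k (tnth f i) = (k == i)%:R.
Proof. exact: dual_form_frame. Qed.

Lemma mem_iota7 (i : 'I_7) : (i : nat) \in iota 0 7.
Proof. by rewrite mem_iota add0n ltn_ord. Qed.

Lemma interior_frame_sum v p (a : p.+1.-tuple V -> R) : multilinear_map a ->
  interior_product v a =1
  fun x => \sum_(i < 7) xi i v * interior_product (tnth f i) a x.
Proof.
move=> ma x; have := scalar_sum (fun i : 'I_7 => xi i v) (tnth f) (multilinear_head x ma).
by rewrite -(frame_sum f_basis v).
Qed.

(** Both sides are bilinear in v and w, so the computed table on frame vectors decides. *)
Lemma frame_G2_density v w x :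
  G2_density frame_G2 v w x = 6%:R * g v w * frame_volume x.
Proof.
have basis_density (i j : 'I_7) : wedge_product (wedge_product
    (interior_product (tnth f i) frame_G2) (interior_product (tnth f j) frame_G2))
    frame_G2 x = (i == j)%:R * 6%:R * frame_volume x.
  have hi := homogeneous_interior i homogeneous_G2.
  have hj := homogeneous_interior j homogeneous_G2.
  rewrite (eq_wedge (a' := form_eval xi (2 + 2) (formal_wedge (formal_interior i G2_form)
     (formal_interior j G2_form))) (b' := form_eval xi 3 G2_form)) //; last first.
    move=> y; rewrite -form_eval_wedge //.
    apply: eq_wedge; exact: (form_eval_interior homogeneous_G2 (xi_frame _)).
  have hij := homogeneous_wedge hi hj.
  rewrite (form_eval_wedge xi hij homogeneous_G2).
  rewrite form_eval_normal; last exact: (homogeneous_wedge hij homogeneous_G2).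
  have /allP /(_ _ (mem_iota7 i)) /allP /(_ _ (mem_iota7 j)) := density_form_check.
  rewrite /density_form => /eqP ->; rewrite val_eqE.
  case: (i == j); last by rewrite /form_eval big_nil !mul0r.
  by rewrite /form_eval big_seq1 mul1r.
pose iota_ i := interior_product (tnth f i) frame_G2.
have E u : interior_product u frame_G2 =1 fun y => \sum_(i < 7) xi i u * iota_ i y.
  exact/interior_frame_sum/altform_multilinear.
have E2 : wedge_product (interior_product v frame_G2) (interior_product w frame_G2) =1
    fun y => \sum_(i < 7) xi i v * (fun z => \sum_(j < 7) xi j w *
      wedge_product (iota_ i) (iota_ j) z) y.
  move=> y; rewrite (eq_wedge (E v) (E w)).
  rewrite (wedge_suml _ (fun i : 'I_7 => xi i v) iota_); apply: eq_bigr => i _.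
  by rewrite (wedge_sumr _ (fun i : 'I_7 => xi i w) _ iota_).
rewrite /G2_density (eq_wedge E2 (fun=> erefl)).
rewrite (wedge_suml _ (fun i : 'I_7 => xi i v)).
have -> : g v w = \sum_(i < 7) xi i v * xi i w by [].
rewrite [6%:R * _]mulr_sumr mulr_suml; apply: eq_bigr => i _.
rewrite (wedge_suml _ (fun j : 'I_7 => xi j w)).
rewrite (bigD1 i) //= [X in _ + X]big1 => [|j ji]; rewrite basis_density.
  by rewrite eqxx mul1r addr0 !mulrA (mulrC 6%:R) -!mulrA; congr (_ * _); rewrite mulrCA.
by rewrite eq_sym (negPf ji) !mul0r mulr0.
Qed.

Lemma frame_volume_frame : frame_volume f = 1.
Proof.
rewrite -[LHS]/(monomial xi (iota 0 7) f) /monomial -[RHS](det1 R 7); congr (\det _).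
by apply/matrixP => a b; rewrite !mxE xi_frame nth_iota // add0n eq_sym.
Qed.

Lemma frame_G2_structure : G2_structure frame_G2.
Proof.
move=> v v0 /(_ f); rewrite frame_G2_density frame_volume_frame mulr1 => /eqP.
by rewrite mulf_eq0 pnatr_eq0 (gt_eqF (frame_dot_pos f_basis v0)).
Qed.

Let dual_matrix (e : 7.-tuple V) : 'M[R]_7 := \matrix_(a, b) xi b (tnth e a).

Lemma dual_matrix_orthogonal (e : 7.-tuple V) : orthonormal g e ->
  dual_matrix e *m (dual_matrix e)^T = 1%:M.
Proof.
move=> oe; apply/matrixP => a b; rewrite !mxE -(orthonormal_tnth oe).
by rewrite /g /= /frame_dot; apply: eq_bigr => i _; rewrite !mxE.
Qed.

(** The change between two orthonormal frames is an orthogonal matrix, of determinant 1 or -1. *)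
Lemma frame_volume_form : volume_form g frame_volume.
Proof.
move=> e /dual_matrix_orthogonal /(congr1 determinant).
rewrite det_mulmx det_tr det1 -expr2 => /eqP.
rewrite sqrf_eq1 => /orP[] /eqP E; rewrite -[frame_volume e]/(monomial xi (iota 0 7) e) /monomial.
  rewrite (_ : \matrix_(a, b) _ = dual_matrix e) ?E ?normr1 //.
  by apply/matrixP => a b; rewrite !mxE nth_iota.
rewrite (_ : \matrix_(a, b) _ = dual_matrix e) ?E ?normrN1 //.
by apply/matrixP => a b; rewrite !mxE nth_iota.
Qed.

Lemma frame_G2_induced : G2_induced frame_G2 g frame_volume.
Proof.
split=> [|v w x]; first exact: frame_volume_form.
by rewrite frame_G2_density !mulrA mulVf ?mul1r // pnatr_eq0.
Qed.

Lemma frame_G2_coef (i j k : 'I_7) :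
  frame_G2 [tuple tnth f i; tnth f j; tnth f k] = \sum_(m <- G2_coef i j k) m.1%:~R.
Proof.
have H p (l : 'I_7) F (x : p.-tuple V) : homogeneous p.+1 F ->
   form_eval xi p.+1 F [tuple of tnth f l :: x] = form_eval xi p (formal_interior l F) x.
  by move=> hF; rewrite -(form_eval_interior hF (xi_frame l)).
have h3 := homogeneous_G2; have h2 := homogeneous_interior i h3.
have h1 := homogeneous_interior j h2; have h0 := homogeneous_interior k h1.
transitivity (form_eval xi 0 (G2_coef i j k) [tuple]).
  by rewrite -form_eval_normal // -H // -H // -H.
by apply: eq_bigr => m _; rewrite /monomial det_mx00 mulr1.
Qed.

(** The frame e is arbitrary orthonormal, so [form_dot] is first transported from e to f. Then [a]
    is expanded in monomials of f, and each monomial is one entry of [hodge_form_check]. *)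
Lemma frame_hodge : hodge_dual (p := 3) (q := 4) g frame_volume frame_G2 frame_G2_dual.
Proof.
move=> e oe a x.
have -> : form_dot e a frame_G2 = (3`!)%:R^-1 * \sum_(I : 3.-tuple 'I_7)
     a [tuple of map (tnth f) I] * frame_G2 [tuple of map (tnth f) I].
  rewrite form_dot_full; congr (_ * _).
  apply: (sum_orthogonal_change (M := dual_matrix e)); try exact: altform_multilinear.
    move=> i; rewrite {1}(frame_sum f_basis (tnth e i)).
    by apply: eq_bigr => j _; rewrite mxE.
  move=> j k; have /mulmx1C/matrixP/(_ j k) := dual_matrix_orthogonal oe.
  by rewrite !mxE => <-; apply: eq_bigr => i _; rewrite !mxE.
rewrite (eq_wedge (form_expand f_basis a) (fun=> erefl)).
pose ea (I : 3.-tuple 'I_7) := a [tuple of map (tnth f) I].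
rewrite (eq_wedge (a' := fun y => \sum_(I : 3.-tuple 'I_7) ((3`!)%:R^-1 * ea I)
  * monomial xi [seq val i | i <- I] y) (b' := frame_G2_dual)) //; last first.
  by move=> y; rewrite mulr_sumr; apply: eq_bigr => I _; rewrite mulrA.
rewrite (wedge_suml _ (fun I : 3.-tuple 'I_7 => (3`!)%:R^-1 * ea I)).
rewrite [_ * (\sum_(I : 3.-tuple 'I_7) _)]mulr_sumr mulr_suml.
apply: eq_bigr => I _; rewrite [in RHS]mulrA -[RHS]mulrA.
congr (_ * _).
case/tupleP: I => i I; case/tupleP: I => j I; case/tupleP: I => k I.
rewrite (tuple0 I).
rewrite (_ : altform_fun frame_G2 _ = frame_G2 [tuple tnth f i; tnth f j; tnth f k]); last first.
  by congr (altform_fun frame_G2 _); apply: val_inj.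
rewrite frame_G2_coef.
rewrite (eq_wedge (a' := form_eval xi 3 [:: (1, [:: val i; val j; val k])])
   (b' := form_eval xi 4 G2_dual_form)) //; last first.
  by move=> y; rewrite /form_eval big_seq1 mul1r.
have hI : homogeneous 3 [:: (1, [:: val i; val j; val k])] by [].
rewrite (form_eval_wedge xi hI homogeneous_G2_dual).
rewrite form_eval_normal; last exact: (homogeneous_wedge hI homogeneous_G2_dual).
have /allP /(_ _ (mem_iota7 i)) /allP /(_ _ (mem_iota7 j)) := hodge_form_check.
move=> /allP /(_ _ (mem_iota7 k)) /eqP ->.
by rewrite /form_eval big_map mulr_suml.
Qed.

End StandardG2.

(** * The Ricci tensor in an orthonormal frame *)

Section TraceFrame.
Variables (R : realType) (V : vectType R) (n : nat) (f : n.-tuple V).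
Hypothesis f_basis : basis_of fullv f.

Lemma endo_trace_frame (F : V -> V) : linear F ->
  endo_trace F = \sum_(i < n) dual_form f i (F (tnth f i)).
Proof.
move=> linF; pose A : {linear V -> V} := HB.pack F (GRing.isLinear.Build R V V _ F linF).
rewrite /endo_trace -[F]/(A : V -> V).
pose b := vbasis {:V}; have bb : basis_of fullv b := vbasisP _.
transitivity (\sum_(i < \dim {:V}) \sum_(j < n) dual_form f j b`_i * coord b i (A (tnth f j))).
  apply: eq_bigr => i _; rewrite {1}(frame_sum f_basis b`_i) linear_sum linear_sum.
  by apply: eq_bigr => j _; rewrite !linearZ.
rewrite exchange_big /=; apply: eq_bigr => j _.
rewrite -[F (tnth f j)]/(A (tnth f j)) [in RHS](coord_basis bb (memvf (A (tnth f j)))).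
by rewrite linear_sum; apply: eq_bigr => i _; rewrite linearZ /= mulrC.
Qed.

End TraceFrame.

Section StructureConstants.
Variables (R : realType) (V : vectType R) (n : nat) (f : n.-tuple V).
Hypothesis f_basis : basis_of fullv f.
Variables (L : lie_algebra V) (N : 'I_n -> 'I_n -> 'I_n -> R).
Hypothesis LE : forall i j k : 'I_n, dual_form f k (L (tnth f i) (tnth f j)) = N i j k.
Let g := frame_metric f_basis.

Lemma N_skew i j k : N i j k = - N j i k.
Proof.
have skew x y : L x y = - L y x.
  have := bracket_alternating L (x + y); rewrite linearDl !linearDr !bracket_alternating.
  by rewrite add0r addr0 => /eqP; rewrite addr_eq0 => /eqP.
by rewrite -!LE skew linearN.
Qed.

(* The Koszul formula: [Gamma i j k] is twice the k-th coordinate of the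
   covariant derivative of [f_j] along [f_i]. *)
Definition koszul i j k := N i j k - N j k i + N k i j.

Definition frame_connection (x y : V) : V :=
  \sum_(k < n) (\sum_(i < n) \sum_(j < n)
    dual_form f i x * dual_form f j y * (koszul i j k / 2%:R)) *: tnth f k.

Lemma frame_connection_bilinear : bilinear_for *:%R *:%R frame_connection.
Proof.
split=> x c u v; rewrite /frame_connection /= scaler_sumr -big_split /=;
apply: eq_bigr => k _; rewrite scalerA -scalerDl; congr (_ *: _);
rewrite mulr_sumr -big_split /=; apply: eq_bigr => i _;
rewrite mulr_sumr -big_split /=; apply: eq_bigr => j _;
by rewrite dual_form_scalar; ring.
Qed.

HB.instance Definition _ := bilinear_isBilinear.Build R V V V _ _
  frame_connection frame_connection_bilinear.

Definition connection : {bilinear V -> V -> V} := frame_connection.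

Lemma frame_ext u v : (forall k : 'I_n, dual_form f k u = dual_form f k v) -> u = v.
Proof.
move=> E; rewrite (frame_sum f_basis u) (frame_sum f_basis v).
by apply: eq_bigr => k _; rewrite E.
Qed.

Lemma connection_frame (i j k : 'I_n) :
  dual_form f k (connection (tnth f i) (tnth f j)) = koszul i j k / 2%:R.
Proof.
rewrite /connection /= /frame_connection linear_sum (bigD1 k) //= [X in _ + X]big1.
  rewrite addr0 linearZ /= dual_form_frame // eqxx mulr1.
  rewrite (bigD1 i) //= [X in _ + X]big1 => [|i' i'i].
    rewrite addr0 (bigD1 j) //= [X in _ + X]big1 => [|j' j'j].
      by rewrite addr0 !dual_form_frame // !eqxx !mul1r.
    by rewrite !dual_form_frame // !val_eqE (negPf j'j) mulr0 mul0r.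
  by rewrite big1 // => j' _; rewrite !dual_form_frame // !val_eqE (negPf i'i) !mul0r.
move=> k' k'k; rewrite linearZ /= dual_form_frame //.
by rewrite eq_sym val_eqE (negPf k'k) mulr0.
Qed.

(* Bilinear identities may be checked on the frame. *)
Lemma scalar_frame (h : V -> R) x : scalar h ->
  h x = \sum_(i < n) dual_form f i x * h (tnth f i).
Proof. by move=> hs; rewrite {1}(frame_sum f_basis x) scalar_sum. Qed.

Lemma scalar_frame_eq (h h' : V -> R) : scalar h -> scalar h' ->
  (forall i, h (tnth f i) = h' (tnth f i)) -> h =1 h'.
Proof.
move=> hs hs' E x; rewrite (scalar_frame x hs) (scalar_frame x hs').
by apply: eq_bigr => i _; rewrite E.
Qed.

(** Both identities are linear in each argument. On the frame they reduce to the skew-symmetry of N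
    in its first two indices. *)
Lemma connection_levi_civita : levi_civita L g connection.
Proof.
split=> [x y|x y z].
  apply: frame_ext => k.
  move: x; apply: scalar_frame_eq => [c u v|c u v|i].
  - rewrite !linearPl !linearPr /= !(linearD, linearN) !linearZ /=; ring.
  - rewrite !linearPl /= !(linearD, linearN) !linearZ /=; ring.
  move: y; apply: scalar_frame_eq => [c u v|c u v|j].
  - rewrite !linearPl !linearPr /= !(linearD, linearN) !linearZ /=; ring.
  - rewrite !linearPr /= !(linearD, linearN) !linearZ /=; ring.
  rewrite linearB /= !connection_frame LE /koszul (N_skew j i) (N_skew k j) (N_skew i k).
  by field.
move: x; apply: scalar_frame_eq => [c u v|c u v|i].
- rewrite !linearPl !linearPr /=; ring.
- by rewrite mulr0 addr0.
move: y; apply: scalar_frame_eq => [c u v|c u v|j].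
- rewrite !linearPr !linearPl /=; ring.
- by rewrite mulr0 addr0.
move: z; apply: scalar_frame_eq => [c u v|c u v|k].
- rewrite !linearPr /=; ring.
- by rewrite mulr0 addr0.
rewrite (dot_sym g) /g !frame_metric_dual !connection_frame /koszul.
rewrite (N_skew j i) (N_skew k j) (N_skew i k); ring.
Qed.

Lemma curvature_trilinear (nabla : {bilinear V -> V -> V}) :
  [/\ forall y z, linear (fun x => curvature L nabla x y z),
      forall x z, linear (fun y => curvature L nabla x y z)
    & forall x y, linear (fun z => curvature L nabla x y z)].
Proof.
have shuffle k (a b c a' b' c' : V) :
    (k *: a + a') - (k *: b + b') - (k *: c + c') = k *: (a - b - c) + (a' - b' - c').
  by rewrite !scalerBr !opprD (addrACA _ a') [LHS]addrACA.
by split=> x y k u v; rewrite /curvature !(linearPl, linearPr) shuffle.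
Qed.

(** Four times the Ricci tensor: [koszul] is twice the connection, so products of two carry the
    factor 4, and the bracket term with a single one needs the factor 2. *)
Definition frame_ricci b c : R := \sum_(a < n) \sum_(m < n)
  (koszul b c m * koszul a m a - koszul a c m * koszul b m a
   - 2%:R * N a b m * koszul m c a).

Lemma connection_frame_sum (i j : 'I_n) :
  connection (tnth f i) (tnth f j) = \sum_(k < n) (koszul i j k / 2%:R) *: tnth f k.
Proof.
rewrite (frame_sum f_basis (connection _ _)).
by apply: eq_bigr => k _; rewrite connection_frame.
Qed.

Lemma bracket_frame_sum (i j : 'I_n) :
  L (tnth f i) (tnth f j) = \sum_(k < n) N i j k *: tnth f k.
Proof.
by rewrite (frame_sum f_basis (L _ _)); apply: eq_bigr => k _; rewrite LE.
Qed.

Lemma ricci_tensor_frame y z : ricci_tensor L connection y z =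
  \sum_(b < n) \sum_(c < n) dual_form f b y * dual_form f c z * (frame_ricci b c / 4%:R).
Proof.
have [lin1 lin2 lin3] := curvature_trilinear connection.
rewrite /ricci_tensor (endo_trace_frame f_basis) //.
transitivity (\sum_(a < n) \sum_(b < n) \sum_(c < n) dual_form f b y * dual_form f c z *
   dual_form f a (curvature L connection (tnth f a) (tnth f b) (tnth f c))).
  apply: eq_bigr => a _; rewrite {1}(frame_sum f_basis y).
  pose F2 z' : {linear V -> V} := HB.pack (fun y => curvature L connection (tnth f a) y z')
    (GRing.isLinear.Build R V V _ _ (lin2 (tnth f a) z')).
  rewrite -[curvature _ _ _ _ _]/(F2 z _) linear_sum linear_sum; apply: eq_bigr => b _.
  rewrite !linearZ /= {1}(frame_sum f_basis z).
  pose F3 : {linear V -> V} := HB.pack (fun z => curvature L connection (tnth f a) (tnth f b) z)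
    (GRing.isLinear.Build R V V _ _ (lin3 (tnth f a) (tnth f b))).
  rewrite -[curvature _ _ _ _ _]/(F3 _) linear_sum linear_sum mulr_sumr.
  by apply: eq_bigr => c _; rewrite !linearZ /= mulrA.
rewrite exchange_big /=; apply: eq_bigr => b _.
rewrite exchange_big /=; apply: eq_bigr => c _.
rewrite -mulr_sumr; congr (_ * _); rewrite /frame_ricci mulr_suml; apply: eq_bigr => a _.
rewrite /curvature !(linearB, linearD) /=.
rewrite !connection_frame_sum bracket_frame_sum !linear_sumr linear_sumlz !linear_sum /=.
rewrite mulr_suml -!sumrN -!big_split /=; apply: eq_bigr => m _.
rewrite !linearZr_LR linearZl_LR /= !linearZ /= !connection_frame; by field.
Qed.

(** The endomorphism Rc - lambda Id is diagonal, up to the factor 4 with entries rho_i - lambda. On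
    frame vectors the derivation rule for it is the second hypothesis. *)
Lemma frame_nilsoliton (rho : 'I_n -> R) (lambda : R) :
  (forall b c, frame_ricci b c = (b == c)%:R * rho b) ->
  (forall i j k, N i j k * (rho i + rho j - rho k - lambda) = 0) ->
  nilsoliton L g.
Proof.
move=> ric_diag der.
pose scale_fun (s : 'I_n -> R) (x : V) := \sum_(i < n) (s i * dual_form f i x) *: tnth f i.
have scale_lin s : linear (scale_fun s).
  move=> c u v; rewrite /scale_fun scaler_sumr -big_split /=; apply: eq_bigr => i _.
  by rewrite dual_form_scalar mulrDr scalerDl scalerA mulrCA.
pose A s : {linear V -> V} := HB.pack (scale_fun s)
  (GRing.isLinear.Build R V V _ _ (scale_lin s)).
have AE s (i : 'I_n) x : dual_form f i (A s x) = s i * dual_form f i x.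
  rewrite /= /scale_fun linear_sum (bigD1 i) //= big1 ?addr0 => [|j ji].
    by rewrite linearZ /= dual_form_frame // eqxx mulr1.
  by rewrite linearZ /= dual_form_frame // eq_sym val_eqE (negPf ji) mulr0.
exists (linfun (A (fun i => rho i / 4%:R))), (lambda / 4%:R),
  (linfun (A (fun i => (rho i - lambda) / 4%:R))); split.
- exists connection; split=> [|y z]; first exact: connection_levi_civita.
  rewrite ricci_tensor_frame lfunE; apply: eq_bigr => b _; rewrite AE.
  rewrite (bigD1 b) //= big1 ?addr0 => [|c cb].
    by rewrite ric_diag eqxx mul1r; ring.
  by rewrite ric_diag eq_sym (negPf cb) mul0r mul0r mulr0.
- move=> x y; rewrite !lfunE; apply: frame_ext => k.
  rewrite linearD AE; set B := A _.
  move: x; apply: scalar_frame_eq => [c u v|c u v|i].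
  + by rewrite linearPl dual_form_scalar; ring.
  + by rewrite (linearP B) !linearPl /= !dual_form_scalar; ring.
  move: y; apply: scalar_frame_eq => [c u v|c u v|j].
  + by rewrite linearPr dual_form_scalar; ring.
  + by rewrite (linearP B) !linearPr /= !dual_form_scalar; ring.
  have Af s l : A s (tnth f l) = s l *: tnth f l.
    apply: frame_ext => m; rewrite AE linearZ /= dual_form_frame //.
    by case: eqP => [/val_inj->|] //; rewrite !mulr0.
  rewrite /B !Af linearZl_LR linearZr_LR !linearZ /= !LE.
  have := der i j k; move: (N i j k) (rho i) (rho j) (rho k) => N1 r1 r2 r3 H.
  apply/eqP; rewrite -subr_eq0; apply/eqP.
  rewrite -[LHS](_ : - (N1 * (r1 + r2 - r3 - lambda)) / 4%:R = _); last by field.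
  by rewrite H oppr0 mul0r.
- apply/lfunP => x; rewrite add_lfunE scale_lfunE id_lfunE !(lfunE (A _)).
  by apply: frame_ext => k; rewrite AE linearD linearZ /= -/(A _ _) AE /=; ring.
Qed.

End StructureConstants.

(** * Model structure constants *)

(* Adapted to [G2_form]: for every c, the closed 2-forms -d e^4, -d e^5, -d e^6
   below make [G2_dual_form] closed. *)
Definition structure_terms (c : seq int) (k : nat) : seq (int * (nat * nat)) :=
  match k with
  | 4%N => [:: (c`_0, (0, 3)%N); (c`_1, (1, 2)%N)]
  | 5%N => [:: (c`_2, (0, 2)%N); (- c`_3, (1, 3)%N)]
  | 6%N => [:: (c`_4, (0, 1)%N); (c`_5, (2, 3)%N); (c`_6, (4, 5)%N)]
  | _ => [::]
  end.

Definition structure_coef c i j k : int :=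
  foldr (fun d s => (if (d.2.1 == i) && (d.2.2 == j) then d.1 else 0)
                    - (if (d.2.1 == j) && (d.2.2 == i) then d.1 else 0) + s)
    0 (structure_terms c k).

Definition closed_check c :=
  normal_form (formal_diff (structure_terms c) G2_dual_form) == [::].

Definition int_sum n (F : nat -> int) : int := foldr (fun i s => F i + s) 0 (iota 0 n).

(* Twice the Christoffel symbols, and four times the Ricci tensor. *)
Definition int_koszul c i j k :=
  structure_coef c i j k - structure_coef c j k i + structure_coef c k i j.

Definition int_ricci c b d : int := int_sum 7 (fun a => int_sum 7 (fun m =>
  int_koszul c b d m * int_koszul c a m a - int_koszul c a d m * int_koszul c b m a
  - 2 * structure_coef c a b m * int_koszul c m d a)).

Definition nilsoliton_check c (lambda : int) :=
  let rho := [seq int_ricci c b b | b <- iota 0 7] in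
  all (fun b => all (fun d => (b == d) || (int_ricci c b d == 0)) (iota 0 7)) (iota 0 7)
  && all (fun i => all (fun j => all (fun k =>
       structure_coef c i j k * (rho`_i + rho`_j - rho`_k - lambda) == 0)
     (iota 0 7)) (iota 0 7)) (iota 0 7).

(* Fitted to the list [admissible] below. *)
Definition nilsoliton_constant (c : seq int) : int :=
  - 2 * foldr (fun x s => x ^+ 2 + s) 2 c.

Definition model_check c := closed_check c && nilsoliton_check c (nilsoliton_constant c).

Section Model.
Variables (R : realType) (V : vectType R) (f : 7.-tuple V).
Hypothesis f_basis : basis_of fullv f.
Variables (L : lie_algebra V) (c : seq int).
Hypothesis L_frame : forall i j k : 'I_7,
  dual_form f k (L (tnth f i) (tnth f j)) = (structure_coef c i j k)%:~R.

Lemma frame_structure_eq k x y : dual_forms f k (L x y) =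
  \sum_(d <- structure_terms c k) d.1%:~R *
    (dual_forms f d.2.1 x * dual_forms f d.2.2 y
     - dual_forms f d.2.2 x * dual_forms f d.2.1 y).
Proof.
have [k7|k7] := ltnP k 7; last first.
  rewrite /dual_forms /= /dual_form insubN -?leqNgt //.
  by do 7![case: k k7 => // k k7]; rewrite big_nil.
have scalar_l y' : scalar (fun x => \sum_(d <- structure_terms c k) d.1%:~R *
    (dual_forms f d.2.1 x * dual_forms f d.2.2 y'
     - dual_forms f d.2.2 x * dual_forms f d.2.1 y')).
  move=> a u v; rewrite mulr_sumr -big_split; apply: eq_bigr => d _ /=.
  by rewrite !dual_form_scalar; ring.
have scalar_r x' : scalar (fun y => \sum_(d <- structure_terms c k) d.1%:~R *
    (dual_forms f d.2.1 x' * dual_forms f d.2.2 y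
     - dual_forms f d.2.2 x' * dual_forms f d.2.1 y)).
  move=> a u v; rewrite mulr_sumr -big_split; apply: eq_bigr => d _ /=.
  by rewrite !dual_form_scalar; ring.
move: x; apply: (scalar_frame_eq f_basis) => [a u v|//|i].
  by rewrite linearPl linearP.
move: y; apply: (scalar_frame_eq f_basis) => [a u v|//|j].
  by rewrite linearPr linearP.
rewrite -[k]/(val (Ordinal k7)) [LHS]L_frame /structure_coef.
elim: (structure_terms c _) => [|d s IH] /=; first by rewrite big_nil.
rewrite big_cons -IH rmorphD rmorphB /= !dual_form_frame // mulrBr.
have ifE (p q : bool) : d.1%:~R * (p%:R * q%:R) = (if p && q then d.1 else 0)%:~R :> R.
  by case: p; case: q; rewrite /= ?mul0r ?mulr0 ?mul1r ?mulr1.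
by rewrite !ifE; congr (_ - _%:~R + _); rewrite andbC.
Qed.

Lemma rmorph_int_sum n (F : nat -> int) :
  (int_sum n F)%:~R = \sum_(i < n) (F i)%:~R :> R.
Proof.
rewrite -(big_mkord xpredT (fun i => (F i)%:~R)) /int_sum /index_iota subn0.
elim: (iota 0 n) => [|i s IH] /=; first by rewrite big_nil.
by rewrite rmorphD /= big_cons IH.
Qed.

Lemma frame_coclosed : closed_check c -> coclosed L (frame_G2 f).
Proof.
move=> /eqP cc; exists (frame_metric f_basis), (frame_volume f), (frame_G2_dual f).
split; [exact: frame_G2_induced|exact: frame_hodge|move=> x].
rewrite [LHS](ce_diff_eval frame_structure_eq homogeneous_G2_dual).
rewrite form_eval_normal; last exact: homogeneous_diff homogeneous_G2_dual.
by rewrite cc /form_eval big_nil.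
Qed.

Lemma frame_nilsoliton_check lambda : nilsoliton_check c lambda ->
  nilsoliton L (frame_metric f_basis).
Proof.
case/andP => /allP offdiag /allP der.
have ricE (b d : 'I_7) : frame_ricci (fun i j k : 'I_7 => (structure_coef c i j k)%:~R : R) b d
    = (int_ricci c b d)%:~R.
  rewrite /frame_ricci /int_ricci rmorph_int_sum; apply: eq_bigr => a _.
  rewrite rmorph_int_sum; apply: eq_bigr => m _.
  by rewrite /koszul /int_koszul !(rmorphB, rmorphD, rmorphM).
apply: (frame_nilsoliton f_basis L_frame (rho := fun i => (int_ricci c i i)%:~R)
  (lambda := lambda%:~R)) => [b d|i j k].
  rewrite ricE; case: eqVneq => [->|bd]; first by rewrite mul1r.
  have /allP /(_ _ (mem_iota7 d)) := offdiag _ (mem_iota7 b).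
  by rewrite val_eqE (negPf bd) => /eqP ->; rewrite mul0r.
have /allP /(_ _ (mem_iota7 j)) /allP /(_ _ (mem_iota7 k)) := der _ (mem_iota7 i).
by rewrite !(nth_map 0%N) ?size_iota // !nth_iota // !add0n => /eqP E;
  rewrite -rmorphD -!rmorphB -rmorphM E.
Qed.

Lemma model_frame : model_check c ->
  exists phi : altform V 3,
    [/\ G2_structure phi,
        coclosed L phi
      & exists (g : {dot V for idfun}) (vol : altform V 7),
          G2_induced phi g vol /\ nilsoliton L g].
Proof.
case/andP => cc nc; exists (frame_G2 f); split.
- exact: frame_G2_structure.
- exact: frame_coclosed.
exists (frame_metric f_basis), (frame_volume f); split; first exact: frame_G2_induced.
exact: frame_nilsoliton_check nc.
Qed.

End Model.

Definition signs : seq int := [:: -1; 0; 1].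

(** First row: \dim D = 3 with a bracket form of nonzero Pfaffian; second row: the same with \dim D
    = 2. Then the isotropic spaces of bracket forms, one in dimension 2 and two in dimension 3, and
    last \dim D = 1 with one, two or three symplectic pairs. *)
Definition admissible : seq (seq int) :=
  [seq [:: 1; 1; 1; a; 1; b; 0] | a <- signs, b <- signs]
  ++ [seq [:: 1; 1; 1; a; 0; 0; 0] | a <- signs]
  ++ [:: [:: 0; 0; 1; 0; 1; 0; 0]; [:: 1; 0; 1; 0; 1; 0; 0]; [:: 0; 1; 1; 0; 1; 0; 0];
         [:: 0; 0; 0; 0; 1; 0; 0]; [:: 0; 0; 0; 0; 1; 1; 0]; [:: 0; 0; 0; 0; 1; 1; 1]].

Lemma admissible_check : all model_check admissible.
Proof. by vm_compute. Qed.

(** * Skew forms on a 4-dimensional space *)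

Section SkewMatrices4.
Variable R : realType.
Implicit Types (B C P : 'M[R]_4) (x y u v : 'rV[R]_4).

Definition o0 : 'I_4 := Ordinal (isT : 0 < 4)%N.
Definition o1 : 'I_4 := Ordinal (isT : 1 < 4)%N.
Definition o2 : 'I_4 := Ordinal (isT : 2 < 4)%N.
Definition o3 : 'I_4 := Ordinal (isT : 3 < 4)%N.

Lemma ord4P (i : 'I_4) : [\/ i = o0, i = o1, i = o2 | i = o3].
Proof.
by case: i => [[|[|[|[|//]]]] ip]; [constructor 1|constructor 2|constructor 3|constructor 4];
   apply: val_inj.
Qed.

Lemma sum4 (A : nmodType) (F : 'I_4 -> A) : \sum_i F i = F o0 + F o1 + F o2 + F o3.
Proof.
by rewrite !big_ord_recr big_ord0 /= add0r; congr (_ + _ + _ + _); congr F; apply: val_inj.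
Qed.

Definition skew4 (a b c d e f : R) : 'M[R]_4 := \matrix_(i, j)
  match val i, val j with
  | 0%N, 1%N => a | 0%N, 2%N => b | 0%N, 3%N => c
  | 1%N, 2%N => d | 1%N, 3%N => e | 2%N, 3%N => f
  | 1%N, 0%N => - a | 2%N, 0%N => - b | 3%N, 0%N => - c
  | 2%N, 1%N => - d | 3%N, 1%N => - e | 3%N, 2%N => - f
  | _, _ => 0
  end.

Definition skewsym B := B^T = - B.

Lemma skew_skew4 a b c d e f : skewsym (skew4 a b c d e f).
Proof.
apply/matrixP => i j; rewrite !mxE.
by case: (ord4P i) => ->; case: (ord4P j) => -> /=; rewrite ?opprK ?oppr0.
Qed.

Lemma skewE B : skewsym B ->
  B = skew4 (B o0 o1) (B o0 o2) (B o0 o3) (B o1 o2) (B o1 o3) (B o2 o3).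
Proof.
move=> sB; have E i j : B i j = - B j i by have /matrixP/(_ j i) := sB; rewrite !mxE => ->.
have D i : B i i = 0 by have := E i i; lra.
apply/matrixP => i j; rewrite !mxE.
by case: (ord4P i) => ->; case: (ord4P j) => -> /=; rewrite ?D // E.
Qed.

(* The wedge product of 2-forms on R^4, so that [pf B B] is twice the Pfaffian. *)
Definition pf B C : R :=
  B o0 o1 * C o2 o3 - B o0 o2 * C o1 o3 + B o0 o3 * C o1 o2
  + B o2 o3 * C o0 o1 - B o1 o3 * C o0 o2 + B o1 o2 * C o0 o3.

(** The Hodge star on 2-forms, equivalently the Pfaffian adjugate: B times [star B] is minus the
    Pfaffian of B. *)
Definition star B : 'M[R]_4 :=
  skew4 (B o2 o3) (- B o1 o3) (B o1 o2) (B o0 o3) (- B o0 o2) (B o0 o1).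

(** The polarised adjugate identity. It is a Clifford relation for the wedge pairing and the source
    of all anticommutation below. *)
Lemma mul_star B C : skewsym B -> skewsym C ->
  B *m star C + C *m star B = - (pf B C)%:M.
Proof.
move=> /skewE -> /skewE ->; rewrite /star /pf; apply/matrixP => i j.
rewrite !mxE !sum4 !mxE.
by case: (ord4P i) => ->; case: (ord4P j) => -> /=; ring.
Qed.

Lemma star_mul B C : skewsym B -> skewsym C ->
  star C *m B + star B *m C = - (pf B C)%:M.
Proof.
move=> sB sC; apply: trmx_inj; rewrite linearD linearN /= !trmx_mul tr_scalar_mx.
rewrite sB sC (skew_skew4 _ _ _ _ _ _ : skewsym (star B)).
rewrite (skew_skew4 _ _ _ _ _ _ : skewsym (star C)).
by rewrite !mulmxN !mulNmx !opprK mul_star.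
Qed.

Lemma pfC B C : pf B C = pf C B. Proof. by rewrite /pf; ring. Qed.

Lemma pf_scalar B : scalar (pf B).
Proof. by move=> c C D; rewrite /pf !mxE; ring. Qed.

Lemma skew_congr P B : skewsym B -> skewsym (P *m B *m P^T).
Proof. by rewrite /skewsym !trmx_mul trmxK => ->; rewrite mulNmx mulmxN mulmxA. Qed.

Lemma skew_unit B : skewsym B -> pf B B != 0 -> B \in unitmx.
Proof.
move=> sB pf0; have /mulmx1_unit[] // : B *m ((- 2%:R / pf B B) *: star B) = 1%:M.
have := mul_star sB sB; rewrite -mulr2n => E.
have -> : B *m ((- 2%:R / pf B B) *: star B) = - (pf B B)^-1 *: (B *m star B *+ 2).
  by rewrite -scalemxAr -scaler_nat scalerA; congr (_ *: _); field.
by rewrite E scalerN scaleNr opprK scale_scalar_mx mulVf.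
Qed.

(** Lets the invertibility of a base change be read off from a nondegenerate form that it
    produces. *)
Lemma congr_unit P B : skewsym B -> pf (P *m B *m P^T) (P *m B *m P^T) != 0 -> P \in unitmx.
Proof.
move=> sB /(skew_unit (skew_congr P sB)).
by rewrite -mulmxA unitmx_mul => /andP[].
Qed.

Lemma skew4_congr P a b c d e f (i j : 'I_4) :
  (P *m skew4 a b c d e f *m P^T) i j =
  a * (P i o0 * P j o1 - P i o1 * P j o0) + b * (P i o0 * P j o2 - P i o2 * P j o0)
  + c * (P i o0 * P j o3 - P i o3 * P j o0) + d * (P i o1 * P j o2 - P i o2 * P j o1)
  + e * (P i o1 * P j o3 - P i o3 * P j o1) + f * (P i o2 * P j o3 - P i o3 * P j o2).
Proof. by rewrite !mxE !sum4 !mxE !sum4 !mxE /=; ring. Qed.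

Lemma pf_congr P B C : skewsym B -> skewsym C -> pf B C = 0 ->
  pf (P *m B *m P^T) (P *m C *m P^T) = 0.
Proof.
move=> /skewE -> /skewE ->; move: (B o0 o1) (B o0 o2) (B o0 o3) (B o1 o2) (B o1 o3) (B o2 o3)
 (C o0 o1) (C o0 o2) (C o0 o3) (C o1 o2) (C o1 o3) (C o2 o3).
move=> b01 b02 b03 b12 b13 b23 c01 c02 c03 c12 c13 c23.
(* The 2 x 2 minors of the upper and of the lower two rows of P; D is then \det P by Laplace
   expansion, the factor by which a congruence scales [pf]. *)
pose p i j := P o0 i * P o1 j - P o0 j * P o1 i.
pose q i j := P o2 i * P o3 j - P o2 j * P o3 i.
pose D := p o0 o1 * q o2 o3 - p o0 o2 * q o1 o3 + p o0 o3 * q o1 o2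
  + p o1 o2 * q o0 o3 - p o1 o3 * q o0 o2 + p o2 o3 * q o0 o1.
set B' := skew4 _ _ _ _ _ _; set C' := skew4 _ _ _ _ _ _ => H.
suff -> : pf (P *m B' *m P^T) (P *m C' *m P^T) = D * pf B' C' by rewrite H mulr0.
rewrite /pf !skew4_congr /D /p /q !mxE /=; ring.
Qed.

End SkewMatrices4.

Section NonNullPencils.
Variable R : realType.
Implicit Types (A B C P : 'M[R]_4) (x y u v r : 'rV[R]_4).

Definition bform B x y : R := (x *m B *m y^T) 0 0.

Definition rows4 r0 r1 r2 r3 : 'M[R]_4 :=
  \matrix_(i < 4) tnth [tuple r0; r1; r2; r3] i.

Lemma bform_skew B x y : skewsym B -> bform B x y = - bform B y x.
Proof.
move=> sB; rewrite /bform.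
have -> : x *m B *m y^T = - (y *m B *m x^T)^T.
  by rewrite !trmx_mul trmxK sB mulNmx mulmxN opprK mulmxA.
by rewrite !mxE.
Qed.

Lemma bform_alt B x : skewsym B -> bform B x x = 0.
Proof. by move=> sB; have := bform_skew x x sB; lra. Qed.

Lemma rows4_congr B r0 r1 r2 r3 : skewsym B ->
  let P := rows4 r0 r1 r2 r3 in
  P *m B *m P^T = skew4 (bform B r0 r1) (bform B r0 r2) (bform B r0 r3)
                        (bform B r1 r2) (bform B r1 r3) (bform B r2 r3).
Proof.
move=> sB P; rewrite [LHS]skewE; last exact: skew_congr.
have E i j : (P *m B *m P^T) i j = bform B (row i P) (row j P).
  by rewrite /bform tr_row -row_mul mxE [RHS]mxE; apply: eq_bigr => k _; rewrite !mxE.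
by rewrite !E /P !rowK !(tnth_nth 0).
Qed.

Lemma bform_linear_l B y : scalar (fun x => bform B x y).
Proof. by move=> c u v; rewrite /bform !mulmxDl -!scalemxAl !mxE. Qed.

Lemma bform_linear_r B x : scalar (bform B x).
Proof. by move=> c u v; rewrite /bform linearD linearZ /= mulmxDr -!scalemxAr !mxE. Qed.

(* Skew forms wedge-orthogonal to a symplectic form b1 are b1(x A, y) for
   anticommuting operators A with scalar squares. *)
Section Clifford.
Variable B1 : 'M[R]_4.
Hypotheses (sB1 : skewsym B1) (p1 : pf B1 B1 != 0).

(** This is B times the inverse of B1, the inverse being written through [star]. *)
Definition clifford B : 'M[R]_4 := (- 2%:R / pf B1 B1) *: (B *m star B1).

Lemma star_mul1 : star B1 *m B1 = (- pf B1 B1 / 2%:R)%:M.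
Proof.
have := star_mul sB1 sB1; rewrite -mulr2n -scaler_nat => /(congr1 (fun M => 2%:R^-1 *: M)).
rewrite scalerA mulVf ?pnatr_eq0 // scale1r => ->.
by rewrite -scaleN1r scalerA scale_scalar_mx; congr (_%:M); field.
Qed.

Lemma mul_star1 : B1 *m star B1 = (- pf B1 B1 / 2%:R)%:M.
Proof.
have := mul_star sB1 sB1; rewrite -mulr2n -scaler_nat => /(congr1 (fun M => 2%:R^-1 *: M)).
rewrite scalerA mulVf ?pnatr_eq0 // scale1r => ->.
by rewrite -scaleN1r scalerA scale_scalar_mx; congr (_%:M); field.
Qed.

Lemma cliffordK B : clifford B *m B1 = B.
Proof.
rewrite /clifford -scalemxAl -mulmxA star_mul1 mul_mx_scalar scalerA.
by rewrite [X in X *: _](_ : _ = 1) ?scale1r //; field.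
Qed.

Lemma clifford_adj B : skewsym B -> B1 *m (clifford B)^T = B.
Proof.
move=> sB; apply: (can_inj trmxK); rewrite trmx_mul trmxK sB1 sB mulmxN.
by rewrite cliffordK.
Qed.

(** Orthogonality to B1 allows [star B1 *m B] to be replaced by [- (star B *m B1)]. Then B1 meets
    its own star and becomes a scalar, and [mul_star] applies to B and C. *)
Lemma clifford_anticomm B C : skewsym B -> skewsym C ->
  pf B1 B = 0 -> pf B1 C = 0 ->
  clifford B *m clifford C + clifford C *m clifford B = (- (2%:R * pf B C) / pf B1 B1)%:M.
Proof.
move=> sB sC pB pC.
have E D : skewsym D -> pf B1 D = 0 -> star B1 *m D = - (star D *m B1).
  move=> sD pD; have := star_mul sB1 sD; rewrite pD raddf0 oppr0 => /eqP.
  by rewrite addrC addr_eq0 => /eqP.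
rewrite /clifford -!scalemxAl -!scalemxAr !scalerA -scalerDr !mulmxA.
rewrite -(mulmxA B) -(mulmxA C) (E B) // (E C) // !mulmxN !mulNmx -!mulmxA mul_star1.
rewrite !mul_mx_scalar -!scalemxAr -opprD -scalerDr mul_star // !scalerN opprK.
by rewrite !scale_scalar_mx; congr (_%:M); field.
Qed.

Lemma clifford_sqr B : skewsym B -> pf B1 B = 0 ->
  clifford B *m clifford B = (- (pf B B / pf B1 B1))%:M.
Proof.
move=> sB pB; have := clifford_anticomm sB sB pB pB.
rewrite -mulr2n -scaler_nat => /(congr1 (fun M => 2%:R^-1 *: M)).
rewrite scalerA mulVf ?pnatr_eq0 // scale1r => ->.
by rewrite scale_scalar_mx; congr (_%:M); field.
Qed.

Lemma bform_clifford B x y : bform B1 (x *m clifford B) y = bform B x y.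
Proof. by rewrite /bform -(mulmxA x) cliffordK. Qed.

Lemma bform_cliffordr B x y : skewsym B -> bform B1 x (y *m clifford B) = bform B x y.
Proof. by move=> sB; rewrite /bform trmx_mul mulmxA -(mulmxA x) clifford_adj. Qed.

End Clifford.
End NonNullPencils.

Section NonNullNormalForms.
Variable R : realType.
Implicit Types (A B C P S : 'M[R]_4) (x y u v r : 'rV[R]_4).

Lemma bform_delta B i j : bform B (delta_mx 0 i) (delta_mx 0 j) = B i j.
Proof. by rewrite /bform -rowE trmx_delta -colE !mxE. Qed.

Lemma bform_addl B u v y : bform B (u + v) y = bform B u y + bform B v y.
Proof. by have := bform_linear_l B y 1 u v; rewrite scale1r mul1r. Qed.

Lemma bform_addr B x u v : bform B x (u + v) = bform B x u + bform B x v.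
Proof. by have := bform_linear_r B x 1 u v; rewrite scale1r mul1r. Qed.

Lemma bform_scaler B x c u : bform B x (c *: u) = c * bform B x u.
Proof. by rewrite /bform linearZ /= -scalemxAr mxE. Qed.

Lemma bform_oppr B x u : bform B x (- u) = - bform B x u.
Proof. by rewrite -scaleN1r bform_scaler mulN1r. Qed.

Lemma bform_scalel B y c u : bform B (c *: u) y = c * bform B u y.
Proof. by rewrite /bform -!scalemxAl mxE. Qed.

Lemma bform_quadratic_neq0 S : S^T = S -> S != 0 -> exists x, bform S x x != 0.
Proof.
move=> symS /matrix0Pn[i [j Sij]].
have [ii|] := eqVneq (bform S (delta_mx 0 i) (delta_mx 0 i)) 0; last by exists (delta_mx 0 i).
have [jj|] := eqVneq (bform S (delta_mx 0 j) (delta_mx 0 j)) 0; last by exists (delta_mx 0 j).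
exists (delta_mx 0 i + delta_mx 0 j).
rewrite bform_addl !bform_addr ii jj !bform_delta add0r addr0.
have -> : S j i = S i j by rewrite -{1}symS mxE.
by rewrite -mulr2n mulrn_eq0.
Qed.

(** A matrix that is not scalar has a nonzero off-diagonal entry, witnessed by two unit vectors, or
    two distinct diagonal entries, witnessed by the sum and the difference of two unit vectors. *)
Lemma nonscalar_witness C : (forall c, C != c%:M) ->
  exists u v, bform 1%:M u v = 0 /\ bform C u v != 0.
Proof.
move=> nsC; case: (pickP (fun p : 'I_4 * 'I_4 => (p.1 != p.2) && (C p.1 p.2 != 0))).
  move=> [i j] /= /andP[ij Cij]; exists (delta_mx 0 i), (delta_mx 0 j).
  by rewrite !bform_delta mxE (negPf ij).
move=> diagC; case: (pickP (fun i => C i i != C o0 o0)) => [i Ci|scalC].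
  have i0 : i != o0 by apply: contraNneq Ci => ->.
  have Ci0 : C i o0 = 0 by have /negbT := diagC (i, o0); rewrite /= i0 negbK => /eqP.
  have C0i : C o0 i = 0.
    by have /negbT := diagC (o0, i); rewrite /= eq_sym i0 negbK => /eqP.
  exists (delta_mx 0 i + delta_mx 0 o0), (delta_mx 0 i - delta_mx 0 o0).
  rewrite !bform_addl !bform_addr !bform_oppr !bform_delta Ci0 C0i !mxE !eqxx.
  by rewrite [o0 == i]eq_sym (negPf i0) !(oppr0, addr0, add0r) subrr subr_eq0.
have /eqP[] := nsC (C o0 o0); apply/matrixP => i j; rewrite !mxE.
have [->|ij] := eqVneq i j; first by have /negbFE/eqP := scalC j.
by have /negbT := diagC (i, j); rewrite /= ij negbK => /eqP.
Qed.

Section Normal.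
Variables B1 B2 : 'M[R]_4.
Hypotheses (sB1 : skewsym B1) (p1 : pf B1 B1 != 0).
Hypotheses (sB2 : skewsym B2) (p12 : pf B1 B2 = 0) (B2_neq0 : B2 != 0).
Let e2 := pf B2 B2 / pf B1 B1.
Let A2 := clifford B1 B2.

(** B2 is not a multiple of B1, as [p12] would make the factor 0. So B1^-1 B2 is not scalar, and its
    witness u, v is carried over by x = u B1^-1. *)
Lemma pair_witness : exists x y, bform B1 x y = 0 /\ bform B2 x y = 1.
Proof.
have uB1 := skew_unit sB1 p1.
have [|u [v [uv Cuv]]] := @nonscalar_witness (invmx B1 *m B2).
  move=> c; apply: contraNneq B2_neq0 => E.
  have E2 : B2 = c *: B1.
    by rewrite -(mulKVmx uB1 B2) E mul_mx_scalar.
  have : c * pf B1 B1 = 0 by rewrite -p12 E2 -[c *: B1]addr0 pf_scalar /pf !mxE !mulr0; ring.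
  by move/eqP; rewrite mulf_eq0 (negPf p1) orbF E2 => /eqP ->; rewrite scale0r.
exists (u *m invmx B1), ((bform (invmx B1 *m B2) u v)^-1 *: v).
rewrite !bform_scaler; split.
  have -> : bform B1 (u *m invmx B1) v = bform 1%:M u v by rewrite /bform mulmxKV // mulmx1.
  by rewrite uv mulr0.
by rewrite [X in _ * X](_ : _ = bform (invmx B1 *m B2) u v) ?mulVf // /bform mulmxA.
Qed.

Lemma clifford_sqr_row x : x *m A2 *m A2 = - e2 *: x.
Proof. by rewrite -mulmxA clifford_sqr // mul_mx_scalar. Qed.

(** A2 is self-adjoint for B1 with scalar square, so every entry reduces to B1(x, y) = 0, B2(x, y) =
    1 or a value of a skew form at a repeated vector. *)
Lemma pair_normal_form : exists x y,
  let P := rows4 x (x *m A2) y (y *m A2) in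
  [/\ P \in unitmx,
      P *m B1 *m P^T = skew4 0 0 1 1 0 0
    & P *m B2 *m P^T = skew4 0 1 0 0 (- e2) 0].
Proof.
have [x [y [xy xy2]]] := pair_witness; exists x, y => P.
have b1l u v : bform B1 (u *m A2) v = bform B2 u v := bform_clifford sB1 p1 B2 u v.
have b1r u v : bform B1 u (v *m A2) = bform B2 u v := bform_cliffordr sB1 p1 u v sB2.
have E1 : P *m B1 *m P^T = skew4 0 0 1 1 0 0.
  rewrite rows4_congr //; congr skew4; rewrite ?b1l ?b1r ?bform_alt //.
  by rewrite -b1l b1r -b1l clifford_sqr_row bform_scalel xy mulr0.
split=> //.
  by apply: (congr_unit sB1); rewrite E1 /pf !mxE /=; apply/eqP; lra.
rewrite rows4_congr //; congr skew4; rewrite ?bform_alt //.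
- by rewrite -b1l bform_alt.
- by rewrite -b1l b1r -b1l clifford_sqr_row bform_scalel xy mulr0.
- by rewrite -b1l clifford_sqr_row bform_scalel xy mulr0.
- by rewrite -b1l clifford_sqr_row bform_scalel b1r xy2 mulr1.
- by rewrite -b1l bform_alt.
Qed.

Section Triple.
Variable B3 : 'M[R]_4.
Hypotheses (sB3 : skewsym B3) (p13 : pf B1 B3 = 0) (p23 : pf B2 B3 = 0).
Hypothesis B3_nprop : forall t, B3 != t *: B2.
Let e3 := pf B3 B3 / pf B1 B1.
Let A3 := clifford B1 B3.

Let b1l2 u v : bform B1 (u *m A2) v = bform B2 u v := bform_clifford sB1 p1 B2 u v.
Let b1r2 u v : bform B1 u (v *m A2) = bform B2 u v := bform_cliffordr sB1 p1 u v sB2.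
Let b1l3 u v : bform B1 (u *m A3) v = bform B3 u v := bform_clifford sB1 p1 B3 u v.
Let b1r3 u v : bform B1 u (v *m A3) = bform B3 u v := bform_cliffordr sB1 p1 u v sB3.

Lemma anticomm_row x : x *m A2 *m A3 = - (x *m A3 *m A2).
Proof.
apply/eqP; rewrite -addr_eq0 -!mulmxA -mulmxDr clifford_anticomm // p23.
by rewrite mulr0 oppr0 mul0r raddf0 mulmx0.
Qed.

(** If the product vanishes, so does A3 A2. For e2 nonzero, A2 is invertible and B3 = 0. For e2 = 0,
    B3 vanishes as soon as one argument is in the image of A2, so in the basis of [pair_normal_form]
    only its entry at x, y survives and B3 is a multiple of B2. *)
Lemma A2A3_neq0 : A2 *m A3 != 0.
Proof.
apply/negP => /eqP A23.
have A32 : A3 *m A2 = 0.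
  have := clifford_anticomm sB1 p1 sB2 sB3 p12 p13.
  by rewrite -/A2 -/A3 A23 add0r p23 mulr0 oppr0 mul0r raddf0.
have sq2 : A2 *m A2 = (- e2)%:M by apply: clifford_sqr.
have sq3 : A3 *m A3 = (- e3)%:M by apply: clifford_sqr.
have [e20|e20] := eqVneq e2 0; last first.
  have : - e2 *: A3 = 0 by rewrite -mul_scalar_mx -sq2 -mulmxA A23 mulmx0.
  move/eqP; rewrite scaler_eq0 oppr_eq0 (negPf e20) /= => /eqP A30.
  have := B3_nprop 0; rewrite scale0r -(cliffordK sB1 p1 B3) -/A3 A30 mul0mx.
  by rewrite eqxx.
have [x [y [uP E1 E2]]] := pair_normal_form; set P := rows4 _ _ _ _ in uP E1 E2.
suff E3 : P *m B3 *m P^T = skew4 0 (bform B3 x y) 0 0 0 0.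
  have := B3_nprop (bform B3 x y); rewrite -subr_eq0 => /eqP[].
  have tuP : P^T \in unitmx by rewrite unitmx_tr.
  apply: (can_inj (mulKmx uP)); apply: (can_inj (mulmxK tuP)).
  rewrite mulmx0 mul0mx mulmxBr mulmxBl -scalemxAr -scalemxAl E2 E3 e20.
  by apply/matrixP => i j; rewrite !mxE; case: (ord4P i) => ->; case: (ord4P j) => -> /=; ring.
have Z u v : bform B3 u (v *m A2) = 0.
  by rewrite -b1l3 b1r2 -b1l2 -(mulmxA u) A32 mulmx0 /bform !mul0mx mxE.
have Z' u v : bform B3 (u *m A2) v = 0.
  by rewrite -b1l3 -(mulmxA u) A23 mulmx0 /bform !mul0mx mxE.
by rewrite rows4_congr // !Z !Z'.
Qed.

(** The basis is x, x A2, x A3, x A3 A2. It degenerates only if h = B1(x A2, x A3) = 0; this h is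
    the value at x of the form with matrix A2 A3 B1. *)
Lemma triple_normal_form : exists P h,
  [/\ P \in unitmx, h != 0,
      P *m B1 *m P^T = h *: skew4 0 0 1 1 0 0,
      P *m B2 *m P^T = h *: skew4 0 1 0 0 (- e2) 0
    & P *m B3 *m P^T = - h *: skew4 1 0 0 0 0 e3].
Proof.
have scale_skew4 k a b c d e f :
    k *: skew4 a b c d e f = skew4 (k * a) (k * b) (k * c) (k * d) (k * e) (k * f).
  by apply/matrixP => i j; rewrite !mxE; case: (ord4P i) => ->; case: (ord4P j) => -> /=; ring.
(* The B1-adjoint of A2 A3 is A3 A2 = - A2 A3, and B1 is skew, so the two signs cancel. A nonzero
   symmetric form has a vector x with nonzero value. *)
have symS : (A2 *m A3 *m B1)^T = A2 *m A3 *m B1.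
  transitivity (B2 *m A3^T).
    have -> : A2 *m A3 = - (A3 *m A2).
      apply/eqP; rewrite -addr_eq0 clifford_anticomm // p23.
      by rewrite mulr0 oppr0 mul0r raddf0.
    by rewrite mulNmx linearN /= -mulmxA cliffordK // trmx_mul sB2 mulNmx opprK.
  by rewrite -mulmxA cliffordK // -[in RHS](clifford_adj sB1 p1 sB3) mulmxA cliffordK.
have [|x hx] := bform_quadratic_neq0 symS.
  apply/negP => /eqP S0; have := A2A3_neq0; rewrite -(mulmxK (skew_unit sB1 p1) (_ *m _)).
  by rewrite S0 mul0mx eqxx.
pose h := bform B1 (x *m A2) (x *m A3).
have h0 : h != 0 by rewrite /h b1r3 -b1l3 /bform -!mulmxA mulmxA in hx *.
pose P := rows4 x (x *m A2) (x *m A3) (x *m A3 *m A2).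
have sq2 u : u *m A2 *m A2 = - e2 *: u by apply: clifford_sqr_row.
have sq3 u : u *m A3 *m A3 = - e3 *: u by rewrite -mulmxA clifford_sqr // mul_mx_scalar.
have b03 : bform B1 x (x *m A3 *m A2) = h by rewrite b1r2 -b1l2.
have b13 : bform B1 (x *m A2) (x *m A3 *m A2) = 0.
  by rewrite b1r2 -b1l2 sq2 bform_scalel b1r3 bform_alt // mulr0.
have E1 : P *m B1 *m P^T = h *: skew4 0 0 1 1 0 0.
  rewrite rows4_congr // scale_skew4 !mulr0 !mulr1 b03 b13.
  by congr skew4; rewrite ?b1r2 ?b1r3 ?bform_alt.
exists P, h; split=> //.
- apply: (congr_unit sB1); rewrite E1 /pf !mxE /= !mulr0 !mulr1 !oppr0 !addr0 !add0r.
  by rewrite -mulr2n mulrn_eq0 mulf_neq0.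
- rewrite rows4_congr // scale_skew4 !mulr0 mulr1; congr skew4.
  + by rewrite -b1l2 bform_alt.
  + by rewrite -b1l2.
  + by rewrite -b1l2.
  + by rewrite -b1l2 sq2 bform_scalel b1r3 bform_alt // mulr0.
  + by rewrite -b1l2 sq2 bform_scalel b03 mulrC.
  + by rewrite -b1l2 bform_alt.
- rewrite rows4_congr // scale_skew4 !mulr0 mulr1; congr skew4.
  + by rewrite -b1l3 bform_skew.
  + by rewrite -b1l3 bform_alt.
  + by rewrite -b1l3 b1r2 bform_alt.
  + by rewrite -b1l3 anticomm_row bform_skew // bform_oppr opprK b1r2 bform_alt.
  + by rewrite -b1l3 anticomm_row bform_skew // bform_oppr opprK bform_alt.
  + by rewrite -b1l3 sq3 bform_scalel b03 mulrC mulNr mulrN.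
Qed.

End Triple.
End Normal.
End NonNullNormalForms.

(** * Bases adapted to bilinear forms *)

Section BilinearBases.
Variables (R : realType) (E : vectType R).
Implicit Types (W K : {vspace E}) (X : seq E).

Lemma kernel_space (h : E -> R) : scalar h -> exists K, forall w, (w \in K) = (h w == 0).
Proof.
move=> hs; pose H : {linear E -> R^o} := HB.pack h (GRing.isLinear.Build R E R^o _ h hs).
by exists (lker (linfun H)) => w; rewrite memv_ker lfunE.
Qed.

Lemma cons_basis W K v X : v \in W -> (K <= W)%VS -> v \notin K ->
  (forall w, w \in W -> exists c, w - c *: v \in K) ->
  basis_of K X -> basis_of W (v :: X).
Proof.
move=> vW KW vK split_w /andP[/eqP spX fX].
rewrite /basis_of free_cons spX vK fX andbT span_cons spX eqEsubv.
rewrite subv_add -memvE vW KW andbT; apply/subvP => w /split_w[c wc].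
by rewrite -(subrKC (c *: v) w) memv_add // memvZ // memv_line.
Qed.

Section Symmetric.
Variable q : E -> E -> R.
Hypotheses (q_scalar : forall v, scalar (q v)) (q_sym : forall u v, q u v = q v u).

Lemma quadratic_neq0 u v : q u v != 0 -> exists2 w, w \in <<[:: u; v]>>%VS & q w w != 0.
Proof.
move=> uv; have [uu|] := eqVneq (q u u) 0; last first.
  by exists u => //; rewrite memv_span // mem_head.
have [vv|] := eqVneq (q v v) 0; last first.
  by exists v => //; rewrite memv_span // !inE eqxx orbT.
exists (u + v); first by rewrite memvD // memv_span // !inE eqxx ?orbT.
have add x y z : q x (y + z) = q x y + q x z.
  by have := q_scalar x 1 y z; rewrite scale1r mul1r.
by rewrite add ![q (u + v) _]q_sym !add uu vv addr0 add0r [q v u]q_sym -mulr2n mulrn_eq0.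
Qed.

Lemma scalar_basis (h : E -> R) W X : scalar h -> basis_of W X ->
  (forall i, (i < size X)%N -> h X`_i = 0) -> forall w, w \in W -> h w = 0.
Proof.
move=> hs bX hX w; rewrite -(span_basis bX) -[X]in_tupleE => /coord_span ->.
by rewrite scalar_sum // big1 // => i _; rewrite hX ?mulr0.
Qed.

(** The basis starts with a non-isotropic vector whenever W has one; hence an isotropic first vector
    means that q vanishes on W. The rest of the basis comes from the orthogonal of that vector. *)
Lemma orthogonal_basis W : exists X, [/\ basis_of W X,
    forall i j, (i < size X)%N -> (j < size X)%N -> i != j -> q X`_i X`_j = 0
  & q X`_0 X`_0 = 0 -> forall v w, v \in W -> w \in W -> q v w = 0].
Proof.
move: {2}(\dim W) (leqnn (\dim W)) => m; elim: m W => [|m IH] W dW.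
  have -> : W = 0%VS by apply/eqP; rewrite -dimv_eq0 -leqn0.
  exists [::]; split=> //; first exact: nil_basis.
  by move=> q0 v w; rewrite !memv0 => /eqP -> /eqP ->.
pose b := vbasis W; have bW : basis_of W b := vbasisP W.
case: (pickP (fun p : 'I_(\dim W) * 'I_(\dim W) => q b`_p.1 b`_p.2 != 0)) => [[i j] /=|q0].
  move=> /quadratic_neq0[v vij vv].
  have vW : v \in W.
    move: v vij {vv}; apply/subvP/span_subvP => x.
    by rewrite !inE => /pred2P[] ->; apply: vbasis_mem; rewrite mem_nth // size_tuple.
  have [K0 K0E] := kernel_space (q_scalar v); pose K := (W :&: K0)%VS.
  have vK : v \notin K by rewrite memv_cap K0E negb_and vv orbT.
  have KW : (K <= W)%VS by apply: capvSl.
  have dK : (\dim K <= m)%N.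
    rewrite -ltnS; apply: leq_trans dW; rewrite ltn_neqAle dimvS // andbT.
    apply: contra vK => /eqP dE; rewrite (_ : K = W) //.
    by apply/eqP; rewrite -(dimv_leqif_eq KW) dE.
  have [X [bX oX _]] := IH K dK; exists (v :: X); split.
  - apply: cons_basis bX => // w wW; exists (q v w / q v v).
    rewrite memv_cap memvB ?memvZ //= K0E addrC -scaleNr q_scalar.
    by rewrite mulNr divfK // addNr.
  - have vX k : (k < size X)%N -> q v X`_k = 0.
      move=> kX; apply/eqP; rewrite -K0E; have : X`_k \in K.
        by rewrite (basis_mem bX) // mem_nth.
      by rewrite memv_cap => /andP[].
    by case=> [|k] [|l] //= kX lX kl; rewrite ?vX //; [rewrite q_sym vX|apply: oX].
  - by move=> /= qv; rewrite qv eqxx in vv.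
exists b; split=> // [k l kb lb _|_ v w vW wW].
  have kW : (k < \dim W)%N by rewrite size_tuple in kb.
  have lW : (l < \dim W)%N by rewrite size_tuple in lb.
  by have /negbFE/eqP := q0 (Ordinal kW, Ordinal lW).
apply: (scalar_basis (q_scalar v) bW) wW => l lb; rewrite q_sym.
apply: (scalar_basis (q_scalar _) bW) vW => k kb.
have kW : (k < \dim W)%N by rewrite size_tuple in kb.
have lW : (l < \dim W)%N by rewrite size_tuple in lb.
by have /negbFE/eqP := q0 (Ordinal lW, Ordinal kW).
Qed.

End Symmetric.

Section Alternating.
Variable B : E -> E -> R.
Hypotheses (B_scalar : forall v, scalar (B v)) (B_scalar_l : forall v, scalar (B^~ v)).
Hypothesis B_alt : forall v, B v v = 0.

Lemma alternating_skew u v : B u v = - B v u.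
Proof.
have addr x y z : B x (y + z) = B x y + B x z.
  by have := B_scalar x 1 y z; rewrite scale1r mul1r.
have addl x y z : B (y + z) x = B y x + B z x.
  by have := B_scalar_l x 1 y z; rewrite /= scale1r mul1r.
have := B_alt (u + v); rewrite addl !addr !B_alt add0r addr0 => /eqP.
by rewrite addr_eq0 => /eqP.
Qed.

(** The r hyperbolic pairs occupy the positions 2k, 2k+1 at the front; everything after them lies in
    the radical. *)
Lemma symplectic_basis W : exists r X, [/\ (r.*2 <= size X)%N, basis_of W X
  & forall i j, (i < j < size X)%N ->
      B X`_i X`_j = [&& ~~ odd i, j == i.+1 & (i < r.*2)%N]%:R].
Proof.
move: {2}(\dim W) (leqnn (\dim W)) => m; elim/ltn_ind: m W => m IH W dW.
pose b := vbasis W; have bW : basis_of W b := vbasisP W.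
case: (pickP (fun p : 'I_(\dim W) * 'I_(\dim W) => B b`_p.1 b`_p.2 != 0)) => [[i j] /=|B0];
  last first.
  exists 0%N, b; split=> // i j /andP[ij jb]; rewrite ltn0 !andbF.
  have iW : (i < \dim W)%N by rewrite size_tuple in jb; apply: ltn_trans jb.
  have jW : (j < \dim W)%N by rewrite size_tuple in jb.
  by have /negbFE/eqP := B0 (Ordinal iW, Ordinal jW).
set x := b`_i => Bxy; pose y := (B x b`_j)^-1 *: b`_j.
have bmem k : (k < \dim W)%N -> b`_k \in W.
  by move=> kW; apply: vbasis_mem; rewrite mem_nth // size_tuple.
have xW : x \in W by apply: bmem.
have yW : y \in W by rewrite memvZ // bmem.
have xy : B x y = 1.
  have := B_scalar x (B x b`_j)^-1 b`_j 0; rewrite addr0 => ->.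
  have -> : B x 0 = 0.
    by have := B_scalar x (-1) 0 0; rewrite scaler0 addr0 mulN1r => H; lra.
  by rewrite addr0 mulVf.
have [K1 K1E] := kernel_space (B_scalar_l y); have [K2 K2E] := kernel_space (B_scalar x).
(* W1 still contains y but not x, and W2 drops y as well, so x and y are adjoined to a basis of W2
   one after the other. *)
pose W1 := (W :&: K1)%VS; pose W2 := (W1 :&: K2)%VS.
have W1W : (W1 <= W)%VS by apply: capvSl.
have W21 : (W2 <= W1)%VS by apply: capvSl.
have yW1 : y \in W1 by rewrite memv_cap yW K1E B_alt /=.
have xW1 : x \notin W1 by rewrite memv_cap K1E xy oner_eq0 andbF.
have yW2 : y \notin W2 by rewrite memv_cap K2E xy oner_eq0 andbF.
have dW2 : (\dim W2 < m)%N.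
  apply: leq_trans dW; apply: leq_ltn_trans (dimvS W21) _.
  rewrite ltn_neqAle dimvS // andbT; apply: contra xW1 => /eqP dE.
  by rewrite (_ : W1 = W) //; apply/eqP; rewrite -(dimv_leqif_eq W1W) dE.
have [r [X [rX bX BX]]] := IH _ dW2 W2 (leqnn _).
have Xmem k : (k < size X)%N -> X`_k \in W2 by move=> kX; rewrite (basis_mem bX) // mem_nth.
have xX k : (k < size X)%N -> B x X`_k = 0.
  by move/Xmem; rewrite memv_cap K2E => /andP[_ /eqP].
have yX k : (k < size X)%N -> B y X`_k = 0.
  move/Xmem; rewrite !memv_cap K1E => /andP[/andP[_ /eqP E1] _].
  by rewrite alternating_skew E1 oppr0.
exists r.+1, [:: x, y & X]; split.
- by rewrite doubleS /= !ltnS.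
- apply: (cons_basis xW W1W xW1) => [w wW|].
    exists (B w y); rewrite memv_cap memvB ?memvZ //= K1E addrC -scaleNr.
    by have /= -> := B_scalar_l y (- B w y) x w; rewrite xy mulr1 addNr.
  apply: (cons_basis yW1 W21 yW2) bX => w wW; exists (B x w).
  rewrite memv_cap (memvB wW (memvZ _ yW1)) K2E addrC -scaleNr B_scalar.
  by rewrite xy mulr1 addNr eqxx.
case=> [|[|i']] [|[|j']] //=; rewrite ?ltnS.
- by move=> jX; rewrite xX.
- by move=> jX; rewrite yX.
by move=> ijX; rewrite BX // !eqSS negbK.
Qed.

End Alternating.
End BilinearBases.

(** * Spaces of skew forms on a 4-dimensional space *)

Section SkewSpaces.
Variable R : realType.
Implicit Types (B P : 'M[R]_4) (W : {vspace 'M[R]_4}).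

(* B is in the span of the forms - d e^4, - d e^5, - d e^6 restricted to e0..e3. *)
Definition fits (c : seq int) B := exists t0 t1 t2 : R,
  B = skew4 (t2 * (c`_4)%:~R) (t1 * (c`_2)%:~R) (t0 * (c`_0)%:~R)
            (t0 * (c`_1)%:~R) (- (t1 * (c`_3)%:~R)) (t2 * (c`_5)%:~R).

Lemma skew4_linear k a b c d e f a' b' c' d' e' f' :
  k *: skew4 a b c d e f + skew4 a' b' c' d' e' f' =
  skew4 (k * a + a') (k * b + b') (k * c + c') (k * d + d') (k * e + e') (k * f + f') :> 'M[R]_4.
Proof.
by apply/matrixP => i j; rewrite !mxE; case: (ord4P i) => ->; case: (ord4P j) => -> /=; ring.
Qed.

Lemma fits_linear c k B B' : fits c B -> fits c B' -> fits c (k *: B + B').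
Proof.
move=> [t0 [t1 [t2 ->]]] [u0 [u1 [u2 ->]]].
exists (k * t0 + u0), (k * t1 + u1), (k * t2 + u2).
by rewrite skew4_linear; congr skew4; ring.
Qed.

Lemma fits0 c : fits c 0.
Proof.
exists 0, 0, 0; rewrite !mul0r oppr0; apply/matrixP => i j.
by rewrite !mxE; case: (ord4P i) => ->; case: (ord4P j) => -> /=; rewrite ?oppr0.
Qed.

Lemma fits_scale c k B : fits c B -> fits c (k *: B).
Proof. by move=> fB; rewrite -[_ *: B]addr0; apply: fits_linear => //; apply: fits0. Qed.

Lemma fits_basis c P W X : basis_of W X ->
  (forall i, (i < size X)%N -> fits c (P *m X`_i *m P^T)) ->
  forall B, B \in W -> fits c (P *m B *m P^T).
Proof.
move=> bX fX B; rewrite -(span_basis bX) -[X]in_tupleE => /coord_span ->.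
apply: (big_rec (fun M => fits c (P *m M *m P^T))) => [|i M _ fM].
  by rewrite mulmx0 mul0mx; apply: fits0.
rewrite mulmxDr mulmxDl -scalemxAr -scalemxAl; apply: fits_linear => //.
exact: fX.
Qed.

Lemma rows4_unit (X : 4.-tuple 'rV[R]_4) : basis_of fullv X ->
  rows4 X`_0 X`_1 X`_2 X`_3 \in unitmx.
Proof.
move=> bX; pose Q := \matrix_(i < 4, j < 4) coord X j (delta_mx 0 i).
suff /mulmx1_unit[] : Q *m rows4 X`_0 X`_1 X`_2 X`_3 = 1%:M by [].
apply/row_matrixP => i; rewrite row_mul row1 mulmx_sum_row.
rewrite [RHS](coord_basis bX (memvf _)); apply: eq_bigr => j _.
by rewrite !mxE rowK !(tnth_nth 0); case: (ord4P j) => ->.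
Qed.

(** A symplectic basis has 0, 1 or 2 pairs; [B != 0] excludes 0 and [pf B B = 0] excludes 2. *)
Lemma null_normal_form B : skewsym B -> B != 0 -> pf B B = 0 ->
  exists2 P, P \in unitmx & P *m B *m P^T = skew4 1 0 0 0 0 0.
Proof.
move=> sB B0 pB; have [r [X [rX bX BX]]] := symplectic_basis (bform_linear_r B)
  (bform_linear_l B) (fun x => bform_alt x sB) fullv.
have sX : size X = 4%N by rewrite -(size_basis (X := in_tuple X) bX) dimvf dim_matrix.
have sXb : size X == 4%N by rewrite sX.
pose P := rows4 X`_0 X`_1 X`_2 X`_3.
have uP : P \in unitmx by apply: (@rows4_unit (Tuple sXb)).
have E : P *m B *m P^T = skew4 (0 < r)%:R 0 0 0 0 (1 < r)%:R.
  rewrite rows4_congr // !BX ?sX //=; congr skew4; congr (_%:R : R); lia.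
exists P => //; rewrite E.
have := pf_congr P sB sB pB; rewrite E /pf !mxE /= => H.
case: r E H {rX BX} => [|[|r]] E H //=; last by exfalso; move: H => /= H; lra.
have uPT : P^T \in unitmx by rewrite unitmx_tr.
case/eqP: B0; apply: (can_inj (mulKmx uP)); apply: (can_inj (mulmxK uPT)).
rewrite E mulmx0 mul0mx; apply/matrixP => i j.
by rewrite !mxE; case: (ord4P i) => ->; case: (ord4P j) => -> /=; rewrite ?oppr0.
Qed.

Lemma rank_one_witness (a b c d : R) : [|| a != 0, b != 0, c != 0 | d != 0] ->
  exists x0 x1 y0 y1, x0 * (a * y0 + b * y1) + x1 * (c * y0 + d * y1) != 0.
Proof.
case/or4P => H; [exists 1, 0, 1, 0|exists 1, 0, 0, 1|exists 0, 1, 1, 0|exists 0, 1, 0, 1];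
by rewrite !(mul1r, mul0r, mulr1, mulr0, addr0, add0r).
Qed.

Lemma null_pair_normal_form B1 B2 : skewsym B1 -> skewsym B2 -> B1 != 0 ->
  (forall t, B2 != t *: B1) -> pf B1 B1 = 0 -> pf B1 B2 = 0 -> pf B2 B2 = 0 ->
  exists P h k, [/\ P \in unitmx, h != 0, P *m B1 *m P^T = skew4 (- h) 0 0 0 0 0
    & P *m B2 *m P^T = skew4 k h 0 0 0 0].
Proof.
move=> s1 s2 B10 nprop p11 p12 p22; have [P1 uP1 E1] := null_normal_form s1 B10 p11.
have := pf_congr P1 s1 s2 p12; have := pf_congr P1 s2 s2 p22; rewrite E1.
have := skewE (skew_congr P1 s2).
move: (_ o0 o1) (_ o0 o2) (_ o0 o3) (_ o1 o2) (_ o1 o3) (_ o2 o3) => b01 b02 b03 b12 b13 b23 E2.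
(* With B1 = e^01, orthogonality to B1 gives b23 = 0, and then [pf B2 B2 = 0] makes the block M of
   b02, b03, b12, b13 singular. M is nonzero because B2 is not a multiple of B1. *)
rewrite E2 /pf !mxE /= => q22 q12; have b230 : b23 = 0 by lra.
have [|x0 [x1 [y0 [y1 h0]]]] := @rank_one_witness b02 b03 b12 b13.
  rewrite -!negb_and; apply: contra_neqN (nprop b01).
  move=> /and4P[/eqP b020 /eqP b030 /eqP b120 /eqP b130].
  have uPT : P1^T \in unitmx by rewrite unitmx_tr.
  apply: (can_inj (mulKmx uP1)); apply: (can_inj (mulmxK uPT)).
  rewrite E2 -scalemxAr -scalemxAl E1 b020 b030 b120 b130 b230.
  by apply/matrixP => i j; rewrite !mxE; case: (ord4P i) => ->; case: (ord4P j) => -> /=; ring.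
set h := (X in X != 0) in h0.
pose m0 := b02 * y0 + b03 * y1; pose m1 := b12 * y0 + b13 * y1.
pose n0 := x0 * b02 + x1 * b12; pose n1 := x0 * b03 + x1 * b13.
(* Here h = x M y. The upper block has the rows x and a vector annihilating M y, the lower block the
   rows y and a vector annihilated by x M; both have determinant -h. This isolates the entry h of
   the rank one matrix M. *)
pose P2 : 'M[R]_4 := \matrix_(i, j) match val i, val j with
  | 0%N, 0%N => x0 | 0%N, 1%N => x1 | 1%N, 0%N => m1 | 1%N, 1%N => - m0
  | 2%N, 2%N => y0 | 2%N, 3%N => y1 | 3%N, 2%N => n1 | 3%N, 3%N => - n0 | _, _ => 0 end.
have congr2 a b c d e f : P2 *m skew4 a b c d e f *m P2^T =
  skew4 (- h * a) (x0 * (b * y0 + c * y1) + x1 * (d * y0 + e * y1))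
        (x0 * (b * n1 - c * n0) + x1 * (d * n1 - e * n0))
        (m1 * (b * y0 + c * y1) - m0 * (d * y0 + e * y1))
        (m1 * (b * n1 - c * n0) - m0 * (d * n1 - e * n0)) (- h * f).
  rewrite [LHS]skewE; last exact/skew_congr/skew_skew4.
  by congr skew4; rewrite skew4_congr !mxE /= /h /m0 /m1 /n0 /n1; ring.
exists (P2 *m P1), h, (- h * b01).
have tr21 B : P2 *m P1 *m B *m (P2 *m P1)^T = P2 *m (P1 *m B *m P1^T) *m P2^T.
  by rewrite trmx_mul !mulmxA.
split=> //.
(* The symplectic test form e^01 + e^23 is sent to -h times itself. *)
- rewrite unitmx_mul uP1 andbT; apply: (congr_unit (skew_skew4 1 0 0 0 0 1)).
  rewrite congr2 /pf !mxE /= !(mulr0, mulr1, mul0r, addr0, add0r, subr0, oppr0).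
  by rewrite mulrNN -mulr2n mulrn_eq0 mulf_neq0.
- by rewrite tr21 E1 congr2; congr skew4; ring.
- rewrite tr21 E2 congr2 b230; congr skew4; rewrite ?mulr0 //; rewrite /m0 /m1 /n0 /n1; try ring.
  have -> : m1 * (b02 * n1 - b03 * n0) - m0 * (b12 * n1 - b13 * n0) = h * (b02 * b13 - b03 * b12).
    by rewrite /h /m0 /m1 /n0 /n1; ring.
  rewrite (_ : b02 * b13 - b03 * b12 = 0) ?mulr0 //.
  by rewrite b230 in q22; lra.
Qed.

End SkewSpaces.

Lemma free_nth_neq0 (K : fieldType) (E : vectType K) (X : seq E) i :
  free X -> (i < size X)%N -> X`_i != 0.
Proof.
by move=> fX iX; exact: free_not0 fX (mem_nth 0 iX).
Qed.

Lemma free_nth_nprop (K : fieldType) (E : vectType K) (X : seq E) i j t :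
  free X -> (i < size X)%N -> (j < size X)%N -> i != j -> X`_i != t *: X`_j.
Proof.
move=> fX iX jX ij; apply/eqP => /(congr1 (coord (in_tuple X) (Ordinal iX))).
rewrite linearZ /= (coord_free (Ordinal iX) (Ordinal iX)) //.
rewrite (coord_free (Ordinal jX) (Ordinal iX)) // eqxx.
by rewrite -val_eqE /= eq_sym (negPf ij) mulr0 => /eqP; rewrite oner_eq0.
Qed.

Lemma normalize_sign (R : realType) (e : R) :
  exists s a, [/\ s != 0, a \in signs & s ^+ 2 * e = a%:~R].
Proof.
have [->|e0] := eqVneq e 0; first by exists 1, 0; rewrite oner_neq0 mulr0.
have e_pos : 0 < `|e| by rewrite normr_gt0.
exists (Num.sqrt `|e|)^-1, (if 0 < e then 1 else -1); split.
- by rewrite invr_eq0 gt_eqF // sqrtr_gt0.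
- by case: ifP.
rewrite exprVn sqr_sqrtr 1?ltW //; case: (ltrP 0 e) => [e_gt|e_le].
  by rewrite gtr0_norm // mulVf.
by rewrite ler0_norm // invrN mulNr mulVf.
Qed.

Section SkewSpaceClassification.
Variable R : realType.
Implicit Types (B P : 'M[R]_4) (W : {vspace 'M[R]_4}).

Lemma skewsym_scale k B : skewsym B -> skewsym (k *: B).
Proof. by rewrite /skewsym linearZ /= => ->; rewrite scalerN. Qed.

Lemma pf_scale k l B B' : pf (k *: B) (l *: B') = k * l * pf B B'.
Proof. by rewrite /pf !mxE; ring. Qed.

Lemma pf_scaler k B B' : pf B (k *: B') = k * pf B B'.
Proof. by rewrite -[B]scale1r pf_scale mul1r scale1r. Qed.

Lemma fits_unscale c k P B : k != 0 -> fits c (P *m (k *: B) *m P^T) ->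
  fits c (P *m B *m P^T).
Proof.
move=> k0 /(fits_scale k^-1); rewrite -scalemxAr -scalemxAl scalerA mulVf //.
by rewrite scale1r.
Qed.

(** The last clause says that for \dim W = 2 the model form of e^4 or that of e^6 is zero. This is
    the place for the additional central vector. *)
Lemma skew_space_normal_form W : (forall B, B \in W -> skewsym B) ->
  (\dim W == 2%N) || (\dim W == 3%N) ->
  exists P c, [/\ P \in unitmx, c \in admissible, c`_6 = 0,
    forall B, B \in W -> fits c (P *m B *m P^T)
  & \dim W = 2%N -> (c`_0 == 0) && (c`_1 == 0) || (c`_4 == 0) && (c`_5 == 0)].
Proof.
move=> sW; have [X [bX oX q0]] := orthogonal_basis (@pf_scalar R) (@pfC R) W.
have fX := basis_free bX; rewrite (size_basis (X := in_tuple X) bX) => dW.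
have X1 : (1 < size X)%N by case/orP: dW => /eqP ->.
have X0 : (0 < size X)%N by apply: ltn_trans X1.
have sX i : (i < size X)%N -> skewsym X`_i.
  by move=> iX; apply: sW; rewrite (basis_mem bX) // mem_nth.
have [p0|p0] := eqVneq (pf X`_0 X`_0) 0.
  have pX i j : (i < size X)%N -> (j < size X)%N -> pf X`_i X`_j = 0.
    by move=> iX jX; apply: (q0 p0); rewrite (basis_mem bX) // mem_nth.
  have [P [h [k [uP h0 E1 E2]]]] := null_pair_normal_form (sX _ X0) (sX _ X1)
    (free_nth_neq0 fX X0) (fun t => free_nth_nprop t fX X1 X0 isT)
    (pX _ _ X0 X0) (pX _ _ X0 X1) (pX _ _ X1 X1).
  case/orP: dW => /eqP dX.
    exists P, [:: 0; 0; 1; 0; 1; 0; 0]; split=> //.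
    apply: (fits_basis bX) => -[|[|i]]; rewrite dX // => _.
      by rewrite E1; exists 0, 0, (- h); congr skew4; rewrite /= ?mulr0 ?mulr1 ?oppr0.
    by rewrite E2; exists 0, h, k; congr skew4; rewrite /= ?mulr0 ?mulr1 ?oppr0.
  have X2 : (2 < size X)%N by rewrite dX.
  have := pf_congr P (sX _ X0) (sX _ X2) (pX _ _ X0 X2).
  have := pf_congr P (sX _ X1) (sX _ X2) (pX _ _ X1 X2).
  have := pf_congr P (sX _ X2) (sX _ X2) (pX _ _ X2 X2).
  have := skewE (skew_congr P (sX _ X2)); rewrite E1 E2.
  move: (_ o0 o1) (_ o0 o2) (_ o0 o3) (_ o1 o2) (_ o1 o3) (_ o2 o3).
  move=> b01 b02 b03 b12 b13 b23 E3; rewrite E3 /pf !mxE /= => q33 q23 q13.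
  have b230 : b23 = 0 by apply: (mulfI h0); lra.
  have b130 : b13 = 0 by apply: (mulfI h0); move: q23; rewrite b230; lra.
  have : b03 * b12 = 0 by move: q33; rewrite b230 b130; lra.
  (* The two families of isotropic 3-spaces: for b03 = 0 all 2-forms in e^0, e^1, e^2, and for b12 =
     0 the products e^0 /\ e^i. *)
  move/eqP; rewrite mulf_eq0 => /orP[] /eqP b0.
    exists P, [:: 0; 1; 1; 0; 1; 0; 0]; split=> //; last by rewrite dX.
    apply: (fits_basis bX) => -[|[|[|i]]]; rewrite dX // => _.
    - by rewrite E1; exists 0, 0, (- h); congr skew4; rewrite /= ?mulr0 ?mulr1 ?oppr0.
    - by rewrite E2; exists 0, h, k; congr skew4; rewrite /= ?mulr0 ?mulr1 ?oppr0.
    - rewrite E3 b230 b130 b0; exists b12, b02, b01; congr skew4;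
        by rewrite /= ?mulr0 ?mulr1 ?oppr0.
  exists P, [:: 1; 0; 1; 0; 1; 0; 0]; split=> //; last by rewrite dX.
  apply: (fits_basis bX) => -[|[|[|i]]]; rewrite dX // => _.
  - by rewrite E1; exists 0, 0, (- h); congr skew4; rewrite /= ?mulr0 ?mulr1 ?oppr0.
  - by rewrite E2; exists 0, h, k; congr skew4; rewrite /= ?mulr0 ?mulr1 ?oppr0.
  - by rewrite E3 b230 b130 b0; exists b03, b02, b01; congr skew4; rewrite /= ?mulr0 ?mulr1 ?oppr0.
have [s2 [a2 [s20 a2s E2]]] := normalize_sign (pf X`_1 X`_1 / pf X`_0 X`_0).
pose B2 := s2 *: X`_1.
have sB2 : skewsym B2 by apply/skewsym_scale/sX.
have p12 : pf X`_0 B2 = 0 by rewrite /B2 pf_scaler oX ?mulr0.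
have B20 : B2 != 0 by rewrite scaler_eq0 negb_or s20 (free_nth_neq0 fX X1).
have e2E : pf B2 B2 / pf X`_0 X`_0 = a2%:~R by rewrite pf_scale -expr2 -mulrA.
case/orP: dW => /eqP dX.
  have [x [y [uP F1 F2]]] := pair_normal_form (sX _ X0) p0 sB2 p12 B20.
  rewrite e2E in F2.
  exists (rows4 x (x *m clifford X`_0 B2) y (y *m clifford X`_0 B2)), [:: 1; 1; 1; a2; 0; 0; 0].
  split=> //.
    by move: a2s; rewrite !inE => /or3P[] /eqP ->.
  apply: (fits_basis bX) => -[|[|i]]; rewrite dX // => _.
    by rewrite F1; exists 1, 0, 0; congr skew4; rewrite /= ?mul0r ?mulr0 ?mulr1 ?oppr0.
  apply: (fits_unscale s20); rewrite -/B2 F2.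
  by exists 0, 1, 0; congr skew4; rewrite /= ?mul0r ?mulr0 ?mulr1 ?mul1r ?oppr0.
have X2 : (2 < size X)%N by rewrite dX.
have [s3 [a3 [s30 a3s E3]]] := normalize_sign (pf X`_2 X`_2 / pf X`_0 X`_0).
pose B3 := s3 *: X`_2.
have sB3 : skewsym B3 by apply/skewsym_scale/sX.
have p13 : pf X`_0 B3 = 0 by rewrite /B3 pf_scaler oX ?mulr0.
have p23 : pf B2 B3 = 0 by rewrite pf_scale oX ?mulr0.
have nprop t : B3 != t *: B2.
  have := free_nth_nprop (s3^-1 * t * s2) fX X2 X1 isT; apply: contraNneq => B3E.
  by rewrite -!scalerA -/B2 -B3E scalerA mulVf // scale1r.
have e3E : pf B3 B3 / pf X`_0 X`_0 = a3%:~R by rewrite pf_scale -expr2 -mulrA.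
have [P [h [uP h0 F1 F2 F3]]] := triple_normal_form (sX _ X0) p0 sB2 p12 B20 sB3 p13 p23 nprop.
rewrite e2E in F2; rewrite e3E in F3.
have scale4 k a b c d e f :
    k *: skew4 a b c d e f = skew4 (k * a) (k * b) (k * c) (k * d) (k * e) (k * f) :> 'M[R]_4.
  by apply/matrixP => i j; rewrite !mxE; case: (ord4P i) => ->; case: (ord4P j) => -> /=; ring.
exists P, [:: 1; 1; 1; a2; 1; a3; 0]; split=> //; last by rewrite dX.
  by move: a2s a3s; rewrite !inE => /or3P[] /eqP -> /or3P[] /eqP ->.
apply: (fits_basis bX) => -[|[|[|i]]]; rewrite dX // => _.
- by rewrite F1 scale4; exists h, 0, 0; congr skew4; rewrite /= ?mul0r ?mulr0 ?mulr1 ?oppr0.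
- apply: (fits_unscale s20); rewrite -/B2 F2 scale4.
  by exists 0, h, 0; congr skew4; rewrite /= ?mul0r ?mulr0 ?mulr1 ?mulrN ?oppr0.
apply: (fits_unscale s30); rewrite -/B3 F3 scale4.
by exists 0, 0, (- h); congr skew4; rewrite /= ?mul0r ?mulr0 ?mulr1 ?oppr0.
Qed.

End SkewSpaceClassification.

(** * Reduction to the models *)

Section FrameOfModel.
Variables (R : realType) (V : vectType R) (L : lie_algebra V).

Lemma bracket_skew x y : L x y = - L y x.
Proof.
have := bracket_alternating L (x + y); rewrite linearDl !linearDr !bracket_alternating.
by rewrite add0r addr0 => /eqP; rewrite addr_eq0 => /eqP.
Qed.

Lemma structure_coef_skew c i j k : structure_coef c j i k = - structure_coef c i j k.
Proof.
rewrite /structure_coef; elim: (structure_terms c k) => [|d s IH] /=; first by rewrite oppr0.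
by rewrite IH !opprD opprK [- _ + _]addrC.
Qed.

Lemma structure_coef_lt4 c i j k : (k < 4)%N -> structure_coef c i j k = 0.
Proof. by case: k => [|[|[|[|k]]]]. Qed.

Lemma structure_coef_ge4 c i j k : c`_6 = 0 -> (4 <= j)%N -> structure_coef c i j k = 0.
Proof.
move=> c6 j4; rewrite /structure_coef /structure_terms.
have E m : (m < 4)%N -> (m == j) = false by move=> m4; apply/eqP; lia.
by case: k => [|[|[|[|[|[|[|k]]]]]]] //=;
  rewrite ?c6 ?(E 0%N) ?(E 1%N) ?(E 2%N) ?(E 3%N) //= ?andbF ?if_same !(subr0, addr0).
Qed.

Lemma model_of_frame (f : 7.-tuple V) c : basis_of fullv f -> c \in admissible ->
  (forall i j, (i < j < 7)%N -> L f`_i f`_j =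
     (structure_coef c i j 4)%:~R *: f`_4 + (structure_coef c i j 5)%:~R *: f`_5
     + (structure_coef c i j 6)%:~R *: f`_6) ->
  exists phi : altform V 3,
    [/\ G2_structure phi,
        coclosed L phi
      & exists (g : {dot V for idfun}) (vol : altform V 7),
          G2_induced phi g vol /\ nilsoliton L g].
Proof.
move=> bf cA H; apply: (model_frame bf _ (allP admissible_check c cA)) => i j k.
wlog ij : i j / (i < j)%N => [IH|].
  case: (ltngtP i j) => [ij|ji|/val_inj ->]; first exact: IH.
    by rewrite bracket_skew linearN /= IH // structure_coef_skew mulrNz opprK.
  rewrite bracket_alternating linear0 /=; have := structure_coef_skew c j j k.
  by move=> E; rewrite (_ : structure_coef c j j k = 0) //; lia.
rewrite !(tnth_nth 0) H ?ij ?ltn_ord // !linearD !linearZ /=.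
have fE (m : 'I_7) : dual_form f k f`_m = (k == m)%:R.
  by rewrite -tnth_nth dual_form_frame.
have := (fE (inord 4), fE (inord 5), fE (inord 6)); rewrite -!val_eqE /= !inordK //.
case=> [[-> ->] ->].
have := structure_coef_lt4 c i j (k := k); case: k {fE} => [] [|[|[|[|[|[|[|//]]]]]]] kp /= Z;
  first [by rewrite Z //; ring | ring].
Qed.

End FrameOfModel.

(** * The derived algebra *)

Section TwoStep.
Variables (R : realType) (V : vectType R) (L : lie_algebra V).
Hypotheses (L_two_step : two_step_nilpotent L).

Definition derived_space : {vspace V} :=
  <<[seq L x y | x <- vbasis {:V}, y <- vbasis {:V}]>>%VS.

Lemma bracket_derived x y : L x y \in derived_space.
Proof.
rewrite (coord_vbasis (memvf x)) (coord_vbasis (memvf y)) linear_sumlz.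
apply: memv_suml => i _; rewrite linear_sumr; apply: memv_suml => j _.
rewrite linearZl_LR linearZr_LR /= !memvZ // memv_span //.
by apply/allpairsP; exists ((vbasis {:V})`_i, (vbasis {:V})`_j); rewrite !mem_nth ?size_tuple.
Qed.

Lemma derived_central z x : z \in derived_space -> L z x = 0.
Proof.
rewrite /derived_space -[X in <<X>>%VS]in_tupleE => /coord_span ->.
rewrite linear_sumlz big1 // => i _; rewrite linearZl_LR /=.
have /allpairsP[[u v] /= [_ _ ->]] := mem_nth 0 (ltn_ord i).
have [_ cent] := L_two_step; rewrite (cent (L u v)) ?scaler0 //.
by exists 1%N, (fun=> u), (fun=> v); rewrite big_ord1.
Qed.

(** Brackets depend only on classes modulo the central space Z, so those of vectors spanning V
    modulo Z generate D. This serves both to bound D and to show that given vectors span it. *)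
Lemma derived_subset (e : seq V) (Z K : {vspace V}) :
  (forall z x, z \in Z -> L z x = 0) -> (<<e>> + Z = fullv)%VS ->
  (forall i j, (i < j < size e)%N -> L e`_i e`_j \in K) -> (derived_space <= K)%VS.
Proof.
move=> Zc eZ eK; apply/span_subvP => _ /allpairsP[[x y] /= [_ _ ->]].
have /memv_addP[x1 x1e [x2 x2Z ->]] : x \in (<<e>> + Z)%VS by rewrite eZ memvf.
have /memv_addP[y1 y1e [y2 y2Z ->]] : y \in (<<e>> + Z)%VS by rewrite eZ memvf.
rewrite linearDl (Zc x2) // addr0 linearDr [L x1 y2]bracket_skew (Zc y2) // oppr0 addr0.
move: x1e y1e; rewrite -[e]in_tupleE => /coord_span -> /coord_span ->.
rewrite linear_sumlz; apply: memv_suml => i _; rewrite linear_sumr; apply: memv_suml => j _.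
rewrite linearZl_LR linearZr_LR /= !memvZ //.
case: (ltngtP i j) => [ij|ji|/val_inj ->]; last by rewrite bracket_alternating mem0v.
  by rewrite eK // ij ltn_ord.
by rewrite bracket_skew memvN eK // ji ltn_ord.
Qed.

Lemma derived_neq0 : \dim derived_space != 0%N.
Proof.
rewrite dimv_eq0; apply/negP => /eqP D0; have [nab _] := L_two_step; apply: nab => x y.
by have := bracket_derived x y; rewrite D0 memv0 => /eqP.
Qed.

Lemma complement_basis (Z : {vspace V}) n : \dim {:V} = n -> exists e : seq V,
  [/\ size e = (n - \dim Z)%N, free e & (<<e>> + Z = fullv)%VS].
Proof.
move=> dV; exists (vbasis Z^C); split.
- by rewrite size_tuple dimv_compl dV.
- exact: basis_free (vbasisP _).
- by rewrite (span_basis (vbasisP _)) addvC addv_complf.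
Qed.

Lemma dim_derived : \dim {:V} = 7%N -> (\dim derived_space <= 3)%N.
Proof.
move=> dV; have [e [se _ eV]] := complement_basis derived_space dV.
have dim_le (s : seq V) : (\dim <<s>> <= size s)%N by apply: dim_span.
rewrite leqNgt; apply/negP => d4.
have se3 : (size e <= 3)%N by rewrite se; lia.
(* If e has fewer than three vectors, the default entries 0 only add zero brackets. *)
have sub : (derived_space <= <<[:: L e`_0 e`_1; L e`_0 e`_2; L e`_1 e`_2]>>)%VS.
  apply: (derived_subset derived_central eV) => i j /andP[ij je].
  have j3 : (j < 3)%N by apply: leq_trans je se3.
  by case: j ij j3 {je} => [|[|[|//]]]; case: i => [|[|[|//]]] // _ _;
    rewrite memv_span // !inE eqxx ?orbT.
have := leq_trans (dimvS sub) (dim_le _); rewrite leqNgt => /negP[] //.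
Qed.

End TwoStep.

(** * Model frames according to the dimension of the derived algebra *)

Section Assembly.
Variables (R : realType) (V : vectType R) (L : lie_algebra V).
Hypotheses (dV : \dim {:V} = 7%N) (L_two_step : two_step_nilpotent L).
Notation D := (derived_space L).
Notation conclusion := (exists phi : altform V 3,
    [/\ G2_structure phi,
        coclosed L phi
      & exists (g : {dot V for idfun}) (vol : altform V 7),
          G2_induced phi g vol /\ nilsoliton L g]).

Lemma bracket_centralr x z : z \in D -> L x z = 0.
Proof. by move=> zD; rewrite bracket_skew derived_central // oppr0. Qed.

Lemma spanning_basis (f : 7.-tuple V) : (fullv <= <<f>>)%VS -> basis_of fullv f.
Proof. by move=> sf; rewrite basisEdim sf size_tuple dV. Qed.

Lemma model_dim_derived1 : \dim D = 1%N -> conclusion.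
Proof.
move=> dD; have := vbasisP D; move: (vbasis D); rewrite dD => zz0.
case/tupleP: zz0 => z X0; rewrite (tuple0 X0) => bD {X0}.
pose zz : 1.-tuple V := [tuple of z :: [tuple]].
pose B x y := coord zz ord0 (L x y).
have LB x y : L x y = B x y *: z.
  by rewrite (coord_basis bD (bracket_derived L x y)) big_ord1.
have zD : z \in D by rewrite (basis_mem bD) // mem_head.
have [r [X [rX bX BX]]] := symplectic_basis (B := B)
  (fun x c u v => ltac:(by rewrite /B linearPr linearP))
  (fun y c u v => ltac:(by rewrite /B linearPl linearP))
  (fun x => ltac:(by rewrite /B bracket_alternating linear0)) (D^C)%VS.
have sX : size X = 6%N by rewrite -(size_basis (X := in_tuple X) bX) dimv_compl dV dD.
have XD : (<<X>> + D = fullv)%VS by rewrite (span_basis bX) addvC addv_complf.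
have fP : size (X ++ [:: z]) == 7%N by rewrite size_cat sX.
pose f := Tuple fP; have bf : basis_of fullv f.
  by apply: spanning_basis; rewrite span_cat (_ : <<[:: z]>>%VS = D) ?XD // -(span_basis bD).
have r_gt0 : (0 < r)%N.
  rewrite lt0n; apply/negP => /eqP r0; have /negP := derived_neq0 L_two_step; apply.
  rewrite dimv_eq0 -subv0; apply: (derived_subset (derived_central L_two_step) XD).
  by move=> i j ij; rewrite LB BX // r0 ltn0 !andbF scale0r mem0v.
have f6 : f`_6 = z by rewrite nth_cat sX.
(* The entries 4, 5, 6 are the coefficients of e^01, e^23, e^45 in the bracket, one for each
   possible pair of the symplectic basis. *)
pose c : seq int := [:: 0; 0; 0; 0; 1; (1 < r)%N%:Z; (2 < r)%N%:Z].
have cA : c \in admissible.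
  have : (r <= 3)%N by rewrite sX in rX; lia.
  by rewrite /c; case: r r_gt0 {rX BX c} => [|[|[|[|r]]]].
apply: (model_of_frame bf cA) => i j /andP[ij j7].
have [j6|j6] := ltnP j 6; last first.
  have -> : j = 6%N by lia.
  rewrite f6 bracket_centralr //; have i6 : (i < 6)%N by lia.
  by case: i i6 {ij} => [|[|[|[|[|[|//]]]]]] _; rewrite !scale0r !addr0.
have i6 : (i < 6)%N by apply: ltn_trans j6.
rewrite !nth_cat sX j6 i6 LB BX ?sX ?ij //= {f6 bf f fP cA}.
rewrite (_ : structure_coef c i j 4 = 0); last by rewrite /structure_coef /= !if_same.
rewrite (_ : structure_coef c i j 5 = 0); last by rewrite /structure_coef /= oppr0 !if_same.
rewrite !scale0r !add0r; congr (_ *: _).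
case: r r_gt0 rX {BX} @c => [//|r] _ rX c; rewrite doubleS.
by move: i j ij i6 j6 {j7} => [|[|[|[|[|[|//]]]]]] [|[|[|[|[|[|//]]]]]] //= _ _ _;
  rewrite ?ltnS ?addr0 ?subr0; case: r rX @c => [|[|r]].
Qed.

(** In both cases S is a central 3-space containing D, so the bracket is given by [\dim D]
    independent skew forms on a 4-dimensional complement. *)
Lemma model_dim_derived23 (u : V) :
  \dim D = 3%N \/ [/\ \dim D = 2%N, u \notin D & forall x, L u x = 0] -> conclusion.
Proof.
move=> dD; pose S := if \dim D == 3%N then D else (D + <[u]>)%VS.
have S_central z x : z \in S -> L z x = 0.
  rewrite /S; case: dD => [->|[-> _ uc]] /=; first exact: derived_central.
  case/memv_addP => z1 z1D [_ /vlineP[k ->] ->].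
  by rewrite linearDl linearZl_LR /= uc scaler0 addr0 derived_central.
have dS : \dim S = 3%N.
  rewrite /S; case: dD => [d3|[d2 uD _]]; first by rewrite d3.
  rewrite d2 dimv_disjoint_sum ?d2 /=.
    by rewrite dim_vline (_ : u != 0) //; apply: contraNneq uD => ->; rewrite mem0v.
  apply/eqP; rewrite -subv0; apply/subvP => x; rewrite memv_cap memv0 => /andP[xD].
  case/vlineP => k xE; rewrite xE scaler_eq0; apply/orP; left.
  apply: contraNT uD => k0; rewrite -[u](scalerK k0) -xE memvZ //.
have DS : (D <= S)%VS by rewrite /S; case: ifP => // _; apply: addvSl.
have [e [se _ eS]] := complement_basis S dV; rewrite dS /= in se.
pose d := \dim D; pose z := vbasis D; have bz : basis_of D z := vbasisP D.
pose B (l : 'I_d) : 'M[R]_4 := \matrix_(i, j) coord z l (L e`_i e`_j).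
have sB l : skewsym (B l).
  by apply/matrixP => i j; rewrite !mxE bracket_skew linearN.
pose X := [tuple B l | l < d]; pose W := <<X>>%VS.
have XE (l : 'I_d) : X`_l = B l by rewrite -tnth_nth tnth_mktuple.
(* A relation between the B_l is a linear functional on D that vanishes on the brackets of the e_i,
   hence on D. *)
have fX : free X.
  apply/freeP => k kX l.
  have hs : scalar (fun v => \sum_(m < d) k m * coord z m v).
    move=> a x y; rewrite mulr_sumr -big_split; apply: eq_bigr => m _ /=.
    by rewrite linearP /=; ring.
  have [K KE] := kernel_space hs.
  have DK : (D <= K)%VS.
    apply: (derived_subset S_central eS) => i j; rewrite se => /andP[ij j4].
    have i4 : (i < 4)%N by apply: ltn_trans j4.
    rewrite KE; move/matrixP/(_ (Ordinal i4) (Ordinal j4)): kX.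
    rewrite summxE mxE => kX; rewrite -[X in _ == X]kX; apply/eqP.
    by apply: eq_bigr => m _; rewrite XE !mxE.
  have /(subvP DK) : z`_l \in D by rewrite (basis_mem bz) // mem_nth // size_tuple.
  rewrite KE (bigD1 l) //= big1 => [|m ml].
    by rewrite coord_free ?(basis_free bz) // eqxx mulr1 addr0 => /eqP.
  by rewrite coord_free ?(basis_free bz) // eq_sym (negPf ml) mulr0.
have dW : \dim W = d by rewrite -(size_tuple X); apply/eqP.
have sW M : M \in W -> skewsym M.
  move/coord_span ->; apply: big_rec => [|l M' _ sM'].
    by rewrite /skewsym linear0 oppr0.
  by rewrite /skewsym linearD linearZ /= sM' XE sB scalerN opprD.
have [|P [c [uP cA c6 fitsP c2]]] := skew_space_normal_form sW.
  by rewrite dW /d; case: dD => [->|[-> _ _]].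
have /fin_all_exists[t0 /fin_all_exists[t1 /fin_all_exists[t2 tE]]] (l : 'I_d) :
  exists t0 t1 t2, P *m B l *m P^T =
    skew4 (t2 * (c`_4)%:~R) (t1 * (c`_2)%:~R) (t0 * (c`_0)%:~R)
          (t0 * (c`_1)%:~R) (- (t1 * (c`_3)%:~R)) (t2 * (c`_5)%:~R).
  by apply: fitsP; rewrite -XE memv_span // mem_nth // size_tuple.
pose r (i : 'I_4) := \sum_(a < 4) P i a *: e`_a.
(* [w t0], [w t1], [w t2] collect the coefficients of the three model forms in the bracket and are
   the candidates for e4, e5, e6. *)
pose w (t : 'I_d -> R) := \sum_(l < d) t l *: z`_l.
have rr i j : L (r i) (r j) = \sum_(l < d) (P *m B l *m P^T) i j *: z`_l.
  have LE x y : L x y = \sum_(l < d) coord z l (L x y) *: z`_l.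
    exact: (coord_basis bz (bracket_derived L x y)).
  rewrite LE; apply: eq_bigr => l _; congr (_ *: _).
  rewrite mxE; under [RHS]eq_bigr do rewrite mxE mulr_suml.
  rewrite exchange_big {1}/r linear_sumlz linear_sum; apply: eq_bigr => a _.
  rewrite /r linear_sumr linear_sum; apply: eq_bigr => b _.
  by rewrite linearZl_LR linearZr_LR !linearZ /= !mxE; ring.
pose s (i j : 'I_4) k : R := (structure_coef c i j k)%:~R.
have rrE (i j : 'I_4) : (i < j)%N ->
    L (r i) (r j) = s i j 4 *: w t0 + s i j 5 *: w t1 + s i j 6 *: w t2.
  move=> ij; rewrite rr /w !scaler_sumr -!big_split; apply: eq_bigr => l _ /=.
  rewrite !scalerA -!scalerDl tE mxE; congr (_ *: _); rewrite /s /structure_coef.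
  by move: ij; case: (ord4P i) => ->; case: (ord4P j) => -> //= _;
    rewrite !(subr0, sub0r, addr0, add0r, oppr0) ?rmorphN ?mulr0z /=; ring.
pose rs := [tuple r i | i < 4].
have e_span : (<<e>> <= <<rs>>)%VS.
  apply/span_subvP => x /(nthP 0)[a]; rewrite se => a4 <-.
  have -> : e`_a = \sum_(i < 4) invmx P (Ordinal a4) i *: r i.
    under eq_bigr do rewrite scaler_sumr.
    rewrite exchange_big /= (bigD1 (Ordinal a4)) //= [X in _ + X]big1 => [|b ba].
      under eq_bigr do rewrite scalerA.
      rewrite -scaler_suml (_ : \sum_i _ = (invmx P *m P) (Ordinal a4) (Ordinal a4)).
        by rewrite mulVmx // mxE eqxx scale1r addr0.
      by rewrite mxE.
    under eq_bigr do rewrite scalerA.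
    rewrite -scaler_suml (_ : \sum_i _ = (invmx P *m P) (Ordinal a4) b); last by rewrite mxE.
    by rewrite mulVmx // mxE eq_sym (negPf ba) scale0r.
  apply: memv_suml => i _; rewrite memvZ // memv_span //.
  by apply/tnthP; exists i; rewrite tnth_mktuple.
have rsS : (<<rs>> + S = fullv)%VS.
  apply/eqP; rewrite eqEsubv subvf /= -eS; exact: addvS.
have rs_nth (i : 'I_4) : rs`_i = r i by rewrite -tnth_nth tnth_mktuple.
(* Independence is obtained by counting: once w4, w5, w6 span S, they and the four r_i are seven
   vectors spanning V. *)
have finish w4 w5 w6 :
    (forall i j : 'I_4, (i < j)%N ->
       L (r i) (r j) = s i j 4 *: w4 + s i j 5 *: w5 + s i j 6 *: w6) ->
    (forall x, x \in [:: w4; w5; w6] -> x \in S) -> (S <= <<[:: w4; w5; w6]>>)%VS -> conclusion.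
  move=> LE wS Sw.
  have fP : size (rs ++ [:: w4; w5; w6]) == 7%N by rewrite size_cat size_tuple.
  pose f := Tuple fP; have bf : basis_of fullv f.
    by apply: spanning_basis; rewrite span_cat -rsS addvS.
  apply: (model_of_frame bf cA) => i j /andP[ij j7].
  have [j4|j4] := ltnP j 4.
    have i4 : (i < 4)%N by apply: ltn_trans j4.
    have fE (k : 'I_4) : f`_k = r k by rewrite nth_cat size_tuple ltn_ord rs_nth.
    rewrite -[i]/(val (Ordinal i4)) -[j]/(val (Ordinal j4)) (fE (Ordinal i4)) (fE (Ordinal j4)).
    by rewrite LE // /s !nth_cat size_tuple.
  have jw : f`_j \in [:: w4; w5; w6].
    by rewrite nth_cat size_tuple ltnNge j4 mem_nth //= ltn_subLR.
  rewrite bracket_skew S_central ?oppr0; last exact: wS.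
  by rewrite !structure_coef_ge4 // !scale0r !addr0.
have memw (t : 'I_d -> R) : w t \in D.
  by apply: memv_suml => l _; rewrite memvZ // (basis_mem bz) // mem_nth // size_tuple.
have finish_span w4 w5 w6 :
    (forall i j : 'I_4, (i < j)%N -> L (r i) (r j) \in <<[:: w4; w5; w6]>>%VS) ->
    (D <= <<[:: w4; w5; w6]>>)%VS.
  move=> LE; apply: (derived_subset S_central rsS) => i j; rewrite size_tuple => /andP[ij j4].
  have i4 : (i < 4)%N by apply: ltn_trans j4.
  by have := LE (Ordinal i4) (Ordinal j4) ij; rewrite -!rs_nth.
have mem3 (w4 w5 w6 : V) (a b k : R) :
    a *: w4 + b *: w5 + k *: w6 \in <<[:: w4; w5; w6]>>%VS.
  by rewrite !memvD // memvZ // memv_span // !inE eqxx ?orbT.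
case: dD => [d3|[d2 uD uc]].
  have SD : S = D by rewrite /S d3.
  apply: (finish (w t0) (w t1) (w t2)) => //.
    by move=> x; rewrite SD !inE => /or3P[] /eqP ->; apply: memw.
  by rewrite SD; apply: finish_span => i j /rrE ->; apply: mem3.
have SE : S = (D + <[u]>)%VS by rewrite /S d2.
have uS : u \in S by rewrite SE memvE addvSr.
have wS t : w t \in S by apply: (subvP DS).
(* The candidate whose model form is zero, at e4 or at e6, is replaced by u. The brackets do not see
   the change, and the other two candidates must then span D. *)
have := c2; rewrite dW => /(_ d2) /orP[] /andP[/eqP ca /eqP cb].
  have LE (i j : 'I_4) : (i < j)%N ->
      L (r i) (r j) = s i j 4 *: u + s i j 5 *: w t1 + s i j 6 *: w t2.
    move/rrE ->; rewrite (_ : s i j 4 = 0) ?scale0r // /s /structure_coef /= ca cb.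
    by rewrite !if_same.
  apply: (finish _ _ _ LE).
    by move=> x; rewrite !inE => /or3P[] /eqP ->.
  rewrite SE subv_add -memvE memv_span ?mem_head // andbT.
  by apply: finish_span => i j /LE ->; apply: mem3.
have LE (i j : 'I_4) : (i < j)%N ->
    L (r i) (r j) = s i j 4 *: w t0 + s i j 5 *: w t1 + s i j 6 *: u.
  move/rrE ->; rewrite (_ : s i j 6 = 0) ?scale0r // /s /structure_coef /= ca cb c6.
  by rewrite !if_same.
apply: (finish _ _ _ LE).
  by move=> x; rewrite !inE => /or3P[] /eqP ->.
rewrite SE subv_add -memvE memv_span ?inE ?eqxx ?orbT // andbT.
by apply: finish_span => i j /LE ->; apply: mem3.
Qed.

End Assembly.

(** * Central vectors from coclosedness *)

Section Obstruction.
Variables (R : realType) (V : vectType R).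

(** Both sides are the same average over I, since e^J at e_I and e^I at e_J are determinants of
    transposed matrices. *)
Lemma form_dot_monomial p n (e : n.-tuple V) (b : altform V p) (J : p.-tuple 'I_n) :
  basis_of fullv e ->
  form_dot e (monomial_form (dual_forms e) p [seq val j | j <- J]) b =
  b [tuple of map (tnth e) J].
Proof.
move=> be; rewrite form_dot_full (form_expand be b); congr (_ * _).
apply: eq_bigr => I _; rewrite mulrC; congr (_ * _).
rewrite /= /monomial -det_tr; congr (\det _); apply/matrixP => a c; rewrite !mxE.
rewrite !tnth_map /dual_forms /= !(nth_map (tnth I c)) ?size_tuple //.
rewrite -!tnth_nth (dual_form_frame be) (dual_form_frame be).
by rewrite eq_sym.
Qed.

Lemma monomial_frame0 p n (e : n.-tuple V) (J : seq nat) (I : p.-tuple 'I_n) k :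
  basis_of fullv e -> size J = p -> k \in J -> k \notin [seq val i | i <- I] ->
  monomial (dual_forms e) J [tuple of map (tnth e) I] = 0.
Proof.
move=> be sJ /(nthP 0%N)[b bJ bk] kI; rewrite sJ in bJ.
rewrite /monomial (expand_det_col _ (Ordinal bJ)) big1 // => a _.
rewrite mxE tnth_map /dual_forms /= dual_form_frame // bk.
case: eqP => [kE|_]; last by rewrite mul0r.
by case/negP: kI; rewrite kE map_f // mem_tnth.
Qed.

Lemma two_point_perm k (m m' : 'I_k.+2) : m != m' ->
  exists s : 'S_k.+2, s ord0 = m /\ s (lift ord0 ord0) = m'.
Proof.
move=> mm'; pose t := tperm ord0 m.
exists (tperm (lift ord0 ord0) (t m') * t)%g; rewrite !permM tpermL; split.
  rewrite (@tpermD _ (lift ord0 ord0) (t m') ord0);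
    [by rewrite /t tpermL|by []|apply: contra mm' => /eqP E; apply/eqP].
  by apply: (@perm_inj _ t); rewrite E /t tpermR.
by rewrite /t -permM tperm2 perm1.
Qed.

Lemma mktuple2 (T : Type) (F : 'I_2 -> T) : mktuple F = [tuple F (inord 0); F (inord 1)].
Proof.
by apply: eq_from_tnth => -[[|[|//]] mp]; rewrite tnth_mktuple; congr F;
  apply: val_inj; rewrite /= inordK.
Qed.

Lemma mktuple3 (T : Type) (F : 'I_3 -> T) :
  mktuple F = [tuple F (inord 0); F (inord 1); F (inord 2)].
Proof.
by apply: eq_from_tnth => -[[|[|[|//]]] mp]; rewrite tnth_mktuple; congr F;
  apply: val_inj; rewrite /= inordK.
Qed.

Lemma tuple_tperm3 (phi : altform V 3) x y z :
  phi [tuple x; y; z] = - phi [tuple y; x; z] /\ phi [tuple x; y; z] = - phi [tuple z; y; x].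
Proof.
have H (i j : 'I_3) t : i != j -> phi [tuple tnth t (tperm i j m) | m < 3] = - phi t.
  exact: alternating_tperm.
pose o j := Ordinal (ltn_pmod j (isT : 0 < 3)%N).
split; [rewrite -(H (o 0%N) (o 1%N)) //|rewrite -(H (o 0%N) (o 2%N)) //];
  by congr (altform_fun phi _); apply: eq_from_tnth => -[[|[|[|//]]] mp];
  rewrite tnth_mktuple permE.
Qed.

Lemma pigeonhole2 n (a b c : 'I_n) : a != b -> a != c -> b != c ->
  (a <= 1)%N -> (b <= 1)%N -> (c <= 1)%N -> False.
Proof.
rewrite -!val_eqE /=; move: (val a) (val b) (val c).
by move=> [|[|a']] [|[|b']] [|[|c']].
Qed.

(** Every term of the density is a product of three values of phi at seven distinct frame vectors,
    e_o replacing nothing but leading the first two factors. A nonzero value involving e_o needs an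
    index 0 or 1. All three factors involve e_o, and three distinct indices cannot fit into {0,
    1}. *)
Lemma G2_degenerate_density (phi : altform V 3) (e : 7.-tuple V) (o : 'I_7) : (1 < o)%N ->
  (forall a b : 'I_7, (1 < a)%N -> (1 < b)%N -> phi [tuple tnth e o; tnth e a; tnth e b] = 0) ->
  G2_density phi (tnth e o) (tnth e o) e = 0.
Proof.
move=> o1 phi0.
have phi00 x z : phi [tuple x; x; z] = 0.
  by have [] := tuple_tperm3 phi x x z; lra.
have phi01 x y : phi [tuple x; y; x] = 0.
  by have [_] := tuple_tperm3 phi x y x; lra.
have f_nz (a b : 'I_7) : phi [tuple tnth e o; tnth e a; tnth e b] != 0 ->
    [/\ a != o, b != o & (a <= 1)%N || (b <= 1)%N].
  move=> nz; split; try by apply: contraNneq nz => ->; rewrite ?phi00 ?phi01.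
  by apply: contraNT nz; rewrite negb_or -!ltnNge => /andP[a1 b1]; rewrite phi0.
have h_nz (a b k : 'I_7) : phi [tuple tnth e a; tnth e b; tnth e k] != 0 ->
    [|| a == o, b == o | k == o] -> [|| (a <= 1)%N, (b <= 1)%N | (k <= 1)%N].
  have [E1 E2] := tuple_tperm3 phi (tnth e a) (tnth e b) (tnth e k).
  move=> nz /or3P[] /eqP E; move: nz E1 E2; rewrite E => nz E1 E2.
  - by have [_ _ /orP[] ->] := f_nz _ _ nz; rewrite ?orbT.
  - by rewrite E1 oppr_eq0 in nz; have [_ _ /orP[] ->] := f_nz _ _ nz; rewrite ?orbT.
  - by rewrite E2 oppr_eq0 in nz; have [_ _ /orP[] ->] := f_nz _ _ nz; rewrite ?orbT.
rewrite /G2_density {1}/wedge_product big1 ?mulr0 // => s _.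
pose h k := s (rshift 4 (inord k : 'I_3)).
rewrite mktuple3 -/(h 0%N) -/(h 1%N) -/(h 2%N).
set ph := altform_fun phi _; have [->|nzh] := eqVneq ph 0; first by rewrite mulr0.
rewrite {1}/wedge_product big1 ?mulr0 ?mul0r // => t _.
pose al k := s (lshift 3 (t (lshift 2 (inord k : 'I_2)))).
pose ar k := s (lshift 3 (t (rshift 2 (inord k : 'I_2)))).
have fE x y : interior_product (tnth e o) phi [tuple x; y] = phi [tuple tnth e o; x; y].
  by congr (altform_fun phi _); apply: val_inj.
rewrite !mktuple2 !fE !tnth_mktuple -/(al 0%N) -/(al 1%N) -/(ar 0%N) -/(ar 1%N).
set fl := (X in _ * X * _); set fr := (X in _ * X).
have [->|nzl] := eqVneq fl 0; first by rewrite mulr0 mul0r.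
have [->|nzr] := eqVneq fr 0; first by rewrite mulr0.
have [al0 al1 al01] := f_nz _ _ nzl; have [ar0 ar1 ar01] := f_nz _ _ nzr.
exfalso.
have hl k l : h k != al l by rewrite (inj_eq perm_inj) eq_rlshift.
have hr k l : h k != ar l by rewrite (inj_eq perm_inj) eq_rlshift.
have lr k l : al k != ar l.
  by rewrite !(inj_eq perm_inj) (inj_eq (@lshift_inj _ _)) (inj_eq perm_inj) eq_lrshift.
(* The indices of the first two factors differ from o, so o, being hit by the permutation, occurs in
   the third. *)
have ho : [|| h 0%N == o, h 1%N == o | h 2%N == o].
  have := permKV s o; case: (split_ordP (s^-1%g o)) => [m|m] -> so; last first.
    have E : h m = o by rewrite /h inord_val.
    by case: m {so} E => [[|[|[|//]]] mp] /= ->; rewrite eqxx ?orbT.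
  have := permKV t m; case: (split_ordP (t^-1%g m)) => [m'|m'] -> tm.
    have : al m' = o by rewrite /al inord_val tm.
    by case: m' {tm} => [[|[|//]] mp] /= /eqP; rewrite ?(negPf al0) ?(negPf al1).
  have : ar m' = o by rewrite /ar inord_val tm.
  by case: m' {tm} => [[|[|//]] mp] /= /eqP; rewrite ?(negPf ar0) ?(negPf ar1).
case/or3P: (h_nz _ _ _ nzh ho) => hk; case/orP: al01 => ak; case/orP: ar01 => rk;
  by apply: pigeonhole2 hk ak rk; rewrite ?hl ?hr ?lr.
Qed.

Lemma mktuple4 (T : Type) (F : 'I_4 -> T) :
  mktuple F = [tuple F ord0; F (lift ord0 ord0); F (inord 2); F (inord 3)].
Proof.
by apply: eq_from_tnth => -[[|[|[|[|//]]]] mp]; rewrite tnth_mktuple; congr F;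
  apply: val_inj; rewrite /= ?inordK.
Qed.

Lemma alternating4_eq0 (psi : altform V 4) (x : 4.-tuple V) (m m' : 'I_4) : m != m' ->
  (forall k l, psi [tuple tnth x m; tnth x m'; tnth x k; tnth x l] = 0) -> psi x = 0.
Proof.
move=> mm' H; have [s [s0 s1]] := two_point_perm mm'.
have := alternating_perm psi x s; rewrite mktuple4 s0 s1 H => /esym/eqP.
by rewrite mulf_eq0 signr_eq0 => /eqP.
Qed.

(** Pairing with the monomial e^oij shows that phi at e_o, e_i, e_j is, up to sign and volume, psi
    at the four complementary vectors, among them e_p and e_q but not e_o. *)
Lemma hodge_dual_eq0 (g : {dot V for idfun}) (vol : altform V 7) (phi : altform V 3)
    (psi : altform V 4) (e : 7.-tuple V) (p q o i j : 'I_7) :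
  hodge_dual (p := 3) (q := 4) g vol phi psi -> orthonormal g e -> basis_of fullv e ->
  vol e != 0 -> uniq [:: p; q; o; i; j] ->
  (forall k l, k != o -> l != o -> psi [tuple tnth e p; tnth e q; tnth e k; tnth e l] = 0) ->
  phi [tuple tnth e o; tnth e i; tnth e j] = 0.
Proof.
move=> hd oe be vol0 u5 psi0; pose J := [tuple o; i; j].
have := hd e oe (monomial_form (dual_forms e) 3 [seq val k | k <- J]) e.
rewrite form_dot_monomial //; set W := wedge_product _ _ _.
suff -> : W = 0.
  move/esym/eqP; rewrite mulf_eq0 (negPf vol0) orbF => /eqP <-.
  by congr (altform_fun phi _); apply: val_inj.
rewrite /W /wedge_product big1 ?mulr0 // => s _.
pose I := [tuple s (lshift 4 k) | k < 3].
have -> : [tuple tnth e (s (lshift 4 k)) | k < 3] = [tuple of map (tnth e) I].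
  by apply: eq_from_tnth => k; rewrite tnth_mktuple tnth_map tnth_mktuple.
have [JI|/allPn[k kJ kI]] := boolP (all (mem I) J); last first.
  have M0 : monomial (dual_forms e) [seq val k | k <- J] [tuple of map (tnth e) I] = 0.
    apply: (@monomial_frame0 _ _ _ _ _ (val k)) => //.
    by rewrite (mem_map val_inj).
  by rewrite -[altform_fun (monomial_form _ _ _) _]/(monomial _ _ _) M0 mulr0 mul0r.
(* The three distinct entries of J already exhaust I. *)
have notI k : k \notin J -> k \notin I.
  move=> kJ; apply/negP => kI; have : (size (k :: J) <= size I)%N.
    apply: uniq_leq_size; first by move: u5; rewrite /= kJ => /and3P[_ _ ->].
    by move=> l; rewrite inE => /predU1P[->//|/(allP JI)].
  by rewrite size_tuple.
have in_right k : k \notin J -> exists m, k = s (rshift 3 m).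
  move/notI => kI; have := permKV s k; case: (split_ordP (s^-1%g k)) => m -> sm; last by exists m.
  by case/negP: kI; rewrite -sm; apply/tnthP; exists m; rewrite tnth_mktuple.
have [m pE] : exists m, p = s (rshift 3 m).
  by apply: in_right; move: u5; rewrite /= !inE !negb_or -!andbA => /and5P[_ -> -> -> _].
have [m' qE] : exists m, q = s (rshift 3 m).
  apply: in_right; move: u5; rewrite /= !inE !negb_or -!andbA.
  by move=> /and5P[_ _ _ _ /and3P[-> -> /andP[-> _]]].
have mm' : m != m'.
  by apply: contraTneq u5 => E; rewrite pE qE E /= !inE eqxx.
rewrite (@alternating4_eq0 psi _ m m') ?mulr0 // => k l; rewrite !tnth_mktuple -pE -qE.
have no r : s (rshift 3 r) != o.
  have /tnthP[a ->] : o \in I by apply: (allP JI); rewrite mem_head.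
  by rewrite tnth_mktuple (inj_eq perm_inj) eq_rlshift.
exact: psi0.
Qed.

End Obstruction.

Lemma ce_diff4 (R : realType) (V : vectType R) (L : lie_algebra V) (a : 4.-tuple V -> R) x y z w t :
  ce_diff L a [tuple x; y; z; w; t] =
  - a [tuple L x y; z; w; t] + a [tuple L x z; y; w; t] - a [tuple L x w; y; z; t]
  + a [tuple L x t; y; z; w] - a [tuple L y z; x; w; t] + a [tuple L y w; x; z; t]
  - a [tuple L y t; x; z; w] - a [tuple L z w; x; y; t] + a [tuple L z t; x; y; w]
  - a [tuple L w t; x; y; z].
Proof.
have sum4' (F : 'I_4 -> R) : \sum_i F i =
    F (@Ordinal 4 0 isT) + F (@Ordinal 4 1 isT) + F (@Ordinal 4 2 isT) + F (@Ordinal 4 3 isT).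
  by rewrite sum4; congr (_ + _ + _ + _); congr F; apply: val_inj.
have sum5 (F : 'I_5 -> R) : \sum_i F i = F (@Ordinal 5 0 isT) + F (@Ordinal 5 1 isT)
    + F (@Ordinal 5 2 isT) + F (@Ordinal 5 3 isT) + F (@Ordinal 5 4 isT).
  rewrite !big_ord_recr big_ord0 /= add0r.
  by congr (_ + _ + _ + _ + _); congr F; apply: val_inj.
have E b (F : 'I_3 -> V) : a [tuple of b :: mktuple F] =
    a [tuple b; F (@Ordinal 3 0 isT); F (@Ordinal 3 1 isT); F (@Ordinal 3 2 isT)].
  congr a; apply: eq_from_tnth => -[[|[|[|[|//]]]] mp]; rewrite ?tnth0 //.
  - rewrite (_ : Ordinal mp = lift ord0 (@Ordinal 3 0 isT)) ?tnthS ?tnth_mktuple //.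
    exact: val_inj.
  - rewrite (_ : Ordinal mp = lift ord0 (@Ordinal 3 1 isT)) ?tnthS ?tnth_mktuple //.
    exact: val_inj.
  - rewrite (_ : Ordinal mp = lift ord0 (@Ordinal 3 2 isT)) ?tnthS ?tnth_mktuple //.
    exact: val_inj.
rewrite /ce_diff sum5; do 5 rewrite big_mkcond sum4'.
rewrite !E.
(* Grouped by i; the zeros stand for the pairs excluded by the condition i <= j. *)
transitivity (((-1) ^+ 1 * a [tuple L x y; z; w; t] + (-1) ^+ 2 * a [tuple L x z; y; w; t]
     + (-1) ^+ 3 * a [tuple L x w; y; z; t] + (-1) ^+ 4 * a [tuple L x t; y; z; w])
  + (0 + (-1) ^+ 3 * a [tuple L y z; x; w; t] + (-1) ^+ 4 * a [tuple L y w; x; z; t]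
     + (-1) ^+ 5 * a [tuple L y t; x; z; w])
  + (0 + 0 + (-1) ^+ 5 * a [tuple L z w; x; y; t] + (-1) ^+ 6 * a [tuple L z t; x; y; w])
  + (0 + 0 + 0 + (-1) ^+ 7 * a [tuple L w t; x; y; z])
  + (0 + 0 + 0 + 0)).
  by [].
ring.
Qed.

Section CentralVector.
Variables (R : realType) (V : vectType R) (L : lie_algebra V).
Hypotheses (dV : \dim {:V} = 7%N) (L_two_step : two_step_nilpotent L).
Notation D := (derived_space L).
Variables (phi : altform V 3) (g : {dot V for idfun}) (vol : altform V 7) (psi : altform V 4).
Hypotheses (phi_induced : G2_induced phi g vol)
  (psi_dual : hodge_dual (p := 3) (q := 4) g vol phi psi)
  (psi_closed : ce_diff L psi =1 (fun=> 0)).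

Definition sigma p q y w := psi [tuple p; q; y; w].

Lemma sigma_scalar_l p q w : scalar (fun y => sigma p q y w).
Proof.
have m2 := interior_multilinear q (interior_multilinear p (altform_multilinear psi)).
move=> c u v; have := multilinear_head [tuple w] m2 c u v; rewrite /interior_product.
have E y : psi [tuple of p :: [tuple of q :: [tuple of y :: [tuple w]]]] = sigma p q y w.
  by congr (altform_fun psi _); apply: val_inj.
by rewrite !E.
Qed.

Lemma sigma_scalar_r p q y : scalar (sigma p q y).
Proof.
have m2 := interior_multilinear q (interior_multilinear p (altform_multilinear psi)).
move=> c u v; have := multilinear_head [tuple] (interior_multilinear y m2) c u v.
rewrite /interior_product.
have E w : psi [tuple of p :: [tuple of q :: [tuple of y :: [tuple of w :: [tuple]]]]]
    = sigma p q y w.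
  by congr (altform_fun psi _); apply: val_inj.
by rewrite !E.
Qed.

Lemma sigma_alt p q y : sigma p q y y = 0.
Proof.
exact: (altform_alternating psi (x := [tuple p; q; y; y])
  (i := Ordinal (isT : 2 < 4)%N) (j := Ordinal (isT : 3 < 4)%N)).
Qed.

Lemma sigma_skew p q y w : sigma p q y w = - sigma p q w y.
Proof.
exact: (alternating_skew (sigma_scalar_r p q) (sigma_scalar_l p q) (sigma_alt p q)).
Qed.

Section Pair.
Variables (p q u : V).
Hypotheses (pq : orthonormal g [:: p; q]) (D_pq : basis_of D [:: p; q]).
Hypothesis u_ker : forall w, sigma p q u w = 0.
Let alpha x y := g p (L x y).

Let pqE := elimT (orthonormalP_nth g [:: p; q]) pq.

Lemma derived_coord v : v \in D -> v = g p v *: p + g q v *: q.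
Proof.
rewrite -(span_basis D_pq) span_cons span_seq1 => /memv_addP[_ /vlineP[a ->] [_ /vlineP[b ->] ->]].
have pp : g p p = 1 := @pqE 0 0 isT isT; have pq0 : g p q = 0 := @pqE 0 1 isT isT.
have qp : g q p = 0 := @pqE 1 0 isT isT; have qq : g q q = 1 := @pqE 1 1 isT isT.
by rewrite !linearD !linearZ /= pp pq0 qp qq !mulr0 !mulr1 addr0 add0r.
Qed.

(** The bracket lies in D. Its q-component is lost because q is repeated, and moving q past v and w
    costs no sign. *)
Lemma psi_bracket x y v w : psi [tuple L x y; v; w; q] = alpha x y * sigma p q v w.
Proof.
have psi_head := multilinear_head [tuple v; w; q] (altform_multilinear psi).
have E b : psi [tuple of b :: [tuple v; w; q]] = psi [tuple b; v; w; q].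
  by congr (altform_fun psi _); apply: val_inj.
have := psi_head (alpha x y) p (g q (L x y) *: q).
rewrite !E -derived_coord ?bracket_derived // => ->; rewrite -[RHS]addr0; congr (_ * _ + _).
  have := sigma_skew p v w q; rewrite /sigma => ->.
  have := alternating_tperm psi [tuple p; v; q; w]
    (isT : Ordinal (isT : 1 < 4)%N != Ordinal (isT : 2 < 4)%N) => <-.
  congr (altform_fun psi _); apply: eq_from_tnth => -[[|[|[|[|//]]]] mp];
  by rewrite tnth_mktuple permE.
have := psi_head (g q (L x y)) q 0; rewrite addr0 !E => ->.
have := psi_head (-1) 0 0; rewrite scaler0 addr0 !E mulN1r addNr => ->; rewrite addr0.
rewrite (_ : psi _ = 0) ?mulr0 //.
exact: (altform_alternating psi (x := [tuple q; v; w; q])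
  (i := Ordinal (isT : 0 < 4)%N) (j := Ordinal (isT : 3 < 4)%N)).
Qed.

Lemma q_derived : q \in D.
Proof. by rewrite (basis_mem D_pq) // !inE eqxx orbT. Qed.

(* Contracting d psi = 0 with q and u leaves alpha(u, .) /\ sigma = 0. *)
Lemma closed_contract x y w : alpha u x * sigma p q y w - alpha u y * sigma p q x w
  + alpha u w * sigma p q x y = 0.
Proof.
have psi0 a b c : psi [tuple 0; a; b; c] = 0.
  have := multilinear_head [tuple a; b; c] (altform_multilinear psi) (-1) 0 0.
  have -> : [tuple of 0 :: [tuple a; b; c]] = [tuple 0; a; b; c] by apply: val_inj.
  rewrite scaler0 addr0 mulN1r addNr => <-.
  by congr (altform_fun psi _); apply: val_inj.
have := psi_closed [tuple u; x; y; w; q]; rewrite ce_diff4 !psi_bracket.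
rewrite ![L _ q]bracket_centralr ?q_derived // !psi0 !u_ker; lra.
Qed.

Lemma alpha_eq0 x : alpha u x = 0.
Proof.
have [//|ax] := eqVneq (alpha u x) 0; exfalso.
have as_ : scalar (alpha u) by move=> c v w; rewrite /alpha linearPr linearP.
have [K KE] := kernel_space as_.
have pqK : {subset [:: p; q] <= K}.
  move=> v /(basis_mem D_pq); rewrite KE /alpha => vD.
  by rewrite bracket_centralr // linear0.
(* K is a hyperplane containing D, so p, q extend to an orthonormal basis of K and by a single
   further vector, orthogonal to K, to one of V. *)
have [t [ot bt]] := orthonormal_extend pq pqK.
have xt : basis_of fullv (x :: [:: p; q] ++ t).
  apply: (cons_basis (memvf x) (subvf K)) bt => [|w _]; first by rewrite KE.
  exists (alpha u w / alpha u x); rewrite KE addrC -scaleNr as_ mulNr divfK //.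
  by rewrite addNr.
have st : size t = 4%N.
  by have := size_basis (X := in_tuple _) xt; rewrite dV /= => -[].
have [s [os bs]] := orthonormal_extend ot (fun v _ => memvf v).
have ss : size s = 1%N.
  have := size_basis (X := in_tuple _) bs; rewrite dV size_cat /= st => /eqP.
  by rewrite -[7%N]/(6 + 1)%N eqn_add2l => /eqP.
have eP : size (([:: p; q] ++ t) ++ s) == 7%N by rewrite !size_cat /= st ss.
pose e := Tuple eP; have oe : orthonormal g e := os; have be : basis_of fullv e := bs.
have eK (k : 'I_7) : k != ord_max -> tnth e k \in K.
  move=> k6; have k_lt : (k < 6)%N by rewrite ltn_neqAle [(k <= 6)%N](ltn_ord k) andbT; exact: k6.
  have k_lt' : (k < size ([:: p; q] ++ t))%N by rewrite size_cat /= st.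
  rewrite (tnth_nth 0) -[tval e]/(([:: p; q] ++ t) ++ s) nth_cat k_lt'.
  exact: (basis_mem bt (mem_nth 0 k_lt')).
have vol0 : vol e != 0 by have [v1 _] := phi_induced; rewrite -normr_gt0 v1 // ltr01.
have sig0 (k l : 'I_7) : k != ord_max -> l != ord_max ->
    psi [tuple tnth e (@Ordinal 7 0 isT); tnth e (@Ordinal 7 1 isT); tnth e k; tnth e l] = 0.
  move=> /eK + /eK; rewrite !KE => /eqP ak /eqP al.
  have := closed_contract x (tnth e k) (tnth e l); rewrite ak al !mul0r subr0 addr0.
  by move/eqP; rewrite mulf_eq0 (negPf ax) => /eqP.
have phi0 (a b : 'I_7) : (1 < a)%N -> (1 < b)%N ->
    phi [tuple tnth e ord_max; tnth e a; tnth e b] = 0.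
  move=> a1 b1; have [->|a6] := eqVneq a ord_max.
    by have [] := tuple_tperm3 phi (tnth e ord_max) (tnth e ord_max) (tnth e b); lra.
  have [->|b6] := eqVneq b ord_max.
    by have [_] := tuple_tperm3 phi (tnth e ord_max) (tnth e a) (tnth e ord_max); lra.
  have [->|ab] := eqVneq a b.
    have [E1 _] := tuple_tperm3 phi (tnth e ord_max) (tnth e b) (tnth e b).
    have [_ E2] := tuple_tperm3 phi (tnth e b) (tnth e ord_max) (tnth e b).
    lra.
  refine (hodge_dual_eq0 psi_dual oe be vol0 _ sig0).
  move: a1 b1 a6 b6 ab; clear; rewrite /= !inE -!val_eqE /=; lia.
have dens0 := G2_degenerate_density (o := ord_max) isT phi0.
have [_ /(_ (tnth e ord_max) (tnth e ord_max) e)] := phi_induced.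
rewrite dens0 mulr0 => /eqP; rewrite mulf_eq0 (negPf vol0) orbF.
by rewrite (orthonormal_tnth oe) eqxx oner_eq0.
Qed.

End Pair.

Lemma central_vector : \dim D = 2%N -> exists u, u \notin D /\ forall x, L u x = 0.
Proof.
move=> dD; have [|s [/= os bs]] := @orthonormal_extend _ _ g D [::] isT; first by [].
have ss := size_basis (X := in_tuple s) bs; rewrite dD /= in ss.
case: s ss os bs => [|p [|q []]] // _ opq bpq.
have oqp : orthonormal g [:: q; p].
  have H := elimT (orthonormalP_nth _ _) opq; apply/orthonormalP_nth => -[|[|i]] [|[|j]] //= _ _.
  - exact: (@H 1%N 1%N).
  - exact: (@H 1%N 0%N).
  - exact: (@H 0%N 1%N).
  - exact: (@H 0%N 0%N).
have bqp : basis_of D [:: q; p].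
  by rewrite (perm_basis (Y := [:: p; q])) // (perm_catC [:: q] [:: p]).
have [r [X [rX bX BX]]] := symplectic_basis (sigma_scalar_r p q) (sigma_scalar_l p q)
  (sigma_alt p q) (D^C)%VS.
have sX : size X = 5%N by rewrite -(size_basis (X := in_tuple X) bX) dimv_compl dV dD.
(* At most two pairs fit into five vectors, so the last one is in the radical of sigma on the
   complement. On D itself sigma vanishes by alternation. *)
pose u := X`_4.
have uC : u \in (D^C)%VS by rewrite (basis_mem bX) // mem_nth // sX.
have u0 : u != 0 by rewrite free_nth_neq0 ?(basis_free bX) // sX.
have uD : u \notin D.
  apply: contra u0 => uD; rewrite -memv0 -(capv_compl D) memv_cap uD.
  exact: uC.
have u_ker w : sigma p q u w = 0.
  have : w \in (D + D^C)%VS by rewrite addv_complf memvf.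
  case/memv_addP => w1 w1D [w2 w2C ->].
  have := sigma_scalar_r p q u 1 w1 w2; rewrite scale1r mul1r => ->.
  rewrite (scalar_basis (sigma_scalar_r p q u) bpq _ w1D) ?add0r => [|[|[|i]] //= _].
  - apply: (scalar_basis (sigma_scalar_r p q u) bX _ w2C) => i; rewrite sX => i5.
    have [->|i4] := eqVneq i 4%N; first exact: sigma_alt.
    rewrite sigma_skew BX ?sX; last by move: i4 i5; clear; lia.
    by rewrite (_ : [&& _, _ & _] = false) ?oppr0 //; rewrite sX in rX; move: rX i4 i5; clear; lia.
  - exact: (altform_alternating psi (x := [tuple p; q; u; p])
      (i := Ordinal (isT : 0 < 4)%N) (j := Ordinal (isT : 3 < 4)%N)).
  - exact: (altform_alternating psi (x := [tuple p; q; u; q])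
      (i := Ordinal (isT : 1 < 4)%N) (j := Ordinal (isT : 3 < 4)%N)).
(* With p and q exchanged, the same argument removes the other component of [u, x]. *)
have u_ker' w : sigma q p u w = 0.
  have := alternating_tperm psi [tuple p; q; u; w]
    (isT : Ordinal (isT : 0 < 4)%N != Ordinal (isT : 1 < 4)%N).
  rewrite -[psi [tuple p; q; u; w]]/(sigma p q u w) u_ker oppr0 => <-.
  congr (altform_fun psi _); apply: eq_from_tnth => -[[|[|[|[|//]]]] mp];
  by rewrite tnth_mktuple permE.
exists u; split=> // x.
rewrite (derived_coord opq bpq (bracket_derived L u x)).
by rewrite (alpha_eq0 opq bpq u_ker) (alpha_eq0 oqp bqp u_ker') !scale0r addr0.
Qed.

End CentralVector.

Theorem corollary1p2 (R : realType) (V : vectType R) (L : lie_algebra V) :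
  \dim {:V} = 7%N ->
  two_step_nilpotent L ->
  (exists phi : altform V 3, G2_structure phi /\ coclosed L phi) ->
  exists phi : altform V 3,
    [/\ G2_structure phi,
        coclosed L phi
      & exists (g : {dot V for idfun}) (vol : altform V 7),
          G2_induced phi g vol /\ nilsoliton L g].
Proof.
move=> dV L2 [phi [_ [g [vol [psi [induced dual closed]]]]]].
have dD0 := derived_neq0 L2; have := dim_derived L2 dV.
case dD : (\dim (derived_space L)) dD0 => [|[|[|[|]]]] // _ _.
- exact: (model_dim_derived1 dV L2 dD).
- have [u [uD u_central]] := central_vector dV L2 induced dual closed dD.
  by apply: (model_dim_derived23 dV L2 (u := u)); right.
- by apply: (model_dim_derived23 dV L2 (u := 0)); left.
Qed.
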